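(* Let $n\geqslant 3$ and $0<\alpha\leqslant 2$. The space $\mathcal E_\alpha^b(\mathbb R^n)$ of all bounded signed Radon measures of finite standard $\alpha$-Riesz energy is dense in the pre-Hilbert space $\dot{\mathcal E}_\alpha(\mathbb R^n)$ of all signed Radon measures of finite weak $\alpha$-Riesz energy, both in the topology determined by the weak energy norm $\|\cdot\|^{\cdot}_\alpha$ and in the (induced) vague topology.
   Context: $m$ denotes $n$-dimensional Lebesgue measure. For $\beta\in(0,n)$ let $\kappa_\beta(x,y)=|x-y|^{\beta-n}$ on $\mathbb R^n\times\mathbb R^n$, and for a Radon measure $\nu$ let $\kappa_\beta\nu(x)=\int\kappa_\beta(x,y)\,d\nu(y)=\kappa_\beta\nu^+(x)-\kappa_\beta\nu^-(x)$ wherever at least one of the two terms is finite. $\mathfrak M(\mathbb R^n)$ is the space of real-valued (signed) Radon measures $\mu$ on $\mathbb R^n$ (i.e. real continuous linear functionals on the space $C_0(\mathbb R^n)$ of continuous functions with compact support), with Hahn–Jordan decomposition $\mu=\mu^+-\mu^-$ and $|\mu|=\mu^++\mu^-$. Standing convention: only measures with $\kappa_\alpha|\mu|\not\equiv+\infty$ are considered (this implies that $\kappa_{\alpha/2}|\mu|$ is finite $m$-a.e., so that $\kappa_{\alpha/2}\mu$ is well defined $m$-a.e.). The vague topology is the topology of pointwise convergence on $C_0(\mathbb R^n)$. A measure $\mu$ is bounded if $|\mu|(\mathbb R^n)<\infty$. Standard energy: $E_\alpha(\mu)=\iint\kappa_\alpha(x,y)\,d\mu(x)\,d\mu(y)$;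 $\mathcal E_\alpha(\mathbb R^n)$ is the set of $\mu$ with finite standard energy, meaning that $E_\alpha(\mu^+)$, $E_\alpha(\mu^-)$ and $\iint\kappa_\alpha\,d\mu^+\,d\mu^-$ are all finite (equivalently $E_\alpha(|\mu|)<\infty$). $\mathcal E_\alpha^b(\mathbb R^n)$ is the subspace of bounded elements of $\mathcal E_\alpha(\mathbb R^n)$. Weak energy: $\mu\in\mathfrak M(\mathbb R^n)$ has finite weak $\alpha$-Riesz energy if $\kappa_{\alpha/2}\mu\in L^2(m)$, and then $\dot E_\alpha(\mu)=\int(\kappa_{\alpha/2}\mu)^2\,dm$. $\dot{\mathcal E}_\alpha(\mathbb R^n)$ is the set of such $\mu$; it contains $\mathcal E_\alpha(\mathbb R^n)$ and is a pre-Hilbert space with norm $\|\mu\|^{\cdot}_\alpha=\sqrt{\dot E_\alpha(\mu)}$. *)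

(* Defs.v *)
From HB Require Import structures.
From mathcomp Require Import all_boot all_order all_algebra.
From mathcomp Require Import all_classical all_reals all_analysis.
From mathcomp Require Import measurable_realfun.
From mathcomp Require Import lra.
Set Implicit Arguments.
Unset Strict Implicit.
Unset Printing Implicit Defensive.
Import Order.TTheory GRing.Theory Num.Theory.
Import numFieldNormedType.Exports.
Local Open Scope classical_set_scope.
Local Open Scope ring_scope.

(* R^n is 'rV[R]_n with its library topology and its Borel sigma-algebra. *)
Section borel_rV.
Context (R : realType) (n : nat).

HB.instance Definition _ := @isMeasurable.Build
  (sigma_display (@open 'rV[R]_n)) 'rV[R]_n <<s (@open 'rV[R]_n) >>
  (@sigma_algebra0 _ setT _) (@sigma_algebraC _ _) (@sigma_algebra_bigcup _ setT _).

End borel_rV.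

Section borel_rV_lemmas.
Context (R : realType) (n : nat).

Lemma open_measurable_rV (A : set 'rV[R]_n) : open A -> measurable A.
Proof. by move=> oA; apply: sub_sigma_algebra. Qed.

Lemma measurable_coord_rV (i : 'I_n) :
  measurable_fun setT (fun v : 'rV[R]_n => v ord0 i).
Proof.
apply: (measurability _ (RGenOInfty.measurableE R)) => //.
move=> _ [_ [a ->] <-].
rewrite setTI; apply: open_measurable_rV.
apply: open_comp; last exact: interval_open.
by move=> v _; exact: coord_continuous.
Qed.

Lemma measurable_fun_rV d (T : measurableType d) (f : T -> 'rV[R]_n) :
  (forall i, measurable_fun setT (fun t => f t ord0 i)) -> measurable_fun setT f.
Proof.
move=> mf; apply: (@measurability _ _ _ _ _ f (@open 'rV[R]_n)) => //.
move=> _ [U oU <-]; rewrite setTI.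
pose Q (q : 'rV[rat]_n * nat) : 'rV[R]_n := map_mx ratr q.1.
pose I := [set q : 'rV[rat]_n * nat | ball (Q q) q.2.+1%:R^-1 `<=` U].
have -> : f @^-1` U = \bigcup_(q in I) f @^-1` ball (Q q) q.2.+1%:R^-1.
  apply/seteqP; split=> [t Uft|t [q Iq]]; last exact: Iq.
  have /nbhs_ballP[e /= e0 eU] : nbhs (f t) U by exact: open_nbhs_nbhs.
  have [k ke] : exists k, k.+1%:R^-1 < e / 2.
    have [k _ /(_ k (leqnn _)) kP] :=
      near_infty_natSinv_lt (PosNum (divr_gt0 e0 (ltr0Sn _ 1))).
    by exists k.
  have k0 : 0 < k.+1%:R^-1 :> R by rewrite invr_gt0.
  have /choice[r rP] : forall i, exists r : rat,
      ball (ratr r : R) k.+1%:R^-1 (f t ord0 i).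
    move=> i; have : f t ord0 i - k.+1%:R^-1 < f t ord0 i + k.+1%:R^-1.
      by rewrite ltrD2l; apply: lt_trans k0; rewrite oppr_lt0.
    move=> /rat_in_itvoo[r]; rewrite in_itv/= => /andP[r1 r2].
    by exists r; rewrite /ball/= ltr_distl r1 r2.
  have fQ : ball (Q (\row_i r i, k)) k.+1%:R^-1 (f t).
    by split=> // i j; rewrite !mxE (ord1 i); exact: rP.
  exists (\row_i r i, k) => //= z Qz; apply: eU.
  rewrite (splitr e); apply: ball_triangle.
    by apply: ball_sym; apply: le_ball fQ; exact: ltW.
  by apply: le_ball Qz; exact: ltW.
rewrite (_ : \bigcup_(q in I) _ =
    \bigcup_q (if q \in I then f @^-1` ball (Q q) q.2.+1%:R^-1 else set0)).
  apply: countable_bigcupT_measurable => [|q]; first exact: countableP.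
  case: ifPn => // _; set r := q.2.+1%:R^-1; set v := Q q.
  have r0 : 0 < r :> R by rewrite invr_gt0.
  rewrite (_ : _ @^-1` _ = \bigcap_(i in [set: 'I_n])
      (fun t => f t ord0 i) @^-1` ball (v ord0 i) r).
    apply: fin_bigcap_measurable => // i _; rewrite -[X in measurable X]setTI.
    by apply: mf => //; apply: open_measurable; exact: ball_open.
  apply/seteqP; split=> [t [_ vt] i _|t vt]; first exact: vt.
  by split=> // i j; rewrite (ord1 i); exact: vt.
apply/seteqP; split=> [t [q Iq qt]|t [q _]].
  by exists q => //; rewrite mem_set.
by case: ifPn => // /set_mem Iq qt; exists q.
Qed.
End borel_rV_lemmas.

Section lebesgue_rV.
Context (R : realType).
Local Open Scope ereal_scope.

Definition cons_rV n (p : R * 'rV[R]_n) : 'rV[R]_n.+1 :=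
  \row_i oapp (p.2 ord0) p.1 (unlift ord0 i).

Definition uncons_rV n (v : 'rV[R]_n.+1) : R * 'rV[R]_n :=
  (v ord0 ord0, \row_j v ord0 (lift ord0 j)).

Lemma cons_rVK n : cancel (@cons_rV n) (@uncons_rV n).
Proof.
move=> [a v]; rewrite /uncons_rV !mxE unlift_none; congr pair.
by apply/rowP => j; rewrite !mxE liftK.
Qed.

Lemma measurable_cons_rV n : measurable_fun setT (@cons_rV n).
Proof.
apply: measurable_fun_rV => i.
under eq_fun do rewrite mxE.
case: unliftP => [j _|_] /=; last exact: measurable_fst.
by apply: (measurableT_comp (measurable_coord_rV j)); exact: measurable_snd.
Qed.

Lemma measurable_uncons_rV n : measurable_fun setT (@uncons_rV n).
Proof.
apply: measurable_fun_pair; first exact: measurable_coord_rV.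
apply: measurable_fun_rV => i; under eq_fun do rewrite mxE.
exact: measurable_coord_rV.
Qed.

Section step.
Context n (m : {sigma_finite_measure set 'rV[R]_n -> \bar R}).

Definition lebesgue_cons : set 'rV[R]_n.+1 -> \bar R :=
  pushforward (@lebesgue_measure R \x m) (@cons_rV n).

Let pushm : {measure set 'rV[R]_n.+1 -> \bar R} :=
  measure_function_pushforward__canonical__measure_function_Measure
    (@lebesgue_measure R \x m)%E (@measurable_cons_rV n).

Let lebesgue_cons0 : lebesgue_cons set0 = 0.
Proof. exact: (measure0 pushm). Qed.

Let lebesgue_cons_ge0 A : 0 <= lebesgue_cons A.
Proof. exact: (measure_ge0 pushm). Qed.

Let lebesgue_cons_sigma_additive : semi_sigma_additive lebesgue_cons.
Proof. exact: (@measure_semi_sigma_additive _ _ _ pushm). Qed.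

HB.instance Definition _ := isMeasure.Build _ _ _ lebesgue_cons
  lebesgue_cons0 lebesgue_cons_ge0 lebesgue_cons_sigma_additive.

Let sigma_finite_lebesgue_cons : sigma_finite setT lebesgue_cons.
Proof.
have /sigma_finiteP[F [FT ndF Foo]] := sigma_finiteT (@lebesgue_measure R).
have /sigma_finiteP[G [GT ndG Goo]] := sigma_finiteT m.
exists (fun k => @uncons_rV n @^-1` (F k `*` G k)).
  apply/esym; rewrite -subTset => v _.
  have [i _ Fi] : (\bigcup_i F i) (v ord0 ord0) by rewrite -FT.
  have [j _ Gj] : (\bigcup_i G i) (\row_k v ord0 (lift ord0 k)) by rewrite -GT.
  exists (maxn i j) => //; split => /=.
  - by move: Fi; apply/subsetPset/ndF/leq_maxl.
  - by move: Gj; apply/subsetPset/ndG/leq_maxr.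
move=> k; have [mF Fkoo] := Foo k; have [mG Gkoo] := Goo k; split.
  rewrite -[X in measurable X]setTI; apply: measurable_uncons_rV => //.
  exact: measurableX.
rewrite /lebesgue_cons /pushforward -comp_preimage.
rewrite (_ : _ \o _ = id) ?product_measure1E//; last first.
  by apply/funext => p; exact: cons_rVK.
by rewrite lte_mul_pinfty// ge0_fin_numE.
Qed.

HB.instance Definition _ := @Measure_isSigmaFinite.Build _ _ _ lebesgue_cons
  sigma_finite_lebesgue_cons.
End step.

Fixpoint lebesgue_rV n : {sigma_finite_measure set 'rV[R]_n -> \bar R} :=
  if n is n'.+1 then lebesgue_cons (lebesgue_rV n') else \d_(0%R : 'rV[R]_0).

Lemma lebesgue_rV_box n (A : 'I_n -> set R) : (forall i, measurable (A i)) ->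
  lebesgue_rV n [set v | forall i, A i (v ord0 i)] =
  \prod_(i < n) lebesgue_measure (A i).
Proof.
elim: n A => [|n ih] A mA.
  by rewrite big_ord0 /= diracE mem_set//= => -[].
have mB : measurable [set v : 'rV[R]_n | forall i, A (lift ord0 i) (v ord0 i)].
  rewrite (_ : mkset _ = \bigcap_(i in [set: 'I_n])
      (fun v : 'rV[R]_n => v ord0 i) @^-1` A (lift ord0 i)); last first.
    by apply/seteqP; split=> v /= vA i; [move=> _|]; exact: vA.
  apply: fin_bigcap_measurable => // i _; rewrite -[X in measurable X]setTI.
  exact: measurable_coord_rV.
rewrite big_ord_recl -(ih (fun i => A (lift ord0 i)))//.
rewrite /= /lebesgue_cons /pushforward -product_measure1E//.
congr (_ _); apply/seteqP; split=> [[a v] /= avA|[a v] /= [aA vA] i].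
  split; first by have := avA ord0; rewrite mxE unlift_none.
  by move=> i; have := avA (lift ord0 i); rewrite mxE liftK.
by rewrite mxE; case: unliftP => [j ->|->] //=.
exact: mA.
Qed.

End lebesgue_rV.

Section jordan.
Context d (T : measurableType d) (R : realType).
Local Open Scope ereal_scope.
Implicit Types p q : {measure set T -> \bar R}.

Definition mutually_singular p q :=
  exists A, [/\ measurable A, p A = 0 & q (~` A) = 0].

Lemma jordan_sigma_finite p q (F : (set T)^nat) :
    \bigcup_k F k = setT -> (forall k, measurable (F k)) ->
    (forall k, p (F k) < +oo) -> (forall k, q (F k) < +oo) ->
  exists s t : {measure set T -> \bar R},
    [/\ mutually_singular s t,
        forall A, measurable A -> s A + q A = t A + p A,
        forall A, measurable A -> s A <= p A &
        forall A, measurable A -> t A <= q A].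
Proof.
move=> FT mF pF qF; pose D := seqDU F.
have mD k : measurable (D k) by exact: seqDU_measurable.
have DT : \bigcup_k D k = setT by rewrite -seqDU_bigcup_eq.
have fin_D (m : {measure set T -> \bar R}) : (forall k, m (F k) < +oo) ->
    forall k, m (D k) < +oo.
  move=> mFoo k; apply: le_lt_trans (mFoo k).
  by apply: le_measure; rewrite ?inE//; exact: subset_seqDU.
have pD := fin_D p pF; have qD := fin_D q qF.
have sumD (m : {measure set T -> \bar R}) A : measurable A ->
    m A = \sum_(k <oo) m (A `&` D k).
  move=> mA; rewrite -[in LHS](setIT A) -DT setI_bigcupr measure_semi_bigcup//.
  - by move=> k; exact: measurableI.
  - by apply: trivIset_setIl; exact: trivIset_seqDU.
  - by apply: bigcup_measurable => k _; exact: measurableI.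
pose nu k : {charge set T -> \bar R} :=
  cadd (charge_of_finite_measure (mfrestr (mD k) (pD k)))
       (copp (charge_of_finite_measure (mfrestr (mD k) (qD k)))).
have nuE k A : nu k A = p (A `&` D k) - q (A `&` D k) by [].
have /choice[PN hPN] k : exists PN : set T * set T,
    hahn_decomposition (nu k) PN.1 PN.2.
  by have [P [N h]] := Hahn_decomposition (nu k); exists (P, N).
pose s k : {measure set T -> \bar R} := jordan_pos (hPN k).
pose t k : {measure set T -> \bar R} := jordan_neg (hPN k).
have mP k : measurable (PN k).1 by have [[]] := hPN k.
have mN k : measurable (PN k).2 by have [_ []] := hPN k.
have sE k A : measurable A -> s k A = nu k (A `&` (PN k).1).
  move=> mA; rewrite -[LHS]/(if A \in measurable then _ else 0).
  by rewrite mem_set.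
have tE k A : measurable A -> t k A = - nu k (A `&` (PN k).2).
  move=> mA; rewrite -[LHS]/(-1%:E * if A \in measurable then _ else 0).
  by rewrite mem_set// mulN1e.
have finp k A : measurable A -> p (A `&` D k) \is a fin_num.
  move=> mA; rewrite ge0_fin_numE//; apply: le_lt_trans (pD k).
  by apply: le_measure; rewrite ?inE//; exact: measurableI.
have finq k A : measurable A -> q (A `&` D k) \is a fin_num.
  move=> mA; rewrite ge0_fin_numE//; apply: le_lt_trans (qD k).
  by apply: le_measure; rewrite ?inE//; exact: measurableI.
have stE k A : measurable A ->
    s k A + q (A `&` D k) = t k A + p (A `&` D k).
  move=> mA; have nuA : nu k A = s k A - t k A.
    by rewrite (jordan_decomp (hPN k) mA) -[LHS]/(s k A + -1%:E * t k A) mulN1e.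
  have fs : s k A \is a fin_num by exact: fin_num_measure.
  have ft : t k A \is a fin_num by exact: fin_num_measure.
  move: nuA; rewrite nuE.
  move: fs ft (finp k _ mA) (finq k _ mA).
  case: (s k A) => // a _; case: (t k A) => // b _.
  case: (p _) => // u _; case: (q _) => // v _.
  by rewrite -!EFinB -!EFinD => -[] ab; congr EFin; lra.
have s_le k A : measurable A -> s k A <= p (A `&` D k).
  move=> mA; rewrite sE// nuE.
  apply: (@le_trans _ _ (p (A `&` (PN k).1 `&` D k))).
    by rewrite leeBlDr ?leeDl// finq//; exact: measurableI.
  apply: le_measure; rewrite ?inE; last by apply: setSI; exact: subIsetl.
    by apply: measurableI => //; exact: measurableI.
  exact: measurableI.
have t_le k A : measurable A -> t k A <= q (A `&` D k).
  move=> mA; rewrite tE// nuE.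
  rewrite fin_num_oppeB; last by apply: finq; exact: measurableI.
  rewrite addeC; apply: (@le_trans _ _ (q (A `&` (PN k).2 `&` D k))).
    by rewrite leeBlDr ?leeDl// finp//; exact: measurableI.
  apply: le_measure; rewrite ?inE; last by apply: setSI; exact: subIsetl.
    by apply: measurableI => //; exact: measurableI.
  exact: measurableI.
have mA0 : measurable (\bigcup_k (D k `&` (PN k).2)).
  by apply: bigcup_measurable => k _; exact: measurableI.
exists (mseries s 0), (mseries t 0); split.
- exists (\bigcup_k (D k `&` (PN k).2)); split.
  + exact: mA0.
  + rewrite /= /mseries eseries0// => k _ _; rewrite -/(s k _) sE// nuE.
    rewrite (_ : _ `&` D k = set0) ?measure0 ?subee//.
    rewrite -subset0 => x [[[j _ [Dj Nj]] Pk] Dk].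
    have jk : j = k by apply: (@trivIset_seqDU _ F) => //; exists x.
    by have [_ _ _ <-] := hPN k; split=> //; rewrite -jk.
  + rewrite /= /mseries eseries0// => k _ _; rewrite -/(t k _) tE ?nuE; last first.
      exact: measurableC.
    rewrite (_ : _ `&` D k = set0) ?measure0 ?subee ?oppe0//.
    by rewrite -subset0 => x [[nA Nk] Dk]; apply: nA; exists k.
- move=> A mA; rewrite (sumD p)// (sumD q)// /mseries.
  by rewrite -!nneseriesD//; apply: eq_eseriesr => k _; exact: stE.
- move=> A mA; rewrite (sumD p)//; apply: lee_nneseries => // k _.
  exact: s_le.
- move=> A mA; rewrite (sumD q)//; apply: lee_nneseries => // k _.
  exact: t_le.
Qed.
End jordan.

Section signed_radon.
Context (R : realType) (n : nat).
Local Open Scope ereal_scope.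
Implicit Types (p q : {measure set 'rV[R]_n -> \bar R}).

(* On R^n the positive Radon measures are the locally finite Borel measures. *)
Definition radon p := forall K, compact K -> p K < +oo.

(* A signed Radon measure mu, i.e. a continuous linear functional on C_c(R^n),
   is represented by its Hahn-Jordan decomposition mu = mu_pos - mu_neg; both
   parts may have infinite total mass, so mu need not be a set function on all
   Borel sets. *)
Record signed_radon := SignedRadon {
  mu_pos : {measure set 'rV[R]_n -> \bar R};
  mu_neg : {measure set 'rV[R]_n -> \bar R};
  mu_pos_radon : radon mu_pos;
  mu_neg_radon : radon mu_neg;
  mu_singular : mutually_singular mu_pos mu_neg }.

HB.instance Definition _ := gen_eqMixin signed_radon.
HB.instance Definition _ := gen_choiceMixin signed_radon.

Lemma hahn_jordan p q : radon p -> radon q ->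
  exists s : signed_radon, forall A, measurable A ->
    mu_pos s A + q A = mu_neg s A + p A.
Proof.
move=> rp rq.
pose F k : set 'rV[R]_n := [set v | (`|v| <= k%:R)%R].
have Fcl k : closed (F k).
  apply: (@preimage_closed _ _ (fun v : 'rV[R]_n => `|v|%R)
    [set x | (x <= k%:R)%R]); last exact: closed_le.
  by move=> v _; exact: norm_continuous.
have Fco k : compact (F k).
  apply: bounded_closed_compact; last exact: Fcl.
  exists k%:R; split; first exact: num_real.
  by move=> x kx v Fv; exact: le_trans Fv (ltW kx).
have mF k : measurable (F k).
  rewrite -[F k]setCK; apply: measurableC; apply: open_measurable_rV.
  exact: closed_openC.
have FT : \bigcup_k F k = setT.
  rewrite -subTset => v _; exists (Num.trunc `|v|).+1 => //=.
  by rewrite /F/=; apply/ltW; rewrite truncnS_gt.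
have [s [t [st stE sp tq]]] := jordan_sigma_finite FT mF
  (fun k => rp _ (Fco k)) (fun k => rq _ (Fco k)).
have mK (K : set 'rV[R]_n) : compact K -> measurable K.
  move=> cK; rewrite -[K]setCK; apply: measurableC; apply: open_measurable_rV.
  apply: closed_openC.
  by apply: compact_closed => //; exact: norm_hausdorff.
have rs : radon s by move=> K cK; exact: le_lt_trans (sp _ (mK _ cK)) (rp _ cK).
have rt : radon t by move=> K cK; exact: le_lt_trans (tq _ (mK _ cK)) (rq _ cK).
by exists (SignedRadon rs rt st).
Qed.

Lemma radon_add p q : radon p -> radon q -> radon (measure_add p q).
Proof.
by move=> rp rq K cK; rewrite [ltLHS]measure_addE lte_add_pinfty ?rp ?rq.
Qed.

(* mu - nu is the signed Radon measure with positive and negative parts s, t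
   such that s + (mu^- + nu^+) = t + (mu^+ + nu^-); being mutually singular and
   locally finite, s and t are determined by this equation. *)
Definition signed_radon_sub (mu nu : signed_radon) : signed_radon :=
  sval (cid (hahn_jordan
    (radon_add (mu_pos_radon mu) (mu_neg_radon nu))
    (radon_add (mu_neg_radon mu) (mu_pos_radon nu)))).

Lemma signed_radon_subE mu nu A : measurable A ->
  mu_pos (signed_radon_sub mu nu) A + (mu_neg mu A + mu_pos nu A) =
  mu_neg (signed_radon_sub mu nu) A + (mu_pos mu A + mu_neg nu A).
Proof.
move=> mA; rewrite /signed_radon_sub; case: cid => s /= /(_ A mA).
by rewrite [X in _ + X = _]measure_addE [X in _ = _ + X]measure_addE.
Qed.

End signed_radon.

Section vague.
Context (R : realType) (n : nat).

Definition compactly_supported (f : 'rV[R]_n -> R) :=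
  exists2 K, compact K & forall x, ~ K x -> f x = 0.

Definition Cc := {f : 'rV[R]_n -> R | continuous f /\ compactly_supported f}.

Definition signed_integral (mu : signed_radon R n) (f : Cc) : R :=
  \int[mu_pos mu]_x sval f x - \int[mu_neg mu]_x sval f x.

End vague.

Section riesz.
Context (R : realType) (n : nat).
Local Open Scope ereal_scope.
Implicit Types (beta alpha : R) (p q : {measure set 'rV[R]_n -> \bar R}).
Implicit Types mu nu : signed_radon R n.

(* The library norm on 'rV[R]_n is the sup norm. *)
Definition enorm (x : 'rV[R]_n) : R := Num.sqrt (\sum_i x ord0 i ^+ 2)%R.

(* The diagonal is treated apart because 0 `^ a = 0 for a < 0. *)
Definition riesz_kernel beta (x y : 'rV[R]_n) : \bar R :=
  if x == y then +oo else (enorm (x - y) `^ (beta - n%:R))%:E.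

Definition potential beta p x := \int[p]_y riesz_kernel beta x y.

Definition mutual_energy alpha p q :=
  \int[p]_x \int[q]_y riesz_kernel alpha x y.

(* For an admissible mu and beta = alpha / 2, both potentials are infinite at
   most on a Lebesgue-null set; there the value is a convention. *)
Definition signed_potential beta mu x :=
  potential beta (mu_pos mu) x - potential beta (mu_neg mu) x.

Definition abs_measure mu := measure_add (mu_pos mu) (mu_neg mu).

(* The standing convention that the potential of |mu| is not identically +oo. *)
Definition admissible alpha mu :=
  exists x, potential alpha (abs_measure mu) x < +oo.

Definition bounded_measure mu := abs_measure mu setT < +oo.

Definition standard_energy_space alpha : set (signed_radon R n) :=
  [set mu | [/\ admissible alpha mu,
    mutual_energy alpha (mu_pos mu) (mu_pos mu) < +oo,
    mutual_energy alpha (mu_neg mu) (mu_neg mu) < +oo &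
    mutual_energy alpha (mu_pos mu) (mu_neg mu) < +oo]].

Definition bounded_energy_space alpha : set (signed_radon R n) :=
  standard_energy_space alpha `&` [set mu | bounded_measure mu].

Definition weak_energy alpha mu :=
  \int[lebesgue_rV R n]_x (signed_potential (alpha / 2) mu x) ^+ 2.

Definition weak_norm alpha mu := sqrte (weak_energy alpha mu).

Definition weak_energy_space alpha : set (signed_radon R n) :=
  [set mu | admissible alpha mu /\ weak_energy alpha mu < +oo].

End riesz.

Arguments standard_energy_space {R} n alpha.
Arguments bounded_energy_space {R} n alpha.
Arguments weak_energy_space {R} n alpha.

Section topologies.
Context (R : realType) (n : nat).

Definition vague_space := initial_topology
  (@signed_integral R n : signed_radon R n -> {ptws Cc R n -> R}).

HB.instance Definition _ := Topological.on vague_space.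

Context (alpha : R).

Definition weak_vague_space := initial_topology
  (fun mu : weak_energy_space n alpha => val mu : vague_space).

HB.instance Definition _ := Topological.on weak_vague_space.

Definition weak_norm_space : Type := weak_energy_space n alpha.

HB.instance Definition _ := Choice.on weak_norm_space.

Definition weak_norm_open : set_system weak_norm_space :=
  [set O | forall mu, O mu -> exists2 e : R, 0 < e &
    forall nu : weak_norm_space,
      (weak_norm alpha (signed_radon_sub (val nu) (val mu)) < e%:E)%E -> O nu].

Let weak_norm_openT : weak_norm_open setT.
Proof. by move=> mu _; exists 1. Qed.

Let weak_norm_openI : setI_closed weak_norm_open.
Proof.
move=> A B oA oB mu [/oA[a a0 aA] /oB[b b0 bB]].
exists (Num.min a b); first by rewrite lt_min a0.
move=> nu; rewrite EFin_min lt_min => /andP[nua nub].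
by split; [exact: aA|exact: bB].
Qed.

Let weak_norm_open_bigcup (I : Type) (F : I -> set weak_norm_space) :
  (forall i, weak_norm_open (F i)) -> weak_norm_open (\bigcup_i F i).
Proof.
move=> oF mu [i _ /oF[e e0 eF]]; exists e => // nu nue.
by exists i => //; exact: eF.
Qed.

HB.instance Definition _ := isOpenTopological.Build weak_norm_space
  weak_norm_openT weak_norm_openI weak_norm_open_bigcup.

End topologies.

(* Main.v *)
Require Import Defs.
From HB Require Import structures.
From mathcomp Require Import all_boot all_order all_algebra.
From mathcomp Require Import all_classical all_reals all_analysis.
From mathcomp Require Import measurable_realfun.
From mathcomp Require Import ring lra.
Set Implicit Arguments.
Unset Strict Implicit.
Unset Printing Implicit Defensive.
Import Order.TTheory GRing.Theory Num.Theory.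
Import numFieldNormedType.Exports.
Local Open Scope classical_set_scope.
Local Open Scope ring_scope.

(** Call a positive measure tame if it is finite and has a bounded density with
respect to Lebesgue measure. The potentials of a tame measure are bounded, and
those of order $\beta < n / 2$ are square integrable, so every signed measure
with tame parts is bounded and has finite standard and finite weak energy
([tame_bounded_energy], [tame_weak_energy]). Such measures already suffice for
both density statements; no balayage is needed.

Weak energy norm. Let $\beta = \alpha / 2$ and let $f = \kappa_\beta \mu$, an
element of $L^2$. The squared weak norm of $\nu - \mu$ is the squared
$L^2$-distance from $\kappa_\beta \nu$ to $f$, so it is enough that the
functions $\kappa_\beta p - \kappa_\beta q$ with $p$, $q$ tame are dense in
$L^2$ ([approximable_L2]). By the Dynkin pi-lambda theorem and approximation by
simple functions this reduces to indicators of open sets $U$ of finite measure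
([approximable_open]). The Riesz kernel is a superposition
$k \int_0^\infty t^{\beta/2 - 1} P_t\, dt$ of heat kernels
([riesz_subordination]). Applied to a superposition
$\int w(s) P_s 1_U\, ds$ and by the semigroup law, it gives
$\int (I w)(r) P_r 1_U\, dr$, where $I w$ is a constant multiple of the
fractional integral of order $\beta/2$ of $w$. As $0 < \beta/2 < 1$, Abel
inversion provides an integrable $w$, of variable sign, for which $I w$ is a multiple of
$1_{]0, b]}$ ([abel_inversion]). Hence the average over $0 < r < b$ of
$P_r 1_U$ is a difference of potentials of tame measures, and it tends to
$1_U$ in $L^2$ as $b \to 0$. That $\kappa_\beta |\mu|$ is finite almost
everywhere, so that potentials may be subtracted, follows by integrating over
balls ([potential_finite_ae]).

Vague topology. Restrict $\mu$ to a ball and let the two parts flow by the heat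
semigroup for a time $t$: the resulting measures are tame. As $t \to 0$ they
converge vaguely to the restriction of $\mu$, and as the ball grows the
restrictions converge vaguely to $\mu$. Nothing is said about the weak energy of
the restrictions: the two limits are taken in the space of all functionals on
$C_c$, where the closure of a set is closed ([vague_closure]). *)

(** * Measures with a density, affine changes of variable *)

Section density.
Local Open Scope ereal_scope.
Context d (T : measurableType d) (R : realType).
Variables (mu : {measure set T -> \bar R}) (g : T -> R).
Hypotheses (mg : measurable_fun setT g) (g0 : forall x, (0 <= g x)%R).

(** The measure $g \mu$. The hypotheses on $g$ are arguments, so that the
structure of measure can be inferred from the term. *)
Definition density of measurable_fun setT g & (forall x, (0 <= g x)%R) :
  set T -> \bar R := fun A => \int[mu]_(x in A) (g x)%:E.

Local Notation p := (density mg g0).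

Let p0 : p set0 = 0. Proof. by rewrite /density integral_set0. Qed.
Let p_ge0 A : 0 <= p A.
Proof. by apply: integral_ge0 => x _; rewrite lee_fin. Qed.
Let p_sa : semi_sigma_additive p.
Proof.
by apply: semi_sigma_additive_nng_induced; [exact/measurable_EFinP|].
Qed.
HB.instance Definition _ := isMeasure.Build _ _ _ p p0 p_ge0 p_sa.

Import HBNNSimple.

Lemma ge0_integral_density (h : T -> \bar R) :
  measurable_fun setT h -> (forall x, 0 <= h x) ->
  \int[p]_x h x = \int[mu]_x ((g x)%:E * h x).
Proof.
move=> mh h0; pose h_ := nnsfun_approx measurableT mh.
have cvh x : (h_ k x)%:E @[k --> \oo] --> h x by exact: cvg_nnsfun_approx.
have mgE : measurable_fun setT (EFin \o g) by exact/measurable_EFinP.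
transitivity (limn (fun k => \int[p]_x (h_ k x)%:E)).
  rewrite -monotone_convergence//.
  - by apply: eq_integral => x _; apply/esym/cvg_lim => //; exact: cvh.
  - by move=> k; exact/measurable_EFinP/measurable_funP.
  - by move=> k x _; rewrite lee_fin.
  - by move=> x _ a b ab; rewrite lee_fin; exact/lefP/nd_nnsfun_approx.
transitivity (limn (fun k => \int[mu]_x ((g x)%:E * (h_ k x)%:E))); last first.
  rewrite -monotone_convergence//.
  - apply: eq_integral => x _; apply/cvg_lim => //.
    by apply: cvgeZl => //; exact: cvh.
  - move=> k; apply: emeasurable_funM => //.
    exact/measurable_EFinP/measurable_funP.
  - by move=> k x _; rewrite mule_ge0// lee_fin.
  - move=> x _ a b ab; rewrite lee_wpmul2l ?lee_fin//.
    exact/lefP/nd_nnsfun_approx.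
congr (limn _); apply/funext => k.
transitivity (\int[p]_x (\sum_(y \in range (h_ k))
    (y * \1_(h_ k @^-1` [set y]) x)%:E)).
  by apply: eq_integral => x _; rewrite fimfunE -fsumEFin.
rewrite ge0_integral_fsum//; last 2 first.
- by move=> y; exact/measurable_EFinP/measurable_funM.
- by move=> y x _; rewrite nnfun_muleindic_ge0.
transitivity (\int[mu]_x (\sum_(y \in range (h_ k))
    ((g x)%:E * (y * \1_(h_ k @^-1` [set y]) x)%:E))).
  rewrite ge0_integral_fsum//; last 2 first.
  - by move=> y; apply: emeasurable_funM => //;
      exact/measurable_EFinP/measurable_funM.
  - by move=> y x _; rewrite mule_ge0 ?lee_fin// -lee_fin nnfun_muleindic_ge0.
  apply: eq_fsbigr => y; rewrite inE => -[t _ <-{y}].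
  under eq_integral do rewrite EFinM.
  under [RHS]eq_integral do rewrite EFinM muleCA.
  rewrite !ge0_integralZl_EFin//; last 3 first.
  - by move=> x _; rewrite mule_ge0// lee_fin.
  - by apply: emeasurable_funM => //; exact/measurable_EFinP.
  - exact/measurable_EFinP.
  rewrite integral_indic// setIT /= /density integral_mkcond; congr (_ * _).
  by apply: eq_integral => x _; rewrite epatch_indic.
apply: eq_integral => x _.
rewrite [X in _ * X%:E]fimfunE -fsumEFin// ge0_mule_fsumr//.
by move=> y; rewrite nnfun_muleindic_ge0.
Qed.

End density.

Section affine_change.
Local Open Scope ereal_scope.
Context (R : realType).
Local Notation mu := (@lebesgue_measure R).

Variables (c e : R).
Hypothesis c0 : (0 < c)%R.

Let aff : R -> measurableTypeR R := fun t => (c * t + e)%R.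

Let maff : measurable_fun setT aff.
Proof. by apply: measurable_funD => //; exact: mulrl_measurable. Qed.

Lemma lebesgue_measure_affine (A : set R) : measurable A ->
  mu A = c%:E * mu (aff @^-1` A).
Proof.
move=> mA.
pose m1 : {measure set (measurableTypeR R) -> \bar R} :=
  mscale (NngNum (ltW c0))
      (measure_function_pushforward__canonical__measure_function_Measure
        mu maff).
rewrite (@lebesgue_measure_unique _ m1)// => _ [[a b]] _ <-/=.
rewrite /m1 /= /mscale /= /pushforward.
rewrite (_ : aff @^-1` _ = `]((a - e) / c)%R, ((b - e) / c)%R]%classic); last first.
  apply/seteqP; split => x /=; rewrite /aff !in_itv /=.
    by rewrite ltr_pdivrMr// ler_pdivlMr// ltrBlDr lerBrDr mulrC.
  by rewrite ltr_pdivrMr// ler_pdivlMr// ltrBlDr lerBrDr mulrC.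
rewrite !lebesgue_measure_itv/= !lte_fin ltr_pM2r ?invr_gt0// ltrD2r.
case: ifPn => ab; last by rewrite mule0.
by rewrite -!EFinD -EFinM; congr EFin; field; rewrite gt_eqF.
Qed.

Lemma ge0_integral_affine (h : R -> \bar R) :
  measurable_fun setT h -> (forall x, 0 <= h x) ->
  \int[mu]_t h t = c%:E * \int[mu]_t h (c * t + e)%R.
Proof.
move=> mh h0.
have <- : \int[pushforward mu aff]_t h t = \int[mu]_t h (c * t + e)%R.
  by rewrite ge0_integral_pushforward.
pose m1 : {measure set (measurableTypeR R) -> \bar R} :=
  mscale (NngNum (ltW c0))
      (measure_function_pushforward__canonical__measure_function_Measure
        mu maff).
have -> : \int[mu]_t h t = \int[m1]_t h t.
  by apply: eq_measure_integral => A mA _; exact: lebesgue_measure_affine.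
by rewrite ge0_integral_mscale.
Qed.

End affine_change.

Lemma ge0_integral_scale (R : realType) (c : R) (h : R -> \bar R) :
  0 < c -> measurable_fun setT h -> (forall x, (0 <= h x)%E) ->
  (\int[@lebesgue_measure R]_t h t =
   c%:E * \int[@lebesgue_measure R]_t h (c * t)%R)%E.
Proof.
move=> c0 mh h0; rewrite (ge0_integral_affine 0 c0 mh h0).
by congr (_ * _)%E; apply: eq_integral => t _; rewrite addr0.
Qed.

Lemma ge0_integral_shift (R : realType) (e : R) (h : R -> \bar R) :
  measurable_fun setT h -> (forall x, (0 <= h x)%E) ->
  (\int[@lebesgue_measure R]_t h t =
   \int[@lebesgue_measure R]_t h (t + e)%R)%E.
Proof.
move=> mh h0; rewrite (ge0_integral_affine e ltr01 mh h0) mul1e.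
by apply: eq_integral => t _; rewrite mul1r.
Qed.

(** * Integrals of powers and the beta integral *)

Section ge0_integral_bounds.
Local Open Scope ereal_scope.
Context d (T : measurableType d) (R : realType) (mu : {measure set T -> \bar R}).

(** A bound on the integrals over an exhausting sequence passes to the union. *)
Lemma ge0_integral_bigcup_le (F : (set T)^nat) (f : T -> \bar R) (B : \bar R) :
  nondecreasing_seq F -> (forall k, measurable (F k)) ->
  measurable_fun setT f -> (forall x, 0 <= f x) ->
  (forall k, \int[mu]_(x in F k) f x <= B) ->
  \int[mu]_(x in \bigcup_k F k) f x <= B.
Proof.
move=> ndF mF mf f0 FB.
have /cvg_lim <-// : \int[mu]_(x in F i) f x @[i --> \oo] -->
    \int[mu]_(x in \bigcup_i F i) f x.
  by apply: ge0_nondecreasing_set_cvg_integral => // i; exact: measurable_funTS.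
apply: lime_le; last by apply: nearW => k; exact: FB.
apply: ereal_nondecreasing_is_cvgn => i j ij.
apply: ge0_subset_integral => //; first exact: measurable_funTS.
exact/subsetPset/ndF.
Qed.

Lemma integral_gt0 (f : T -> \bar R) (D : set T) :
  measurable D -> 0 < mu D -> measurable_fun setT f -> (forall x, 0 <= f x) ->
  (forall x, D x -> 0 < f x) -> 0 < \int[mu]_x f x.
Proof.
move=> mD D0 mf f0 fD; rewrite lt0e integral_ge0// andbT; apply/eqP => f0E.
have : ae_eq mu setT f (cst 0).
  apply/ae_eq_integral_abs => //.
  by under eq_integral do rewrite gee0_abs//.
move=> [N [mN N0 fN]].
have DN : D `<=` N by move=> x Dx; apply: fN => /= /(_ I) fx; have := fD x Dx; rewrite fx ltxx.
suff : mu D <= 0 by rewrite leNgt D0.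
by rewrite -N0; apply: le_measure; rewrite ?inE.
Qed.

End ge0_integral_bounds.

Section power_weight.
Context (R : realType).
Implicit Types (a t s c : R).
Local Notation leb := (@lebesgue_measure R).

(** The power $t^a$ on the half-line $t > 0$, extended by $0$. *)
Definition pw a t : R := if 0 < t then t `^ a else 0.

Lemma pwE a t : 0 < t -> pw a t = t `^ a. Proof. by rewrite /pw => ->. Qed.
Lemma pw0 a t : t <= 0 -> pw a t = 0. Proof. by rewrite /pw leNgt => /negbTE ->. Qed.
Lemma pw_ge0 a t : 0 <= pw a t.
Proof. by rewrite /pw; case: ifP => // _; exact: powR_ge0. Qed.
Lemma pw_gt0 a t : 0 < t -> 0 < pw a t.
Proof. by move=> t0; rewrite pwE// powR_gt0. Qed.

Lemma measurable_pw a : measurable_fun setT (pw a).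
Proof.
apply: measurable_fun_ifT.
- by apply: measurable_fun_ltr => //; exact: measurable_cst.
- exact: measurable_powR.
- exact: measurable_cst.
Qed.

Lemma pwM a c t : 0 < c -> pw a (c * t) = c `^ a * pw a t.
Proof.
move=> c0; rewrite /pw pmulr_rgt0//; case: ifPn => t0; last by rewrite mulr0.
by rewrite powRM ?ltW.
Qed.

Lemma pwD a b t : pw a t * pw b t = pw (a + b) t.
Proof.
rewrite /pw; case: ifPn => t0; last by rewrite mulr0.
by rewrite powRD// (gt_eqF t0) implybT.
Qed.

Lemma pw_lexp a b t : a <= b -> 1 <= t -> pw a t <= pw b t.
Proof.
move=> ab t1; rewrite !pwE ?(lt_le_trans ltr01)//; exact: ler_powR.
Qed.

Lemma integral_pw_itv a x y : a != -1 -> 0 < x -> x < y ->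
  (\int[leb]_(t in `[x, y]) (pw a t)%:E =
   ((y `^ (a + 1) - x `^ (a + 1)) / (a + 1))%:E)%E.
Proof.
move=> a1 x0 xy.
have a10 : a + 1 != 0 by rewrite addr_eq0.
pose F (t : R) := (a + 1)^-1 * t `^ (a + 1).
transitivity (\int[leb]_(t in `[x, y]) (t `^ a)%:E)%E.
  apply: eq_integral => t; rewrite inE/= in_itv/= => /andP[xt _].
  by rewrite pwE// (lt_le_trans x0).
have dF t : 0 < t -> is_derive t 1 F (t `^ a).
  move=> t0; have h := is_derive1_powR (a + 1) t0.
  rewrite /F; apply: is_derive_eq; rewrite /GRing.scale/= addrK mulrA mulVf//.
  by rewrite mul1r.
have cp b t : 0 < t -> {for t, continuous (fun s : R => s `^ b)}.
  move=> t0; have := is_derive1_powR b t0.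
  by case=> /derivable1_diffP/differentiable_continuous.
rewrite (@continuous_FTC2 _ (fun t => t `^ a) F)//.
- by rewrite /F -EFinB; congr EFin; field.
- apply/continuous_within_itvP => //; split.
  + by move=> t /[!in_itv]/= /andP[xt _]; apply: cp; exact: lt_trans xt.
  + by apply: cvg_at_right_filter; apply: cp.
  + by apply: cvg_at_left_filter; apply: cp; exact: lt_trans xy.
- split.
  + move=> t /[!in_itv]/= /andP[xt _].
    by have := dF t (lt_trans x0 xt) => -[].
  + apply: cvg_at_right_filter.
    by have [/derivable1_diffP/differentiable_continuous] := dF x x0.
  + apply: cvg_at_left_filter.
    by have [/derivable1_diffP/differentiable_continuous] := dF y (lt_trans x0 xy).
- move=> t /[!in_itv]/= /andP[xt _].
  have [d <-] := dF t (lt_trans x0 xt).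
  by rewrite derive1E.
Qed.

Local Open Scope ereal_scope.

Lemma integral_pw_lt1 a : (-1 < a)%R ->
  \int[leb]_(t in `]0%R, 1%R]) (pw a t)%:E < +oo.
Proof.
move=> a1; have a10 : (0 < a + 1)%R by rewrite -ltrBlDr sub0r.
apply: (@le_lt_trans _ _ ((a + 1)^-1)%:E); last exact: ltry.
rewrite (_ : `]0%R, 1%R] = \bigcup_k `[k.+2%:R^-1%R, 1%R])%classic; last first.
  apply/seteqP; split => [t /= | t [k _] /=]; rewrite !in_itv/=.
    move=> /andP[t0 t1]; have [k _ /(_ k (leqnn _)) kP] :=
      near_infty_natSinv_lt (PosNum t0).
    exists k => //=; rewrite in_itv/= t1 andbT.
    apply: le_trans (ltW kP) => /=.
    by rewrite lef_pV2 ?posrE// ler_nat.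
  by move=> /andP[kt ->]; rewrite andbT (lt_le_trans _ kt).
apply: ge0_integral_bigcup_le => //.
- move=> i j ij; apply/subsetPset => t /=; rewrite !in_itv/= => /andP[it ->].
  rewrite andbT (le_trans _ it)// lef_pV2 ?posrE// ler_nat.
  by rewrite !ltnS.
- by apply/measurable_EFinP; exact: measurable_pw.
- by move=> x; rewrite lee_fin pw_ge0.
- move=> k; rewrite integral_pw_itv ?gt_eqF ?invf_lt1 ?ltr1n//.
  rewrite lee_fin powR1 ler_pdivrMr// mulVf ?gt_eqF//.
Qed.

Lemma integral_pw_gt1 a : (a < -1)%R ->
  \int[leb]_(t in `[1%R, +oo[) (pw a t)%:E < +oo.
Proof.
move=> a1; have a10 : (a + 1 < 0)%R by rewrite -ltrBrDr sub0r.
apply: (@le_lt_trans _ _ ((-(a + 1))^-1)%:E); last exact: ltry.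
rewrite (_ : `[1%R, +oo[ = \bigcup_k `[1%R, k.+2%:R%R])%classic; last first.
  apply/seteqP; split => [t /= | t [k _] /=]; rewrite !in_itv/=.
    move=> /andP[t1 _]; exists (Num.trunc t) => //=; rewrite in_itv/= t1/=.
    by apply: le_trans (ltW (truncnS_gt t)) _; rewrite ler_nat.
  by move=> /andP[->].
apply: ge0_integral_bigcup_le => //.
- move=> i j ij; apply/subsetPset => t /=; rewrite !in_itv/= => /andP[-> ti].
  by rewrite /= (le_trans ti)// ler_nat !ltnS.
- by apply/measurable_EFinP; exact: measurable_pw.
- by move=> x; rewrite lee_fin pw_ge0.
- move=> k; rewrite integral_pw_itv ?lt_eqF ?ltr1n//.
  rewrite lee_fin powR1 ler_ndivrMr//.
  rewrite (_ : (- (a + 1))^-1 * (a + 1) = -1)%R; last first.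
    by rewrite invrN mulNr mulVf// lt_eqF.
  by rewrite lerBrDr addNr powR_ge0.
Qed.

End power_weight.

Section beta.
Context (R : realType).
Implicit Types (a b t s c : R).
Local Notation leb := (@lebesgue_measure R).
Local Open Scope ereal_scope.

(** A comparison test, with one power near $0$ and another near infinity. *)
Lemma integral_le_pw_lty (f : R -> R) a b c : (-1 < a)%R -> (b < -1)%R ->
  (0 <= c)%R -> measurable_fun setT f -> (forall t, (0 <= f t)%R) ->
  (forall t, (t <= 1)%R -> (f t <= c * pw a t)%R) ->
  (forall t, (1 <= t)%R -> (f t <= c * pw b t)%R) ->
  \int[leb]_t (f t)%:E < +oo.
Proof.
move=> a1 b1 c0 mf f0 fa fb.
pose D1 : set R := `]0%R, 1%R]%classic; pose D2 : set R := `[1%R, +oo[%classic.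
pose g1 : R -> \bar R := (EFin \o pw a) \_ D1.
pose g2 : R -> \bar R := (EFin \o pw b) \_ D2.
have mpw e : measurable_fun setT (EFin \o @pw R e).
  by apply/measurable_EFinP; exact: measurable_pw.
have mg1 : measurable_fun setT g1.
  apply/(measurable_restrictT (EFin \o pw a)); first exact: measurable_itv.
  exact: measurable_funTS.
have mg2 : measurable_fun setT g2.
  apply/(measurable_restrictT (EFin \o pw b)); first exact: measurable_itv.
  exact: measurable_funTS.
have g10 t : 0 <= g1 t by apply: erestrict_ge0 => x _; rewrite lee_fin pw_ge0.
have g20 t : 0 <= g2 t by apply: erestrict_ge0 => x _; rewrite lee_fin pw_ge0.
apply: (@le_lt_trans _ _ (\int[leb]_t (c%:E * (g1 t + g2 t)))).
  apply: ge0_le_integral => //.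
  - by move=> t _; rewrite lee_fin.
  - by apply/measurable_EFinP.
  - by apply: measurable_funeM; apply: emeasurable_funD.
  - move=> t _; have [t1|t1] := leP t 1%R.
      apply: (@le_trans _ _ (c%:E * (pw a t)%:E)); first by rewrite -EFinM lee_fin fa.
      rewrite lee_wpmul2l ?lee_fin//.
      apply: (@le_trans _ _ (g1 t)); last by rewrite leeDl.
      rewrite /g1 patchE; case: ifPn => //.
      by rewrite notin_setE /D1/= in_itv/= t1 andbT => /negP; rewrite -leNgt => t0; rewrite pw0.
    apply: (@le_trans _ _ (c%:E * (pw b t)%:E)).
      by rewrite -EFinM lee_fin fb// ltW.
    rewrite lee_wpmul2l ?lee_fin//.
    apply: (@le_trans _ _ (g2 t)); last by rewrite leeDr.
    by rewrite /g2 patchE mem_set// /D2/= in_itv/= andbT ltW.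
rewrite ge0_integralZl_EFin//; last 2 first.
- by move=> t _; rewrite adde_ge0.
- by apply: emeasurable_funD.
rewrite ge0_integralD// /g1 /g2 -!integral_mkcond.
rewrite lte_mul_pinfty ?lee_fin// lte_add_pinfty//.
  exact: integral_pw_lt1.
exact: integral_pw_gt1.
Qed.

(** Euler's beta integral in the form of a convolution on the half-line. *)
Lemma beta_convolution a b : (0 < a)%R -> (0 < b)%R ->
  exists2 B : R, (0 < B)%R & forall H : R -> \bar R,
    measurable_fun setT H -> (forall r, 0 <= H r) ->
    \int[leb]_t \int[leb]_s ((pw (a - 1) t * pw (b - 1) s)%:E * H (t + s)%R) =
    B%:E * \int[leb]_r ((pw (a + b - 1) r)%:E * H r).
Proof.
move=> a0 b0.
pose w v : R := (pw (b - 1) v * pw (- (a + b)) (1 + v))%R.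
have w0 v : (0 <= w v)%R by rewrite mulr_ge0 ?pw_ge0.
have mpw e : measurable_fun setT (@pw R e) by exact: measurable_pw.
have mw : measurable_fun setT w.
  apply: measurable_funM; first exact: mpw.
  by apply: (measurableT_comp (mpw _)); apply: measurable_funD.
have wfin : \int[leb]_v (w v)%:E < +oo.
  apply: (@integral_le_pw_lty w (b - 1) (- a - 1) 1%R) => //.
  - by rewrite ltrBrDr addNr.
  - by rewrite ltrBlDr addNr oppr_lt0.
  - move=> t t1; rewrite mul1r /w.
    have [t0|t0] := ltP 0%R t; last by rewrite [pw (b - 1) t]pw0// mul0r.
    rewrite ler_piMr ?pw_ge0// pwE ?addr_gt0//.
    rewrite -[leRHS](powRr0 (1 + t)%R) ler_powR ?oppr_le0 ?addr_ge0 ?ltW//.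
    by rewrite ltrDl.
  - move=> t t1; have t0 : (0 < t)%R by exact: lt_le_trans t1.
    rewrite mul1r /w.
    apply: (@le_trans _ _ (pw (b - 1) t * pw (- (a + b)) t)%R).
      rewrite ler_wpM2l ?pw_ge0// !pwE ?addr_gt0// !powRN.
      rewrite lef_pV2 ?posrE ?powR_gt0 ?addr_gt0//.
      by rewrite ge0_ler_powR ?nnegrE ?addr_ge0 ?ltW// ltrDr.
    by rewrite pwD; apply: pw_lexp => //; lra.
have wpos : 0 < \int[leb]_v (w v)%:E.
  have D0 : 0 < leb `[1%R, 2%R]%classic.
    by rewrite lebesgue_measure_itv/= lte_fin ltr1n -EFinB lte_fin subr_gt0 ltr1n.
  apply: (@integral_gt0 _ _ _ leb _ `[1%R, 2%R]%classic) => //.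
  - by apply/measurable_EFinP.
  - move=> v /=; rewrite in_itv/= => /andP[v1 _].
    have v0 : (0 < v)%R by exact: lt_le_trans v1.
    by rewrite lte_fin mulr_gt0// pw_gt0// addr_gt0.
have wE : (fine (\int[leb]_v (w v)%:E))%:E = \int[leb]_v (w v)%:E.
  by rewrite fineK// ge0_fin_numE// ltW.
exists (fine (\int[leb]_v (w v)%:E)); first by rewrite -lte_fin wE.
move=> H mH H0; rewrite wE.
pose I := \int[leb]_r ((pw (a + b - 1) r)%:E * H r).
have I0 : 0 <= I by apply: integral_ge0 => r _; rewrite mule_ge0 ?lee_fin ?pw_ge0.
transitivity (\int[leb]_t \int[leb]_v
    ((pw (a + b - 1) t * pw (b - 1) v)%:E * H (t * (1 + v))%R)).
  apply: eq_integral => t _; have [t0|t0] := ltP 0%R t; last first.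
    by rewrite !integral0_eq// => v _; rewrite pw0// mul0r mul0e.
  (* s = t v *)
  pose h s := (pw (a - 1) t * pw (b - 1) s)%:E * H (t + s)%R.
  have mh : measurable_fun setT h.
    apply: emeasurable_funM.
      by apply/measurable_EFinP; apply: measurable_funM => //.
    by apply: (measurableT_comp mH); exact: measurable_funD.
  have h0 s : 0 <= h s by rewrite mule_ge0 ?lee_fin ?mulr_ge0 ?pw_ge0.
  rewrite (ge0_integral_scale t0 mh h0) -ge0_integralZl_EFin ?ltW//; last first.
    by apply: (measurableT_comp mh); exact: mulrl_measurable.
  apply: eq_integral => v _; rewrite /h muleA -EFinM pwM// mulrDr mulr1.
  congr (_%:E * _); rewrite (mulrA (pw _ t)) (mulrA t); congr (_ * _)%R.
  rewrite [pw (a - 1) t]pwE// [pw _ t]pwE// -powRD; last by rewrite (gt_eqF t0) implybT.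
  rewrite -{1}(powRr1 (ltW t0)) -powRD; last by rewrite (gt_eqF t0) implybT.
  by congr (_ `^ _)%R; ring.
rewrite (fubini_tonelli (m1 := leb) (m2 := leb)
  (fun p => (pw (a + b - 1) p.1 * pw (b - 1) p.2)%:E * H (p.1 * (1 + p.2))%R))/=; last 2 first.
- apply: emeasurable_funM.
    apply/measurable_EFinP; apply: measurable_funM.
      exact: (measurableT_comp (mpw _)).
    exact: (measurableT_comp (mpw _)).
  apply: (measurableT_comp mH); apply: measurable_funM => //.
  exact: measurable_funD.
- by move=> p; rewrite mule_ge0 ?lee_fin ?mulr_ge0 ?pw_ge0.
rewrite -ge0_integralZr//; last 2 first.
- by apply/measurable_EFinP.
- by move=> v _; rewrite lee_fin.
apply: eq_integral => v _; rewrite /w.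
have [v0|v0] := ltP 0%R v; last first.
  by rewrite integral0_eq ?[pw (b - 1) v]pw0 ?mul0r ?mul0e// => t _; rewrite mulr0 mul0e.
(* r = (1 + v) t *)
have v1 : (0 < 1 + v)%R by rewrite addr_gt0.
pose h r := (pw (a + b - 1) r)%:E * H r.
have mh : measurable_fun setT h.
  by apply: emeasurable_funM => //; apply/measurable_EFinP.
have h0 s : 0 <= h s by rewrite mule_ge0 ?lee_fin ?pw_ge0.
rewrite -/I; have -> := ge0_integral_scale v1 mh h0 : I = _.
set c := (1 + v)%R in v1 *.
rewrite muleA -EFinM -ge0_integralZl_EFin ?mulr_ge0 ?pw_ge0 ?ltW//; last first.
  by apply: (measurableT_comp mh); exact: mulrl_measurable.
apply: eq_integral => t _; rewrite /h muleA -EFinM pwM// (mulrC t).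
congr (_%:E * _); rewrite [pw _ c]pwE//.
have -> : (c `^ (a + b - 1) = (c `^ (- (a + b)))^-1 / c)%R.
  rewrite -powRN opprK -[in RHS](powR_inv1 (ltW v1)) -powRD//.
  by rewrite (gt_eqF v1) implybT.
by field; rewrite ?gt_eqF ?powR_gt0.
Qed.

End beta.

(** * Borel sets and Radon measures on $R^n$ *)

Section rV_measurability.
Context (R : realType) (n : nat).
Local Notation rV := 'rV[R]_n.

Lemma closed_measurable_rV (A : set rV) : closed A -> measurable A.
Proof.
move=> cA; rewrite -[A]setCK; apply: measurableC; apply: open_measurable_rV.
exact: closed_openC.
Qed.

Lemma measurable_funB_rV d (T : measurableType d) (f g : T -> rV) :
  measurable_fun setT f -> measurable_fun setT g ->
  measurable_fun setT (fun t => f t - g t).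
Proof.
move=> mf mg; apply: measurable_fun_rV => i; under eq_fun do rewrite !mxE.
by apply: measurable_funB; exact: (measurableT_comp (measurable_coord_rV i)).
Qed.

Lemma ball_compact (k : R) : compact [set v : rV | `|v| <= k].
Proof.
apply: bounded_closed_compact.
  exists k; split; first exact: num_real.
  by move=> x kx v /= vk; exact: le_trans vk (ltW kx).
apply: (@preimage_closed _ _ (fun v : rV => `|v|) [set x | x <= k]).
  by move=> v _; exact: norm_continuous.
exact: closed_le.
Qed.

Lemma bigcup_ball : \bigcup_k [set v : rV | `|v| <= k%:R] = setT.
Proof.
rewrite -subTset => v _; exists (Num.trunc `|v|).+1 => //=.
by apply/ltW; rewrite truncnS_gt.
Qed.

Lemma compact_measurable_rV (A : set rV) : compact A -> measurable A.
Proof.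
by move=> cA; apply: closed_measurable_rV; exact: compact_closed.
Qed.

Lemma measurable_ball_rV (k : R) : measurable [set v : rV | `|v| <= k].
Proof. by apply: compact_measurable_rV; exact: ball_compact. Qed.

Section radon_sigma_finite.
Variables (p : {measure set rV -> \bar R}).

(** The measure $p$ itself; the type of the term records that $p$ is Radon, so
that sigma-finiteness can be inferred. *)
Definition radon_measure of radon p : set rV -> \bar R := p.

Hypothesis rp : radon p.
Local Notation q := (radon_measure rp).

Let q0 : q set0 = 0%E. Proof. exact: measure0. Qed.
Let q_ge0 A : (0 <= q A)%E. Proof. exact: measure_ge0. Qed.
Let q_sa : semi_sigma_additive q.
Proof. exact: measure_semi_sigma_additive. Qed.
HB.instance Definition _ := isMeasure.Build _ _ _ q q0 q_ge0 q_sa.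

Let q_sf : sigma_finite setT q.
Proof.
exists (fun k => [set v : rV | `|v| <= k%:R]); first by rewrite bigcup_ball.
by move=> k; split; [exact: measurable_ball_rV|apply: rp; exact: ball_compact].
Qed.
HB.instance Definition _ := @Measure_isSigmaFinite.Build _ _ _ q q_sf.
End radon_sigma_finite.

Lemma coord_le_norm (v : rV) i : `|v ord0 i| <= `|v|.
Proof.
rewrite [leRHS]/Num.norm /= mx_normrE; apply/bigmax_geP; right => /=.
by exists (ord0, i).
Qed.

Lemma norm_le_coord (v : rV) M : 0 <= M -> (forall i, `|v ord0 i| <= M) ->
  `|v| <= M.
Proof.
move=> M0 vM; rewrite [leLHS]/Num.norm /= mx_normrE; apply/bigmax_leP; split => //.
by move=> [i j] _ /=; rewrite (ord1 i).
Qed.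

Lemma radon_lebesgue : radon (lebesgue_rV R n).
Proof.
move=> K cK; have [M [_ MK]] := compact_bounded cK.
pose b : R := `|M| + 1.
have b0 : 0 < b by rewrite /b ltr_wpDl.
pose Q : set rV := [set v | forall i, `[- b, b]%classic (v ord0 i)].
have QE : Q = [set v : rV | `|v| <= b].
  apply/seteqP; split => v /= vb.
    by apply: norm_le_coord => [|i]; [exact: ltW|rewrite ler_norml; exact: vb].
  by move=> i; rewrite /= in_itv/= -ler_norml (le_trans (coord_le_norm v i)).
apply: (@le_lt_trans _ _ (lebesgue_rV R n Q)).
  apply: le_measure; rewrite ?inE.
  - exact: compact_measurable_rV.
  - by rewrite QE; exact: measurable_ball_rV.
  - rewrite QE => v Kv /=; apply: MK => //.
    by rewrite /b (le_lt_trans (ler_norm _))// ltrDl.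
rewrite (@lebesgue_rV_box R n (fun=> `[- b, b]%classic))//.
have fin_lty (x : \bar R) : x \is a fin_num -> (x < +oo)%E.
  by case: x => // r _; exact: ltry.
apply: fin_lty; elim/big_ind : _ => //[x y|i _]; first exact: fin_numM.
by rewrite lebesgue_measure_itv/=; case: ifPn.
Qed.

End rV_measurability.

(** * The heat kernel *)

Section heat_kernel.
Context (R : realType).
Local Notation leb := (@lebesgue_measure R).

(** The square of the Euclidean norm. *)
Definition nsq n (x : 'rV[R]_n) : R := \sum_i x ord0 i ^+ 2.

(** The Gauss--Weierstrass kernel; it vanishes for $t \le 0$. *)
Definition heat n (t : R) (x : 'rV[R]_n) : R :=
  (4 * pi) `^ (- (n%:R / 2)) * pw (- (n%:R / 2)) t *
  expR (- (nsq x / 4 * pw (-1) t)).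

Lemma nsq_ge0 n (x : 'rV[R]_n) : 0 <= nsq x.
Proof. by apply: sumr_ge0 => i _; exact: sqr_ge0. Qed.

Lemma nsqN n (x : 'rV[R]_n) : nsq (- x) = nsq x.
Proof. by apply: eq_bigr => i _; rewrite mxE sqrrN. Qed.

Lemma nsq_eq0 n (x : 'rV[R]_n) : (nsq x == 0) = (x == 0).
Proof.
apply/eqP/eqP => [x0|->]; last first.
  by apply: big1 => i _; rewrite mxE expr0n.
apply/rowP => i; rewrite mxE; apply/eqP; rewrite -sqrf_eq0; apply/eqP.
by apply: (psumr_eq0P _ x0) => // j _; exact: sqr_ge0.
Qed.

Lemma heat_ge0 n t (x : 'rV[R]_n) : 0 <= heat t x.
Proof. by rewrite !mulr_ge0 ?powR_ge0 ?pw_ge0 ?expR_ge0. Qed.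

Lemma heat_sym n t (x y : 'rV[R]_n) : heat t (x - y) = heat t (y - x).
Proof. by rewrite /heat -(nsqN (x - y)) opprB. Qed.

Lemma measurable_nsq n : measurable_fun setT (@nsq n).
Proof.
apply: measurable_sum => i; apply: measurable_funX.
exact: measurable_coord_rV.
Qed.

Lemma measurable_heat n d (T : measurableType d) (f : T -> R)
    (g : T -> 'rV[R]_n) :
  measurable_fun setT f -> measurable_fun setT g ->
  measurable_fun setT (fun u => heat (f u) (g u)).
Proof.
move=> mf mg; have mpw a : measurable_fun setT (fun u => pw a (f u)).
  exact: (measurableT_comp (measurable_pw a)).
rewrite /heat; apply: measurable_funM.
  by apply: measurable_funM => //; exact: measurable_cst.
apply: measurableT_comp => //; apply: measurableT_comp => //.
apply: measurable_funM => //; apply: measurable_funM => //.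
exact: (measurableT_comp (@measurable_nsq n)).
Qed.

Lemma heat_le n t (x : 'rV[R]_n) :
  heat t x <= (4 * pi) `^ (- (n%:R / 2)) * pw (- (n%:R / 2)) t.
Proof.
rewrite ler_piMr ?mulr_ge0 ?powR_ge0 ?pw_ge0// -expR0 ler_expR oppr_le0.
by rewrite !mulr_ge0 ?pw_ge0 ?nsq_ge0.
Qed.

(** The heat kernel is a product of one-dimensional Gaussian densities of variance
$2 t$. *)
Lemma heat_prod n t (x y : 'rV[R]_n) : 0 < t ->
  heat t (x - y) =
  \prod_(i < n) normal_pdf (x ord0 i) (Num.sqrt (2 * t)) (y ord0 i).
Proof.
move=> t0.
have s0 : Num.sqrt (2 * t) != 0 by rewrite gt_eqF// sqrtr_gt0 mulr_gt0.
have s2 : Num.sqrt (2 * t) ^+ 2 = 2 * t by rewrite sqr_sqrtr// mulr_ge0// ltW.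
under eq_bigr do rewrite normal_pdfE//.
rewrite big_split/= prodr_const card_ord -expR_sum; congr (_ * expR _).
  rewrite pwE// -powRM ?mulr_ge0 ?pi_ge0 ?ltW// /normal_peak s2.
  rewrite (_ : - (n%:R / 2) = 2^-1 * - n%:R); last by field.
  rewrite powRrM powR12_sqrt ?mulr_ge0 ?pi_ge0 ?ltW// powR_invn ?sqrtr_ge0//.
  by rewrite exprVn; congr ((Num.sqrt _ ^+ _)^-1); rewrite -mulr_natl; ring.
rewrite /nsq -!mulrA mulr_suml -sumrN; apply: eq_bigr => i _.
rewrite s2 pwE// powR_inv1 ?ltW// !mxE -mulr_natl.
by field; rewrite gt_eqF.
Qed.

Local Open Scope ereal_scope.

(** Lebesgue measure on $R^{n+1}$ is a product, by its definition. *)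
Lemma ge0_integral_rV_rec n (f : 'rV[R]_n.+1 -> \bar R) :
  measurable_fun setT f -> (forall x, 0 <= f x) ->
  \int[lebesgue_rV R n.+1]_x f x =
  \int[leb]_a \int[lebesgue_rV R n]_v f (cons_rV (a, v)).
Proof.
move=> mf f0.
transitivity (\int[pushforward (leb \x lebesgue_rV R n) (@cons_rV R n)]_x f x).
  by [].
have -> := @ge0_integral_pushforward _ _ (measurableTypeR R * 'rV[R]_n)%type _
  R (@cons_rV R n) (@measurable_cons_rV R n) (leb \x lebesgue_rV R n)%E setT f
  measurableT mf (fun y _ => f0 y).
rewrite preimage_setT.
rewrite (fubini_tonelli1 (m1 := leb) (m2 := lebesgue_rV R n)
  (fun p => f (cons_rV p)))//.
by apply: (measurableT_comp mf); exact: measurable_cons_rV.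
Qed.

Lemma integral_prod_eq1 n (f : 'I_n -> R -> R) :
  (forall i, measurable_fun setT (f i)) -> (forall i t, (0 <= f i t)%R) ->
  (forall i, \int[leb]_t (f i t)%:E = 1) ->
  \int[lebesgue_rV R n]_x (\prod_(i < n) f i (x ord0 i))%:E = 1.
Proof.
elim: n f => [|n ih] f mf f0 f1.
  under eq_integral do rewrite big_ord0.
  by rewrite integral_cst// mul1e /= diracT.
rewrite ge0_integral_rV_rec; last 2 first.
- apply/measurable_EFinP; apply: measurable_prod => i _.
  exact: (measurableT_comp (mf i) (measurable_coord_rV i)).
- by move=> x; rewrite lee_fin prodr_ge0.
transitivity (\int[leb]_a (f ord0 a)%:E); last exact: f1.
apply: eq_integral => a _.
transitivity (\int[lebesgue_rV R n]_v
    ((f ord0 a)%:E * (\prod_(i < n) f (lift ord0 i) (v ord0 i))%:E)).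
  apply: eq_integral => v _; rewrite -EFinM big_ord_recl; congr (_%:E).
  congr (f _ _ * _)%R; first by rewrite mxE unlift_none.
  by apply: eq_bigr => i _; rewrite mxE liftK.
rewrite ge0_integralZl_EFin//; last 2 first.
- by move=> v _; rewrite lee_fin prodr_ge0.
- apply/measurable_EFinP; apply: measurable_prod => i _.
  exact: (measurableT_comp (mf _) (measurable_coord_rV i)).
by rewrite (ih (fun i => f (lift ord0 i)))// mule1.
Qed.

Lemma integral_heat n t (x : 'rV[R]_n) : (0 < t)%R ->
  \int[lebesgue_rV R n]_y (heat t (x - y))%:E = 1.
Proof.
move=> t0; under eq_integral do rewrite heat_prod//.
apply: (integral_prod_eq1
  (f := fun i => normal_pdf (x ord0 i) (Num.sqrt (2 * t)))) => i.
- exact: measurable_normal_pdf.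
- by move=> s; exact: normal_pdf_ge0.
- exact: integral_normal_pdf.
Qed.

(** Completing the square in a product of two Gaussian functions of $z$. *)
Lemma heat_mul n (t s : R) (x y z : 'rV[R]_n) : (0 < t)%R -> (0 < s)%R ->
  (heat t (x - z) * heat s (z - y) = heat (t + s) (x - y) *
   heat (t * s / (t + s)) ((s / (t + s)) *: x + (t / (t + s)) *: y - z))%R.
Proof.
move=> t0 s0; rewrite /heat; set c := ((4 * pi) `^ _)%R.
have ts : (0 < t + s)%R by rewrite addr_gt0.
have q0 : (0 < t * s / (t + s))%R by rewrite divr_gt0// mulr_gt0.
rewrite mulrACA [RHS]mulrACA; congr (_ * _)%R.
  rewrite !pwE// mulrACA [RHS]mulrACA; congr (_ * _)%R.
  rewrite -!powRM ?ltW//; congr (_ `^ _)%R.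
  by field; rewrite gt_eqF.
rewrite -!expRD; congr expR; rewrite !pwE// !powR_inv1 ?ltW//.
rewrite /nsq -!mulrA !mulr_suml -!sumrN -!big_split/=; apply: eq_bigr => i _.
rewrite !mxE; field.
by rewrite !gt_eqF.
Qed.

End heat_kernel.

(** * Heat flows of Radon measures *)

Section tonelli_radon.
Context (R : realType) (n : nat).
Local Notation rV := 'rV[R]_n.
Local Notation leb := (@lebesgue_measure R).
Local Open Scope ereal_scope.
Implicit Types p q : {measure set rV -> \bar R}.

Lemma tonelli_radon p q (f : rV -> rV -> \bar R) : radon p -> radon q ->
  measurable_fun setT (fun z : rV * rV => f z.1 z.2) ->
  (forall x y, 0 <= f x y) ->
  \int[p]_x \int[q]_y f x y = \int[q]_y \int[p]_x f x y.
Proof.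
move=> rp rq mf f0.
exact: (@fubini_tonelli _ _ _ _ R (radon_measure rp) (radon_measure rq)
  (fun z => f z.1 z.2) mf (fun z => f0 z.1 z.2)).
Qed.

Lemma tonelli_leb_radon p (f : R -> rV -> \bar R) : radon p ->
  measurable_fun setT (fun z : R * rV => f z.1 z.2) ->
  (forall t y, 0 <= f t y) ->
  \int[leb]_t \int[p]_y f t y = \int[p]_y \int[leb]_t f t y.
Proof.
move=> rp mf f0.
exact: (@fubini_tonelli _ _ _ _ R leb (radon_measure rp)
  (fun z => f z.1 z.2) mf (fun z => f0 z.1 z.2)).
Qed.

Lemma measurable_integral_radon d (T : measurableType d) p
    (f : T -> rV -> \bar R) : radon p ->
  measurable_fun setT (fun z : T * rV => f z.1 z.2) ->
  (forall t y, 0 <= f t y) -> measurable_fun setT (fun t => \int[p]_y f t y).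
Proof.
move=> rp mf f0.
exact: (@measurable_fun_fubini_tonelli_F _ _ T _ R (radon_measure rp)
  (fun z => f z.1 z.2) mf (fun z => f0 z.1 z.2)).
Qed.

Lemma measurable_integral_leb d (T : measurableType d)
    (f : T -> R -> \bar R) :
  measurable_fun setT (fun z : T * R => f z.1 z.2) ->
  (forall t s, 0 <= f t s) -> measurable_fun setT (fun t => \int[leb]_s f t s).
Proof.
move=> mf f0.
exact: (@measurable_fun_fubini_tonelli_F _ _ T _ R leb
  (fun z => f z.1 z.2) mf (fun z => f0 z.1 z.2)).
Qed.

End tonelli_radon.

Section heat_potential.
Context (R : realType) (n : nat).
Local Notation rV := 'rV[R]_n.
Local Notation m := (lebesgue_rV R n).
Local Open Scope ereal_scope.
Implicit Types p q : {measure set rV -> \bar R}.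

(** The heat flow of a measure. *)
Definition heatp t p (x : rV) : \bar R := \int[p]_y (heat t (x - y))%:E.

Lemma heatp_ge0 t p x : 0 <= heatp t p x.
Proof. by apply: integral_ge0 => y _; rewrite lee_fin heat_ge0. Qed.

Lemma measurable_heatp d (T : measurableType d) p (f : T -> R) (g : T -> rV) :
  radon p -> measurable_fun setT f -> measurable_fun setT g ->
  measurable_fun setT (fun u => heatp (f u) p (g u)).
Proof.
move=> rp mf mg.
apply: (@measurable_integral_radon _ _ _ _ _ (fun u y => (heat (f u) (g u - y))%:E)) => //.
  apply/measurable_EFinP; apply: measurable_heat.
    exact: (measurableT_comp mf measurable_fst).
  apply: measurable_funB_rV; first exact: (measurableT_comp mg measurable_fst).
  exact: measurable_snd.
by move=> u y; rewrite lee_fin heat_ge0.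
Qed.

Lemma integral_heat_mul t s (x y : rV) : (0 < t)%R -> (0 < s)%R ->
  \int[m]_z (heat t (x - z) * heat s (z - y))%:E = (heat (t + s) (x - y))%:E.
Proof.
move=> t0 s0; under eq_integral do rewrite heat_mul// EFinM.
rewrite ge0_integralZl_EFin ?heat_ge0//; last 2 first.
- by move=> z _; rewrite lee_fin heat_ge0.
- apply/measurable_EFinP; apply: measurable_heat; first exact: measurable_cst.
  by apply: measurable_funB_rV => //; exact: measurable_cst.
by rewrite integral_heat ?mule1// divr_gt0 ?mulr_gt0 ?addr_gt0.
Qed.

Lemma heatp_semigroup t s p x : radon p -> (0 < t)%R -> (0 < s)%R ->
  \int[m]_y ((heat t (x - y))%:E * heatp s p y) = heatp (t + s) p x.
Proof.
move=> rp t0 s0.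
transitivity (\int[m]_y \int[p]_z (heat t (x - y) * heat s (y - z))%:E).
  apply: eq_integral => y _; rewrite -ge0_integralZl_EFin ?heat_ge0//.
  - by move=> z _; rewrite lee_fin heat_ge0.
  - apply/measurable_EFinP; apply: measurable_heat; first exact: measurable_cst.
    by apply: measurable_funB_rV => //; exact: measurable_cst.
rewrite (tonelli_radon
  (f := fun y z => (heat t (x - y) * heat s (y - z))%:E) (@radon_lebesgue R n) rp).
- by apply: eq_integral => z _; exact: integral_heat_mul.
- apply/measurable_EFinP; apply: measurable_funM; apply: measurable_heat;
    try exact: measurable_cst; apply: measurable_funB_rV;
    by [exact: measurable_cst|exact: measurable_fst|exact: measurable_snd].
- by move=> y z; rewrite lee_fin mulr_ge0 ?heat_ge0.
Qed.

Lemma integral_heatp t p : radon p -> (0 < t)%R ->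
  \int[m]_x heatp t p x = p setT.
Proof.
move=> rp t0; rewrite (tonelli_radon
  (f := fun x y => (heat t (x - y))%:E) (@radon_lebesgue R n) rp).
- under eq_integral do under eq_integral do rewrite heat_sym.
  under eq_integral do rewrite integral_heat//.
  by rewrite integral_cst// mul1e.
- apply/measurable_EFinP; apply: measurable_heat; first exact: measurable_cst.
  by apply: measurable_funB_rV; [exact: measurable_fst|exact: measurable_snd].
- by move=> x y; rewrite lee_fin heat_ge0.
Qed.

Lemma measurable_heatB t x : measurable_fun setT (fun y : rV => (heat t (x - y))%:E).
Proof.
apply/measurable_EFinP; apply: measurable_heat; first exact: measurable_cst.
by apply: measurable_funB_rV => //; exact: measurable_cst.
Qed.

Lemma heatp_le_mass t p x : heatp t p x <=
  ((4 * pi) `^ (- (n%:R / 2)) * pw (- (n%:R / 2)) t)%:E * p setT.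
Proof.
rewrite -integral_cst//; apply: ge0_le_integral => //.
- by move=> y _; rewrite lee_fin heat_ge0.
- exact: measurable_heatB.
- by move=> y _; rewrite lee_fin heat_le.
Qed.

(** $p \le M m$: the measure $p$ has a density bounded by $M$. *)
Definition dominated p (M : R) :=
  forall A, measurable A -> p A <= M%:E * m A.

Lemma ge0_integral_dominated p M (f : rV -> \bar R) : (0 <= M)%R ->
  dominated p M -> measurable_fun setT f -> (forall x, 0 <= f x) ->
  \int[p]_x f x <= M%:E * \int[m]_x f x.
Proof.
move=> M0 pM mf f0.
pose q : {measure set rV -> \bar R} := mscale (NngNum M0) m.
rewrite -[leRHS](@ge0_integral_mscale _ _ _ m _ measurableT (NngNum M0) f)//.
exact: (@ge0_le_measure_integral _ _ _ p q).
Qed.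

Lemma heatp_le_dominated t p M x : (0 <= M)%R -> dominated p M ->
  heatp t p x <= M%:E.
Proof.
move=> M0 pM; have [t0|t0] := ltP 0%R t; last first.
  rewrite /heatp integral0_eq ?lee_fin// => y _.
  by rewrite /heat [pw (- (n%:R / 2)) t]pw0// mulr0 mul0r.
apply: (le_trans (ge0_integral_dominated M0 pM _ _)).
- exact: measurable_heatB.
- by move=> y; rewrite lee_fin heat_ge0.
- by rewrite integral_heat// mule1.
Qed.

Lemma dominated_radon p M : dominated p M -> radon p.
Proof.
move=> pM K cK; apply: le_lt_trans (pM K _) _; first exact: compact_measurable_rV.
have mK : m K < +oo by exact: radon_lebesgue.
rewrite -[m K]fineK ?ge0_fin_numE// -EFinM; exact: ltry.
Qed.

End heat_potential.

(** * Riesz potentials as superpositions of heat flows *)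

Section subordination.
Context (R : realType) (n : nat).
Local Notation rV := 'rV[R]_n.
Local Notation leb := (@lebesgue_measure R).

Lemma expRN_le (u : R) (N : nat) : 0 < u ->
  expR (- u) <= (N.+1%:R / u) ^+ N.+1.
Proof.
move=> u0; rewrite expRN -[X in _ <= X]invrK; rewrite lef_pV2 ?posrE ?expR_gt0//; last first.
  by rewrite invr_gt0 exprn_gt0// divr_gt0.
rewrite -exprVn invf_div.
have -> : expR u = expR (u / N.+1%:R) ^+ N.+1.
  by rewrite -expRM_natl mulrC divfK.
rewrite lerXn2r ?nnegrE ?expR_ge0 ?divr_ge0 ?(ltW u0)//.
by apply: le_trans (expR_ge1Dx _); rewrite lerDr.
Qed.

Local Open Scope ereal_scope.

(** The integral is positive and is multiplied by $2^{a+1} < 1$ under the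
substitution of $2 t$ for $t$, so it cannot be finite. *)
Lemma integral_pw_pinfty (a : R) : (a + 1 < 0)%R ->
  \int[leb]_t (pw a t)%:E = +oo.
Proof.
move=> a0; set I := \int[leb]_t _.
have mpw : measurable_fun setT (fun t => (@pw R a t)%:E).
  by apply/measurable_EFinP; exact: measurable_pw.
have I2 : I = (2 `^ (a + 1))%:E * I.
  have pos x : 0 <= (@pw R a x)%:E by rewrite lee_fin pw_ge0.
  rewrite {1}/I; have -> := @ge0_integral_scale R 2%R _ (ltr0Sn _ _) mpw pos.
  under eq_integral do rewrite pwM// EFinM.
  rewrite ge0_integralZl_EFin ?powR_ge0//.
  rewrite muleA -EFinM -/I; congr (_%:E * _).
  by rewrite powRD ?pnatr_eq0 ?implybT// powRr1// mulrC.
have I0 : 0 < I.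
  have D0 : 0 < leb `[1%R, 2%R]%classic.
    by rewrite lebesgue_measure_itv/= lte_fin ltr1n -EFinB lte_fin subr_gt0 ltr1n.
  apply: (@integral_gt0 _ _ _ leb _ `[1%R, 2%R]%classic) => //.
  - by move=> x; rewrite lee_fin pw_ge0.
  - move=> v /=; rewrite in_itv/= => /andP[v1 _].
    by rewrite lte_fin pw_gt0// (lt_le_trans ltr01).
case: I I2 I0 => [r| |]// [] rE; rewrite lte_fin => r0.
have : (2 `^ (a + 1) = 1 :> R)%R by apply: (mulIf (lt0r_neq0 r0)); rewrite -rE mul1r.
move=> /eqP; rewrite powR_eq1 !ltNge ler0n /= (lt_eqF a0) orbF.
by rewrite -subr_eq0 (_ : 2 - 1 = 1)%R ?oner_eq0//; lra.
Qed.

(** Subordination: a Riesz kernel is a superposition of heat kernels. *)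
Lemma riesz_subordination (beta : R) : (0 < beta)%R -> (beta < n%:R)%R ->
  exists2 k : R, (0 < k)%R & forall x y : rV,
    riesz_kernel beta x y =
    k%:E * \int[leb]_t (pw (beta / 2 - 1) t * heat t (x - y))%:E.
Proof.
move=> b0 bn.
pose a : R := (beta / 2 - 1 - n%:R / 2)%R.
have a1 : (a + 1 < 0)%R by rewrite /a; lra.
pose c : R := ((4 * pi) `^ (- (n%:R / 2)))%R.
have c0 : (0 < c)%R by rewrite powR_gt0// mulr_gt0// pi_gt0.
pose f (t : R) : R := (pw a t * expR (- (4^-1 * pw (- 1) t)))%R.
have f0 t : (0 <= f t)%R by rewrite mulr_ge0 ?pw_ge0 ?expR_ge0.
have mf : measurable_fun setT f.
  apply: measurable_funM; first exact: measurable_pw.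
  apply: measurableT_comp => //; apply: measurableT_comp => //.
  by apply: measurable_funM => //; exact: measurable_pw.
have ffin : \int[leb]_t (f t)%:E < +oo.
  (* exp (- u) <= (N / u) ^ N with N = n + 2, so that t ^ (a + N) is bounded on
     ]0, 1] *)
  pose C : R := (1 + (4 * n.+2%:R) ^+ n.+2)%R.
  have C1 : (1 <= C)%R by rewrite lerDl exprn_ge0// mulr_ge0.
  have C0 : (0 <= C)%R by exact: le_trans C1.
  apply: (@integral_le_pw_lty _ f 0%R a C) => //.
  - by lra.
  - move=> t t1; have [t0|t0] := ltP 0%R t; last by rewrite /f !pw0// mul0r mulr0.
    have u0 : (0 < 4^-1 * pw (- 1) t)%R by rewrite mulr_gt0 ?pw_gt0 ?invr_gt0.
    rewrite /f; apply: (le_trans (ler_wpM2l (pw_ge0 _ _) (expRN_le n.+1 u0))).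
    rewrite [pw (- 1) t]pwE// powR_inv1 ?(ltW t0)// [pw 0 t]pwE// powRr0 mulr1.
    rewrite (_ : n.+2%:R / (4^-1 / t) = 4 * n.+2%:R * t)%R; last first.
      by field; rewrite gt_eqF.
    rewrite exprMn mulrCA.
    apply: (@le_trans _ _ ((4 * n.+2%:R) ^+ n.+2 * 1)%R); last first.
      by rewrite mulr1 lerDr.
    rewrite ler_wpM2l ?exprn_ge0 ?mulr_ge0// pwE// -powR_mulrn ?(ltW t0)//.
    rewrite -powRD; last by rewrite (gt_eqF t0) implybT.
    rewrite -[X in (_ <= X)%R](powRr0 t) ger_powR ?t0// /a.
    have : (0 <= n%:R :> R)%R by [].
    by rewrite -(natr1 n.+1) -(natr1 n); lra.
  - move=> t t1; apply: (@le_trans _ _ (pw a t)).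
      rewrite ler_piMr ?pw_ge0// -expR0 ler_expR oppr_le0.
      by rewrite mulr_ge0 ?pw_ge0// invr_ge0.
    by rewrite ler_peMl ?pw_ge0.
have fpos : 0 < \int[leb]_t (f t)%:E.
  have D0 : 0 < leb `[1%R, 2%R]%classic.
    by rewrite lebesgue_measure_itv/= lte_fin ltr1n -EFinB lte_fin subr_gt0 ltr1n.
  apply: (@integral_gt0 _ _ _ leb _ `[1%R, 2%R]%classic) => //.
  - by apply/measurable_EFinP.
  - move=> v /=; rewrite in_itv/= => /andP[v1 _].
    by rewrite lte_fin mulr_gt0 ?expR_gt0// pw_gt0// (lt_le_trans ltr01).
have [K KE] : exists K, \int[leb]_t (f t)%:E = K%:E.
  by exists (fine (\int[leb]_t (f t)%:E)); rewrite fineK// ge0_fin_numE// ltW.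
have K0 : (0 < K)%R by rewrite -lte_fin -KE.
exists ((c * K)^-1)%R; first by rewrite invr_gt0 mulr_gt0.
move=> x y.
have hE t : (pw (beta / 2 - 1) t * heat t (x - y) =
    c * (pw a t * expR (- (nsq (x - y) / 4 * pw (- 1) t))))%R.
  by rewrite /heat -/c /a -[in RHS]pwD; ring.
under eq_integral do rewrite hE EFinM.
have mg (r : R) : measurable_fun setT (fun t => (pw a t * expR (- (r * pw (- 1) t)))%:E).
  apply/measurable_EFinP; apply: measurable_funM; first exact: measurable_pw.
  apply: measurableT_comp => //; apply: measurableT_comp => //.
  by apply: measurable_funM => //; exact: measurable_pw.
have g0 (r t : R) : 0 <= (pw a t * expR (- (r * pw (- 1) t)))%:E.
  by rewrite lee_fin mulr_ge0 ?pw_ge0 ?expR_ge0.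
rewrite ge0_integralZl_EFin ?(ltW c0)//; last exact: mg.
rewrite muleA -EFinM invfM mulrAC mulVf ?gt_eqF// mul1r.
have [->|xy] := eqVneq x y.
  rewrite /riesz_kernel eqxx subrr.
  have -> : nsq (0 : rV) = 0%R by apply/eqP; rewrite nsq_eq0.
  under eq_integral do rewrite !mul0r oppr0 expR0 mulr1.
  by rewrite integral_pw_pinfty// gt0_muley// lte_fin invr_gt0.
rewrite /riesz_kernel (negbTE xy).
set r := nsq (x - y).
have r0 : (0 < r)%R by rewrite lt0r nsq_ge0 nsq_eq0 subr_eq0 xy.
(* t = r s *)
have -> := ge0_integral_scale r0 (mg (r / 4)%R) (g0 (r / 4)%R).
under eq_integral => t _.
  rewrite !pwM// powR_inv1 ?(ltW r0)// (_ : r / 4 * (r^-1 * _) = 4^-1 * pw (- 1) t)%R; last first.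
    by field; rewrite gt_eqF.
  rewrite -mulrA -/(f t) EFinM; over.
rewrite ge0_integralZl_EFin ?powR_ge0//; last 2 first.
- by move=> t _; rewrite lee_fin.
- by apply/measurable_EFinP.
rewrite KE -!EFinM; congr EFin.
rewrite /enorm -/(nsq (x - y)) -/r -powR12_sqrt ?(ltW r0)// -powRrM.
rewrite (_ : K^-1 * (r * (r `^ a * K)) = r `^ 1 * r `^ a)%R; last first.
  by rewrite powRr1 ?(ltW r0)//; field; rewrite gt_eqF.
rewrite -powRD; last by rewrite (gt_eqF r0) implybT.
by congr (_ `^ _)%R; rewrite /a; field.
Qed.

End subordination.

Section riesz_potentials.
Context (R : realType) (n : nat).
Local Notation rV := 'rV[R]_n.
Local Notation leb := (@lebesgue_measure R).
Local Notation m := (lebesgue_rV R n).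
Local Open Scope ereal_scope.
Implicit Types (p q : {measure set rV -> \bar R}) (beta : R).

Lemma measurable_pwE a : measurable_fun setT (fun t => (@pw R a t)%:E).
Proof. by apply/measurable_EFinP; exact: measurable_pw. Qed.

Lemma measurable_pw_heatp d (T : measurableType d) (f : T -> R) (g : T -> R)
    (h : T -> rV) a p : radon p ->
  measurable_fun setT f -> measurable_fun setT g -> measurable_fun setT h ->
  measurable_fun setT (fun u => (pw a (f u))%:E * heatp (g u) p (h u)).
Proof.
move=> rp mf mg mh; apply: emeasurable_funM; last exact: measurable_heatp.
exact: (measurableT_comp (measurable_pwE a) mf).
Qed.

Lemma pw_heatp_ge0 a t s p x : 0 <= (pw a t)%:E * heatp s p x.
Proof. by rewrite mule_ge0 ?heatp_ge0// lee_fin pw_ge0. Qed.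

Lemma potential_heatp beta : (0 < beta)%R -> (beta < n%:R)%R ->
  exists2 k : R, (0 < k)%R & forall p x, radon p ->
    potential beta p x =
    k%:E * \int[leb]_t ((pw (beta / 2 - 1) t)%:E * heatp t p x).
Proof.
move=> b0 bn; have [k k0 kE] := @riesz_subordination R n _ b0 bn.
exists k => // p x rp; rewrite /potential.
under eq_integral do rewrite kE.
have mF : measurable_fun setT (fun z : R * rV =>
    (pw (beta / 2 - 1) z.1 * heat z.1 (x - z.2))%:E).
  apply/measurable_EFinP; apply: measurable_funM.
    exact: (measurableT_comp (measurable_pw _)).
  by apply: measurable_heat => //; apply: measurable_funB_rV.
have F0 t (y : rV) : 0 <= (pw (beta / 2 - 1) t * heat t (x - y))%:E.
  by rewrite lee_fin mulr_ge0 ?pw_ge0 ?heat_ge0.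
have mF' : measurable_fun setT (fun z : rV * R =>
    (pw (beta / 2 - 1) z.2 * heat z.2 (x - z.1))%:E).
  apply/measurable_EFinP; apply: measurable_funM.
    exact: (measurableT_comp (measurable_pw _)).
  by apply: measurable_heat => //; apply: measurable_funB_rV.
rewrite ge0_integralZl_EFin ?ltW//; last 2 first.
- by move=> y _; exact: integral_ge0.
- exact: (measurable_integral_leb
    (f := fun (y : rV) t => (pw (beta / 2 - 1) t * heat t (x - y))%:E)).
congr (_ * _); rewrite -(tonelli_leb_radon rp mF F0).
apply: eq_integral => t _; rewrite -ge0_integralZl_EFin ?pw_ge0//.
- by move=> y _; rewrite lee_fin heat_ge0.
- exact: measurable_heatB.
Qed.

Lemma potential_ge0 beta p x : 0 <= potential beta p x.
Proof.
apply: integral_ge0 => y _; rewrite /riesz_kernel; case: ifP => // _.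
by rewrite lee_fin powR_ge0.
Qed.

Lemma measurable_riesz_kernel beta : (0 < beta)%R -> (beta < n%:R)%R ->
  measurable_fun setT (fun z : rV * rV => riesz_kernel beta z.1 z.2).
Proof.
move=> b0 bn; have [k k0 kE] := @riesz_subordination R n _ b0 bn.
under eq_fun do rewrite kE.
apply: measurable_funeM; apply: measurable_integral_leb => /=.
  apply/measurable_EFinP; apply: measurable_funM.
    exact: (measurableT_comp (measurable_pw _)).
  apply: measurable_heat => //; apply: measurable_funB_rV.
    exact: (measurableT_comp measurable_fst measurable_fst).
  exact: (measurableT_comp measurable_snd measurable_fst).
by move=> z t; rewrite lee_fin mulr_ge0 ?pw_ge0 ?heat_ge0.
Qed.

Lemma riesz_kernel_ge0 beta (x y : rV) : 0 <= riesz_kernel beta x y.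
Proof. by rewrite /riesz_kernel; case: ifP => // _; rewrite lee_fin powR_ge0. Qed.

Lemma measurable_potential beta p : (0 < beta)%R -> (beta < n%:R)%R ->
  radon p -> measurable_fun setT (potential beta p).
Proof.
move=> b0 bn rp; apply: measurable_integral_radon => //.
- exact: measurable_riesz_kernel.
- exact: riesz_kernel_ge0.
Qed.

(** The class of measures used for approximation: finite mass and bounded
density. *)
Definition tame p := p setT < +oo /\ exists2 M : R, (0 <= M)%R & dominated p M.

Lemma tame_radon p : tame p -> radon p.
Proof. by move=> [_ [M _ /dominated_radon]]. Qed.

Lemma integral_pw_heatp_bounded p a : (0 < a)%R -> (a < n%:R / 2)%R -> tame p ->
  exists2 B : R, (0 <= B)%R & forall x,
    \int[leb]_t ((pw (a - 1) t)%:E * heatp t p x) <= B%:E.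
Proof.
move=> a0 an tp; have rp := tame_radon tp; have [pT [M M0 pM]] := tp.
have [P PE] : exists P, p setT = P%:E.
  by exists (fine (p setT)); rewrite fineK// ge0_fin_numE.
have P0 : (0 <= P)%R by rewrite -lee_fin -PE.
pose c : R := ((4 * pi) `^ (- (n%:R / 2)) * P)%R.
have c0 : (0 <= c)%R by rewrite mulr_ge0 ?powR_ge0.
(* the smaller of the two bounds of the heat flow, by the density and by the mass *)
pose h t : R := Num.min M (c * pw (- (n%:R / 2)) t)%R.
have mh : measurable_fun setT h.
  apply: measurable_minr => //; apply: measurable_funM => //.
  exact: measurable_pw.
have h0 t : (0 <= h t)%R by rewrite le_min M0 mulr_ge0 ?pw_ge0.
pose f t : R := (pw (a - 1) t * h t)%R.
have mf : measurable_fun setT f.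
  by apply: measurable_funM => //; exact: measurable_pw.
have f0 t : (0 <= f t)%R by rewrite mulr_ge0 ?pw_ge0.
have ffin : \int[leb]_t (f t)%:E < +oo.
  apply: (@integral_le_pw_lty _ f (a - 1)%R (a - 1 - n%:R / 2)%R (M + c)%R) => //.
  - by lra.
  - by lra.
  - by rewrite addr_ge0.
  - move=> t _; rewrite /f mulrC ler_wpM2r ?pw_ge0//.
    by rewrite /h ge_min lerDl c0.
  - move=> t t1; rewrite /f -(pwD (a - 1) (- (n%:R / 2))).
    apply: (@le_trans _ _ (pw (a - 1) t * (c * pw (- (n%:R / 2)) t))%R).
      by rewrite ler_wpM2l ?pw_ge0// ge_min lexx orbT.
    by rewrite mulrCA ler_wpM2r ?mulr_ge0 ?pw_ge0// lerDr.
exists (fine (\int[leb]_t (f t)%:E)).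
  by rewrite fine_ge0//; apply: integral_ge0 => t _; rewrite lee_fin.
move=> x; rewrite fineK; last first.
  by rewrite ge0_fin_numE//; apply: integral_ge0 => t _; rewrite lee_fin.
apply: ge0_le_integral => //.
- by move=> t _; exact: pw_heatp_ge0.
- exact: (@measurable_pw_heatp _ _ id id (cst x)).
- exact/measurable_EFinP.
- move=> t _; rewrite /f EFinM lee_wpmul2l ?lee_fin ?pw_ge0//.
  rewrite /h EFin_min le_min heatp_le_dominated//=.
  apply: (le_trans (heatp_le_mass _ _ _)).
  by rewrite PE -EFinM lee_fin /c mulrAC.
Qed.

Lemma potential_bounded beta p : (0 < beta)%R -> (beta < n%:R)%R -> tame p ->
  exists2 B : R, (0 <= B)%R & forall x, potential beta p x <= B%:E.
Proof.
move=> b0 bn tp; have [k k0 kE] := potential_heatp b0 bn.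
have a0 : (0 < beta / 2)%R by lra.
have an : (beta / 2 < n%:R / 2)%R by lra.
have [B B0 BE] := integral_pw_heatp_bounded a0 an tp.
exists (k * B)%R; first by rewrite mulr_ge0// ltW.
move=> x; rewrite kE ?EFinM; last exact: tame_radon.
by rewrite lee_wpmul2l// lee_fin ltW.
Qed.

(** The composition $\kappa_\beta * \kappa_\beta = c \kappa_{2\beta}$, in the
form of an energy identity, bounds the $L^2$-norm of a tame potential. *)
Lemma potential_square_integrable beta p : (0 < beta)%R ->
  (2 * beta < n%:R)%R -> tame p ->
  \int[m]_x (potential beta p x) ^+ 2 < +oo.
Proof.
move=> b0 bn tp; have rp := tame_radon tp.
have bn' : (beta < n%:R)%R by lra.
have [k k0 kE] := potential_heatp b0 bn'.
pose a := (beta / 2)%R; have a0 : (0 < a)%R by rewrite /a; lra.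
pose A x t := (pw (a - 1) t)%:E * heatp t p x.
have A0 x t : 0 <= A x t by exact: pw_heatp_ge0.
have mA d (T : measurableType d) (f : T -> rV) (g : T -> R) :
    measurable_fun setT f -> measurable_fun setT g ->
    measurable_fun setT (fun u => A (f u) (g u)).
  by move=> mf mg; exact: measurable_pw_heatp.
have mI : measurable_fun setT (fun x => \int[leb]_t A x t).
  by apply: measurable_integral_leb => //; exact: mA.
have I0 x : 0 <= \int[leb]_t A x t by exact: integral_ge0.
have -> : \int[m]_x (potential beta p x) ^+ 2 = (k ^+ 2)%:E *
    \int[m]_x ((\int[leb]_t A x t) * (\int[leb]_s A x s)).
  rewrite -ge0_integralZl_EFin ?exprn_ge0 ?(ltW k0)//; last 2 first.
  - by move=> x _; rewrite mule_ge0.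
  - exact: emeasurable_funM.
  apply: eq_integral => x _; rewrite kE// -/a expe2 muleACA -EFinM.
  by rewrite -expr2.
(* integrating P_t p P_s p over R^n gives the integral of P_(t + s) p against p *)
have sw : \int[m]_x ((\int[leb]_t A x t) * (\int[leb]_s A x s)) =
    \int[leb]_t \int[leb]_s ((pw (a - 1) t * pw (a - 1) s)%:E *
      \int[p]_y heatp (t + s) p y).
  transitivity (\int[m]_x \int[leb]_t \int[leb]_s (A x t * A x s)).
    apply: eq_integral => x _; rewrite -ge0_integralZr//; last first.
      exact: mA.
    apply: eq_integral => t _; rewrite ge0_integralZl//.
    exact: mA.
  rewrite -(@tonelli_leb_radon _ _ m
      (fun t x => \int[leb]_s (A x t * A x s)))//; last 3 first.
  - exact: radon_lebesgue.
  - apply: measurable_integral_leb => [|z s]; last exact: mule_ge0.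
    apply: emeasurable_funM; apply: mA.
    + exact: (measurableT_comp measurable_snd measurable_fst).
    + exact: (measurableT_comp measurable_fst measurable_fst).
    + exact: (measurableT_comp measurable_snd measurable_fst).
    + exact: measurable_snd.
  - by move=> t x; apply: integral_ge0 => s _; exact: mule_ge0.
  apply: eq_integral => t _.
  rewrite -(@tonelli_leb_radon _ _ m (fun s x => A x t * A x s))//; last 3 first.
  - exact: radon_lebesgue.
  - by apply: emeasurable_funM; exact: mA.
  - by move=> s x; exact: mule_ge0.
  apply: eq_integral => s _; rewrite /A.
  have [t0|t0] := ltP 0%R t; last first.
    by rewrite pw0// mul0r mul0e integral0_eq// => x _; rewrite !mul0e.
  have [s0|s0] := ltP 0%R s; last first.
    by rewrite [pw _ s]pw0// mulr0 mul0e integral0_eq// => x _; rewrite mul0e mule0.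
  under eq_integral do rewrite muleACA -EFinM.
  rewrite ge0_integralZl_EFin ?mulr_ge0 ?pw_ge0//; last 2 first.
  - by move=> x _; rewrite mule_ge0 ?heatp_ge0.
  - by apply: emeasurable_funM; exact: measurable_heatp.
  congr (_ * _).
  transitivity (\int[m]_x \int[p]_y ((heat t (x - y))%:E * heatp s p x)).
    apply: eq_integral => x _; rewrite ge0_integralZr ?heatp_ge0//.
    - exact: measurable_heatB.
    - by move=> y _; rewrite lee_fin heat_ge0.
  rewrite (tonelli_radon
    (f := fun x y => (heat t (x - y))%:E * heatp s p x) (@radon_lebesgue R n) rp).
  - apply: eq_integral => y _; rewrite -(heatp_semigroup _ rp t0 s0).
    by apply: eq_integral => x _; rewrite heat_sym.
  - apply: emeasurable_funM; last exact: measurable_heatp.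
    apply/measurable_EFinP; apply: measurable_heat; first exact: measurable_cst.
    exact: measurable_funB_rV.
  - by move=> x y; rewrite mule_ge0 ?heatp_ge0// lee_fin heat_ge0.
rewrite sw; have [B B0 BE] := beta_convolution a0 a0.
have mHp d (T : measurableType d) (f : T -> rV) (g : T -> R) :
    measurable_fun setT f -> measurable_fun setT g ->
    measurable_fun setT (fun u => heatp (g u) p (f u)).
  by move=> mf mg; exact: measurable_heatp.
rewrite (BE (fun r => \int[p]_y heatp r p y)); last 2 first.
- by apply: measurable_integral_radon => // [|r y]; [exact: mHp|exact: heatp_ge0].
- by move=> r; apply: integral_ge0 => y _; exact: heatp_ge0.
have aa0 : (0 < a + a)%R by lra.
have aan : (a + a < n%:R / 2)%R by rewrite /a; lra.
have [D D0 DE] := integral_pw_heatp_bounded aa0 aan tp.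
rewrite !lte_mul_pinfty ?lee_fin ?exprn_ge0 ?(ltW k0) ?(ltW B0)//.
apply: (@le_lt_trans _ _ (D%:E * p setT)); last first.
  by rewrite lte_mul_pinfty ?lee_fin//; case: tp.
rewrite -integral_cst//.
have -> : \int[leb]_r ((pw (a + a - 1) r)%:E * \int[p]_y heatp r p y) =
    \int[p]_y \int[leb]_r ((pw (a + a - 1) r)%:E * heatp r p y).
  rewrite -(@tonelli_leb_radon _ _ p
    (fun r y => (pw (a + a - 1) r)%:E * heatp r p y))//; last 2 first.
  - exact: measurable_pw_heatp.
  - by move=> r y; exact: pw_heatp_ge0.
  apply: eq_integral => r _; rewrite ge0_integralZl_EFin ?pw_ge0//.
  - by move=> y _; exact: heatp_ge0.
  - exact: mHp.
apply: ge0_le_integral.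
- exact: measurableT.
- by move=> y _; apply: integral_ge0 => r _; exact: pw_heatp_ge0.
- apply: measurable_integral_leb => [|y r]; last exact: pw_heatp_ge0.
  exact: measurable_pw_heatp.
- exact: measurable_cst.
- by move=> y _; exact: DE.
Qed.

End riesz_potentials.

(** * Abel inversion *)

Section abel.
Context (R : realType).
Local Notation leb := (@lebesgue_measure R).
Local Open Scope ereal_scope.

(** Integrable nonnegative functions on the half-line. *)
Definition weight (w : R -> R) := [/\ measurable_fun setT w,
  forall s, (0 <= w s)%R, forall s, (s <= 0)%R -> w s = 0%R &
  \int[leb]_s (w s)%:E < +oo].

(** The integral of [H] against the fractional integral of order $g$ of [w],
without the factor $1 / \Gamma(g)$. *)
Definition fracint (g : R) (w : R -> R) (H : R -> \bar R) : \bar R :=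
  \int[leb]_t \int[leb]_s ((pw (g - 1) t * w s)%:E * H (t + s)%R).

Lemma measurable_fracint_arg g (w : R -> R) (H : R -> \bar R) :
  measurable_fun setT w -> measurable_fun setT H ->
  measurable_fun setT (fun z : R * R =>
    (pw (g - 1) z.1 * w z.2)%:E * H (z.1 + z.2)%R).
Proof.
move=> mw mH; apply: emeasurable_funM.
  apply/measurable_EFinP; apply: measurable_funM.
    exact: (measurableT_comp (measurable_pw _)).
  exact: (measurableT_comp mw).
apply: (measurableT_comp mH); exact: measurable_funD.
Qed.

Lemma fracintD g (w1 w2 : R -> R) (H : R -> \bar R) :
  measurable_fun setT w1 -> (forall s, (0 <= w1 s)%R) ->
  measurable_fun setT w2 -> (forall s, (0 <= w2 s)%R) ->
  measurable_fun setT H -> (forall r, 0 <= H r) ->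
  fracint g (fun s => w1 s + w2 s)%R H = fracint g w1 H + fracint g w2 H.
Proof.
move=> mw1 w10 mw2 w20 mH H0.
have m1 := measurable_fracint_arg g mw1 mH.
have m2 := measurable_fracint_arg g mw2 mH.
have pos w t s : (forall s, (0 <= w s)%R) ->
    0 <= (pw (g - 1) t * w s)%:E * H (t + s)%R.
  by move=> w0; rewrite mule_ge0// lee_fin mulr_ge0 ?pw_ge0.
rewrite /fracint -ge0_integralD//.
- apply: eq_integral => t _; rewrite -ge0_integralD//.
  + apply: eq_integral => s _; rewrite mulrDr EFinD ge0_muleDl//.
      by rewrite lee_fin mulr_ge0 ?pw_ge0.
    by rewrite lee_fin mulr_ge0 ?pw_ge0.
  + by move=> s _; exact: pos.
  + exact: (measurableT_comp m1 (measurable_pair1 t)).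
  + by move=> s _; exact: pos.
  + exact: (measurableT_comp m2 (measurable_pair1 t)).
- by move=> t _; apply: integral_ge0 => s _; exact: pos.
- apply: (measurable_integral_leb (f := fun t s =>
    (pw (g - 1) t * w1 s)%:E * H (t + s)%R)) => // t s; exact: pos.
- by move=> t _; apply: integral_ge0 => s _; exact: pos.
- apply: (measurable_integral_leb (f := fun t s =>
    (pw (g - 1) t * w2 s)%:E * H (t + s)%R)) => // t s; exact: pos.
Qed.

Let adde_mule_cancel (x y z u c s a t : \bar R) : z \is a fin_num ->
  x + z = y + u -> u = c * s -> s = a + t -> z = c * a -> 0 <= a -> 0 <= t ->
  x = y + c * t.
Proof.
move=> zf xz uE sE zE a0 t0; have uz : u = z + c * t.
  by rewrite uE sE zE ge0_muleDr.
rewrite -[LHS](addeK x zf) xz uz addeCA addeC addeA.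
by rewrite [X in X + _]addeC subee// add0e.
Qed.

(** Abel's inversion: since the fractional integral of order $g$ of
$s^{-g}$ is a constant on the half-line, the difference of $s^{-g}$ and of its
translate by $b$, whose positive and negative parts are integrable, has
fractional integral $C 1_{]0, b]}$. *)
Lemma abel_inversion (g : R) : (0 < g)%R -> (g < 1)%R ->
  exists2 C : R, (0 < C)%R & forall b : R, (0 < b)%R -> (b < 1)%R ->
    exists w1 w2, [/\ weight w1, weight w2 & forall H : R -> \bar R,
      measurable_fun setT H -> (forall r, 0 <= H r) ->
      \int[leb]_r ((pw 0 r)%:E * H r) < +oo ->
      fracint g w1 H = fracint g w2 H +
        C%:E * \int[leb]_r ((\1_(`]0%R, b]%classic) r)%:E * H r)].
Proof.
move=> g0 g1; have g10 : (0 < 1 - g)%R by rewrite subr_gt0.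
have [C C0 CE] := beta_convolution g0 g10; exists C => // b b0 b1.
pose u (s : R) : R := pw (- g) s.
pose v (s : R) : R := pw (- g) (s - b).
(* w1 and w2 are the positive and the negative part of u - v *)
pose mn (s : R) : R := Num.min (u s) (v s).
pose w1 s : R := (u s - mn s)%R.
pose w2 s : R := (v s - mn s)%R.
have mu : measurable_fun setT u by exact: measurable_pw.
have mv : measurable_fun setT v.
  by apply: (measurableT_comp (measurable_pw _)); exact: measurable_funB.
have mmn : measurable_fun setT mn by exact: measurable_minr.
have mw1 : measurable_fun setT w1 by exact: measurable_funB.
have mw2 : measurable_fun setT w2 by exact: measurable_funB.
have u0 s : (0 <= u s)%R by exact: pw_ge0.
have v0 s : (0 <= v s)%R by exact: pw_ge0.
have mn0 s : (0 <= mn s)%R by rewrite le_min u0 v0.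
have w10 s : (0 <= w1 s)%R by rewrite subr_ge0 ge_min lexx.
have w20 s : (0 <= w2 s)%R by rewrite subr_ge0 ge_min lexx orbT.
have w1_le s : (w1 s <= u s)%R by rewrite gerBl.
have w2_le s : (w2 s <= v s)%R by rewrite gerBl.
have powNg x y : (0 < x)%R -> (x <= y)%R -> (y `^ (- g) <= x `^ (- g))%R.
  move=> x0 xy; have y0 := lt_le_trans x0 xy.
  rewrite !powRN lef_pV2 ?posrE ?powR_gt0//.
  by rewrite ge0_ler_powR ?nnegrE ?(ltW g0) ?(ltW x0) ?(ltW y0).
exists w1, w2; split.
- split => // [s s0|].
    by apply/eqP; rewrite eq_le w10 andbT (le_trans (w1_le s))// /u pw0.
  apply: (@integral_le_pw_lty _ w1 (- g)%R (- 2)%R 1%R) => //.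
  + by rewrite ltrN2.
  + by rewrite ltrN2 ltr1n.
  + by move=> t _; rewrite mul1r; exact: w1_le.
  + move=> t t1; rewrite mul1r.
    have tb : (0 < t - b)%R by rewrite subr_gt0 (lt_le_trans b1).
    have ut : (u t <= v t)%R.
      have t0 : (0 < t)%R by exact: lt_le_trans t1.
      by rewrite /u /v !pwE//; apply: powNg => //; rewrite gerBl ltW.
    by rewrite /w1 /mn min_l// subrr pw_ge0.
- split => // [s s0|].
    apply/eqP; rewrite eq_le w20 andbT (le_trans (w2_le s))// /v pw0//.
    by rewrite subr_le0 (le_trans s0)// ltW.
  (* translate by b *)
  rewrite (@ge0_integral_shift _ b)//; last exact/measurable_EFinP.
  have mw2b : measurable_fun setT (fun s : R => w2 (s + b)%R).
    by apply: (measurableT_comp mw2); exact: measurable_funD.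
  apply: (@integral_le_pw_lty _ (fun s => w2 (s + b)%R) (- g)%R (- g - 1)%R 1%R) => //.
  + by rewrite ltrN2.
  + by lra.
  + by move=> t _; rewrite mul1r (le_trans (w2_le _))// /v addrK.
  + move=> t t1; rewrite mul1r.
    have t0 : (0 < t)%R by exact: lt_le_trans t1.
    have tb0 : (0 < t + b)%R by rewrite addr_gt0.
    rewrite /w2 /mn /u /v addrK !pwE// min_l; last first.
      by rewrite powNg// lerDl ltW.
    (* x^(-g) - (x + b)^(-g) = x^(-g) (1 - (x / (x + b))^g) *)
    have -> : ((t + b) `^ (- g) = t `^ (- g) * (t / (t + b)) `^ g)%R.
      rewrite {2}(_ : t = t / (t + b) * (t + b))%R; last first.
        by rewrite divfK ?gt_eqF.
      rewrite powRM ?divr_ge0 ?(ltW t0) ?(ltW tb0)//.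
      rewrite mulrAC -powRD ?addNr ?powRr0 ?mul1r//.
      by rewrite (gt_eqF (divr_gt0 t0 tb0)) implybT.
    rewrite -[X in (X - _)%R]mulr1 -mulrBr powRD; last by rewrite (gt_eqF t0) implybT.
    rewrite ler_wpM2l ?powR_ge0// powR_inv1 ?(ltW t0)//.
    apply: (@le_trans _ _ (1 - t / (t + b))%R).
      rewrite lerB// ger1_powR ?(ltW g1)// divr_gt0//= ler_pdivrMr// mul1r.
      by rewrite lerDl ltW.
    rewrite (_ : 1 - t / (t + b) = b / (t + b))%R; last by field; rewrite gt_eqF.
    rewrite ler_pdivrMr// mulrDr mulVf ?gt_eqF//.
    rewrite (le_trans (ltW b1))// lerDl mulr_ge0 ?invr_ge0 ?(ltW t0) ?(ltW b0)//.
move=> H mH H0 Hoo.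
have mHb : measurable_fun setT (fun r : R => H (r + b)%R).
  by apply: (measurableT_comp mH); exact: measurable_funD.
have TuE (K : R -> \bar R) : measurable_fun setT K -> (forall r, 0 <= K r) ->
    fracint g u K = C%:E * \int[leb]_r ((pw 0 r)%:E * K r).
  move=> mK K0; have := CE K mK K0; rewrite (_ : g + (1 - g) - 1 = 0)%R; last by ring.
  by move=> <-; rewrite (_ : 1 - g - 1 = - g)%R//; ring.
have TvE : fracint g v H = C%:E * \int[leb]_r ((pw 0 (r - b))%:E * H r).
  transitivity (fracint g u (fun r => H (r + b)%R)).
    apply: eq_integral => t _.
    have mh : measurable_fun setT (fun s : R =>
        (pw (g - 1) t * v s)%:E * H (t + s)%R).
      exact: (measurableT_comp (measurable_fracint_arg g mv mH) (measurable_pair1 t)).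
    have h0 s : 0 <= (pw (g - 1) t * v s)%:E * H (t + s)%R.
      by rewrite mule_ge0// lee_fin mulr_ge0 ?pw_ge0.
    have -> := ge0_integral_shift b mh h0.
    by apply: eq_integral => s _; rewrite /v addrK addrA.
  rewrite (TuE _ mHb (fun r => H0 _)); congr (_ * _).
  have mh : measurable_fun setT (fun r : R => (pw 0 (r - b))%:E * H r).
    apply: emeasurable_funM => //; apply/measurable_EFinP.
    by apply: (measurableT_comp (measurable_pw _)); exact: measurable_funB.
  have h0 r : 0 <= (pw 0 (r - b))%:E * H r.
    by rewrite mule_ge0// lee_fin pw_ge0.
  have -> := ge0_integral_shift b mh h0.
  by apply: eq_integral => r _; rewrite addrK.
have mI : measurable_fun setT (fun r : R => (\1_(`]0%R, b]%classic) r : R)%:E).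
  by apply/measurable_EFinP; exact: measurable_indic.
have mv0 : measurable_fun setT (fun r : R => (pw 0 (r - b))%:E).
  apply/measurable_EFinP.
  by apply: (measurableT_comp (measurable_pw _)); exact: measurable_funB.
have I1 : 0 <= \int[leb]_r ((pw 0 (r - b))%:E * H r).
  by apply: integral_ge0 => r _; rewrite mule_ge0// lee_fin pw_ge0.
have I2 : 0 <= \int[leb]_r ((\1_(`]0%R, b]%classic) r)%:E * H r).
  by apply: integral_ge0 => r _; rewrite mule_ge0// lee_fin.
have split0 : \int[leb]_r ((pw 0 r)%:E * H r) =
    \int[leb]_r ((pw 0 (r - b))%:E * H r) +
    \int[leb]_r ((\1_(`]0%R, b]%classic) r)%:E * H r).
  rewrite -ge0_integralD//.
  - apply: eq_integral => r _; rewrite -ge0_muleDl ?lee_fin ?pw_ge0//.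
    congr (_ * _); rewrite -EFinD; congr EFin; rewrite /pw indicE.
    rewrite subr_gt0; case: (ltP 0%R r) => r0; last first.
      rewrite ltNge (le_trans r0 (ltW b0))/= memNset ?addr0// => /=.
      by rewrite in_itv/= ltNge r0.
    case: (ltP b r) => br.
      by rewrite !powRr0 memNset ?addr0//= in_itv/= r0/= leNgt br.
    by rewrite powRr0 mem_set ?add0r//= in_itv/= r0 br.
  - by move=> r _; rewrite mule_ge0// lee_fin pw_ge0.
  - exact: emeasurable_funM.
  - by move=> r _; rewrite mule_ge0// lee_fin.
  - exact: emeasurable_funM.
have Tv_fin : fracint g v H \is a fin_num.
  rewrite ge0_fin_numE; last first.
    apply: integral_ge0 => t _; apply: integral_ge0 => s _.
    by rewrite mule_ge0// lee_fin mulr_ge0 ?pw_ge0.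
  rewrite TvE; apply: lte_mul_pinfty; [by rewrite lee_fin ltW|by []|].
  apply: le_lt_trans Hoo; rewrite split0; apply: leeDl.
  by apply: integral_ge0 => r _; rewrite mule_ge0// lee_fin.
have sumE : fracint g w1 H + fracint g v H = fracint g w2 H + fracint g u H.
  have wE : (fun s => w1 s + v s)%R = (fun s => w2 s + u s)%R.
    by apply/funext => s; rewrite /w1 /w2; ring.
  apply: (eq_trans (esym (fracintD g mw1 w10 mv v0 mH H0))).
  apply: (eq_trans _ (fracintD g mw2 w20 mu u0 mH H0)).
  exact: (congr1 (fun w => fracint g w H) wE).
exact: (adde_mule_cancel Tv_fin sumE (TuE _ mH H0) split0 TvE I1 I2).
Qed.

End abel.

(** * Approximation of indicators by potentials *)

Section mixtures.
Context (R : realType) (n : nat).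
Local Notation rV := 'rV[R]_n.
Local Notation leb := (@lebesgue_measure R).
Local Notation m := (lebesgue_rV R n).
Local Open Scope ereal_scope.
Implicit Types (p q : {measure set rV -> \bar R}) (beta : R).

Lemma dominated_density (g : rV -> R) (mg : measurable_fun setT g)
    (g0 : forall x, (0 <= g x)%R) (M : R) :
  (forall x, (g x <= M)%R) -> dominated (density m mg g0) M.
Proof.
move=> gM A mA; rewrite /= /density -integral_cst//.
apply: ge0_le_integral => //.
- by move=> x _; rewrite lee_fin.
- by apply/measurable_EFinP; exact: measurable_funTS.
- by move=> x _; rewrite lee_fin.
Qed.

(** A superposition of heat flows of a tame measure is a tame measure. *)
Lemma heat_mixture (w : R -> R) q : weight w -> tame q ->
  exists p, tame p /\ forall t x, (0 < t)%R ->
    heatp t p x = \int[leb]_s ((w s)%:E * heatp (t + s) q x).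
Proof.
move=> [mw w0 wneg wfin] tq; have rq := tame_radon tq.
have [qT [M M0 qM]] := tq.
have [W WE] : exists W, \int[leb]_s (w s)%:E = W%:E.
  exists (fine (\int[leb]_s (w s)%:E)); rewrite fineK// ge0_fin_numE//.
  by apply: integral_ge0 => s _; rewrite lee_fin.
pose F x s := (w s)%:E * heatp s q x.
have mwE : measurable_fun setT (EFin \o w) by exact/measurable_EFinP.
have F0 x s : 0 <= F x s by rewrite mule_ge0 ?heatp_ge0 ?lee_fin.
have mF d (T : measurableType d) (f : T -> rV) (g : T -> R) :
    measurable_fun setT f -> measurable_fun setT g ->
    measurable_fun setT (fun u => F (f u) (g u)).
  move=> mf mg; apply: emeasurable_funM; last exact: measurable_heatp.
  exact: (measurableT_comp mwE mg).
pose G x := \int[leb]_s F x s.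
have G0 x : 0 <= G x by exact: integral_ge0.
have mG : measurable_fun setT G by apply: measurable_integral_leb => //; exact: mF.
have GM x : G x <= (W * M)%:E.
  rewrite EFinM -WE -ge0_integralZr//; last by move=> s _; rewrite lee_fin.
  apply: ge0_le_integral.
  - exact: measurableT.
  - by move=> s _; exact: F0.
  - exact: mF.
  - by apply: emeasurable_funM => //; exact: measurable_cst.
  - by move=> s _; rewrite lee_wpmul2l ?lee_fin//; exact: heatp_le_dominated.
pose g x := fine (G x).
have gE x : (g x)%:E = G x.
  by rewrite fineK// ge0_fin_numE// (le_lt_trans (GM x))// ltry.
have mg : measurable_fun setT g
  by apply/measurable_EFinP; rewrite (_ : EFin \o g = G)//; exact/funext.
have g0 x : (0 <= g x)%R by rewrite fine_ge0.
have gM x : (g x <= W * M)%R by rewrite -lee_fin gE.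
have W0 : (0 <= W)%R.
  by rewrite -lee_fin -WE; apply: integral_ge0 => s _; rewrite lee_fin.
pose p : {measure set rV -> \bar R} := density m mg g0.
have heatpE (h : rV -> R) : measurable_fun setT h -> (forall y, (0 <= h y)%R) ->
    \int[p]_y (h y)%:E =
    \int[leb]_s ((w s)%:E * \int[m]_y ((h y)%:E * heatp s q y)).
  move=> mh h0; have mhE : measurable_fun setT (EFin \o h) by exact/measurable_EFinP.
  rewrite [LHS](ge0_integral_density m mg g0 mhE); last by move=> y; rewrite /= lee_fin.
  transitivity (\int[m]_y \int[leb]_s (F y s * (h y)%:E)).
    apply: eq_integral => y _; rewrite gE /G ge0_integralZr ?lee_fin//.
    exact: mF.
  rewrite -(@tonelli_leb_radon _ _ m (fun s y => F y s * (h y)%:E)); last 3 first.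
  - exact: radon_lebesgue.
  - apply: emeasurable_funM; first exact: mF.
    exact: (measurableT_comp mhE).
  - by move=> s y; rewrite mule_ge0// lee_fin.
  apply: eq_integral => s _; rewrite -ge0_integralZl_EFin//.
  - by apply: eq_integral => y _; rewrite /F -muleA [_ * (h y)%:E]muleC.
  - by move=> y _; rewrite mule_ge0 ?heatp_ge0// lee_fin.
  - by apply: emeasurable_funM => //; exact: measurable_heatp.
exists p; split; [split|].
- rewrite -[p setT]mul1e -integral_cst// [ltLHS](heatpE (cst 1%R))//.
  apply: (@le_lt_trans _ _ (\int[leb]_s ((w s)%:E * q setT))).
    apply: ge0_le_integral.
    + exact: measurableT.
    + by move=> s _; rewrite mule_ge0 ?lee_fin//; apply: integral_ge0 => y _; rewrite mul1e heatp_ge0.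
    + apply: emeasurable_funM => //; apply: measurable_integral_radon.
      * exact: radon_lebesgue.
      * by under eq_fun do rewrite mul1e; exact: measurable_heatp.
      * by move=> s y; rewrite mul1e heatp_ge0.
    + by apply: emeasurable_funM => //; exact: measurable_cst.
    + move=> s _; rewrite lee_wpmul2l ?lee_fin//.
      under eq_integral do rewrite mul1e.
      have [s0|s0] := ltP 0%R s; first by rewrite integral_heatp.
      rewrite integral0_eq// => y _; rewrite /heatp integral0_eq// => z _.
      by rewrite /heat [pw (- (n%:R / 2)) s]pw0// mulr0 mul0r.
  rewrite ge0_integralZr//; last by move=> s _; rewrite lee_fin.
  by rewrite WE lte_mul_pinfty// lee_fin.
- by exists (W * M)%R; [rewrite mulr_ge0|exact: dominated_density].
- move=> t x t0; rewrite /heatp (heatpE (fun y => heat t (x - y))); last 2 first.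
  + apply: measurable_heat; first exact: measurable_cst.
    by apply: measurable_funB_rV => //; exact: measurable_cst.
  + by move=> y; exact: heat_ge0.
  apply: eq_integral => s _; have [s0|s0] := ltP 0%R s; last by rewrite wneg// !mul0e.
  by congr (_ * _); exact: heatp_semigroup.
Qed.

End mixtures.

Section concentration.
Context (R : realType) (n : nat).
Local Notation rV := 'rV[R]_n.
Local Notation m := (lebesgue_rV R n).

Lemma nsq_ge_norm (x : rV) : `|x| ^+ 2 <= nsq x.
Proof.
rewrite -(sqr_sqrtr (nsq_ge0 x)) lerXn2r ?nnegrE ?sqrtr_ge0//.
apply: norm_le_coord => [|i]; first exact: sqrtr_ge0.
rewrite -sqrtr_sqr ler_sqrt ?nsq_ge0// /nsq (bigD1 i)//= lerDl.
by apply: sumr_ge0 => j _; exact: sqr_ge0.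
Qed.

(** Away from the origin the heat kernel at time $t$ is $O(t)$ times the heat
kernel at time $2 t$; the bound $e^{-u} \le 1/u$ absorbs half of the exponent. *)
Lemma heat_tail (t d : R) (x : rV) : 0 < t -> 0 < d -> d <= `|x| ->
  heat t x <= 2 `^ (n%:R / 2) * 8 / d ^+ 2 * t * heat (2 * t) x.
Proof.
move=> t0 d0 dx; have dn : d ^+ 2 <= nsq x.
  by apply: le_trans (nsq_ge_norm x); rewrite lerXn2r ?nnegrE ?(ltW d0).
have n0 : 0 < nsq x by rewrite (lt_le_trans _ dn)// exprn_gt0.
have u0 : 0 < nsq x / 8 / t by rewrite !divr_gt0.
have -> : heat t x =
    2 `^ (n%:R / 2) * expR (- (nsq x / 8 / t)) * heat (2 * t) x.
  rewrite /heat !pwM// !pwE// !powR_inv1 ?(ltW t0)// [2 `^ (- (n%:R / 2))]powRN.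
  have -> : expR (- (nsq x / 4 * t^-1)) = expR (- (nsq x / 8 / t)) *
      expR (- (nsq x / 4 * (2^-1 * t^-1))).
    by rewrite -expRD; congr expR; field; rewrite gt_eqF.
  by field; rewrite gt_eqF// powR_gt0.
rewrite ler_wpM2r ?heat_ge0//.
rewrite (_ : _ * 8 / d ^+ 2 * t = 2 `^ (n%:R / 2) * (8 / d ^+ 2 * t)); last by ring.
rewrite ler_wpM2l ?powR_ge0//.
apply: le_trans (expRN_le 0 u0) _; rewrite expr1.
rewrite (_ : 1 / (nsq x / 8 / t) = 8 / nsq x * t); last first.
  by field; rewrite !gt_eqF.
by rewrite ler_wpM2r ?(ltW t0)// ler_wpM2l// lef_pV2 ?posrE// exprn_gt0.
Qed.

Local Open Scope ereal_scope.

(** The constant in the bound $O(t)$ for the heat that leaves a ball of radius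
$d$ by the time $t$. *)
Definition heat_tail_cst (d : R) : R := (2 `^ (n%:R / 2) * 8 / d ^+ 2)%R.

Lemma heat_tail_cst_ge0 d : (0 <= heat_tail_cst d)%R.
Proof. by rewrite /heat_tail_cst !mulr_ge0 ?powR_ge0 ?invr_ge0 ?sqr_ge0. Qed.

Lemma integral_heat_tail (t d : R) (x : rV) (D : set rV) : (0 < t)%R ->
  (0 < d)%R -> measurable D -> (forall y, D y -> (d <= `|x - y|)%R) ->
  \int[m]_(y in D) (heat t (x - y))%:E <= (heat_tail_cst d * t)%:E.
Proof.
move=> t0 d0 mD Dd.
have t20 : (0 < 2 * t)%R by rewrite mulr_gt0.
have c0 : (0 <= heat_tail_cst d * t)%R by rewrite mulr_ge0 ?heat_tail_cst_ge0 ?ltW.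
rewrite -[leRHS]mule1 -(integral_heat x t20).
rewrite -ge0_integralZl_EFin//; last 2 first.
- by move=> y _; rewrite lee_fin heat_ge0.
- exact: measurable_heatB.
apply: (@le_trans _ _ (\int[m]_(y in D)
    ((heat_tail_cst d * t)%:E * (heat (2 * t) (x - y))%:E))).
  apply: ge0_le_integral => //.
  - by move=> y _; rewrite lee_fin heat_ge0.
  - by apply: measurable_funTS; exact: measurable_heatB.
  - by apply: measurable_funTS; apply: measurable_funeM; exact: measurable_heatB.
  - by move=> y Dy; rewrite -EFinM lee_fin; apply: heat_tail => //; exact: Dd.
apply: ge0_subset_integral => //.
- by apply: measurable_funeM; exact: measurable_heatB.
- by move=> y _; rewrite -EFinM lee_fin mulr_ge0 ?heat_ge0.
Qed.

End concentration.

Section restriction.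
Local Open Scope ereal_scope.

(** The restriction of a measure to $A$, as a measure on the whole space. *)
Lemma restricted_measure d (T : measurableType d) (R : realType)
    (mu : {measure set T -> \bar R}) (A : set T) : measurable A ->
  exists q : {measure set T -> \bar R},
    (forall B, measurable B -> q B = mu (A `&` B)) /\
    (forall h : T -> \bar R, measurable_fun setT h -> (forall x, 0 <= h x) ->
      \int[q]_x h x = \int[mu]_(x in A) h x).
Proof.
move=> mA; have mI : measurable_fun setT (\1_A : T -> R) by exact: measurable_indic.
have I0 x : (0 <= \1_A x :> R)%R by [].
exists (density mu mI I0); split => [B mB|h mh h0].
  by rewrite /= /density integral_indic.
rewrite ge0_integral_density// [RHS]integral_mkcond epatch_indic.
by apply: eq_integral => x _; rewrite muleC.
Qed.

End restriction.

(** If the integral of $u$ is the measure of $U$, then the squared distance from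
$u$ to $1_U$ is small as soon as most of the integral of $u$ comes from $U$. *)
Lemma indicator_sq_le d (T : measurableType d) (R : realType)
    (mu : {measure set T -> \bar R}) (U : set T) (u : T -> R) :
  measurable U -> measurable_fun setT u -> (forall x, 0 <= u x) ->
  (forall x, u x <= 1) ->
  (\int[mu]_x ((\1_U x - u x) ^+ 2)%:E + 2%:E * \int[mu]_(x in U) (u x)%:E
    <= \int[mu]_x (u x)%:E + mu U)%E.
Proof.
move=> mU mu' u0 u1.
have mI : measurable_fun setT (\1_U : T -> R) by exact: measurable_indic.
have m1 : measurable_fun setT (fun x => ((\1_U x - u x) ^+ 2)%:E).
  by apply/measurable_EFinP; apply: measurable_funX; exact: measurable_funB.
have m2 : measurable_fun setT (fun x => (2 * (u x * \1_U x))%:E).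
  by apply/measurable_EFinP; do 2 apply: measurable_funM => //.
have m3 : measurable_fun setT (fun x => (u x)%:E) by exact/measurable_EFinP.
have m4 : measurable_fun setT (fun x => (\1_U x : R)%:E) by exact/measurable_EFinP.
have n1 x : (0 <= ((\1_U x - u x) ^+ 2)%:E)%E by rewrite lee_fin sqr_ge0.
have n2 x : (0 <= (2 * (u x * \1_U x))%:E)%E by rewrite lee_fin !mulr_ge0.
have n3 x : (0 <= (u x)%:E)%E by rewrite lee_fin.
have n4 x : (0 <= (\1_U x : R)%:E)%E by rewrite lee_fin.
have -> : (2%:E * \int[mu]_(x in U) (u x)%:E =
    \int[mu]_x (2 * (u x * \1_U x))%:E)%E.
  rewrite [X in (2%:E * X)%E]integral_mkcond epatch_indic.
  rewrite -ge0_integralZl_EFin//.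
  - by move=> x _; rewrite -EFinM lee_fin mulr_ge0.
  - exact: emeasurable_funM.
have <- : (\int[mu]_x (\1_U x : R)%:E = mu U)%E by rewrite integral_indic// setIT.
have <- := ge0_integralD mu measurableT (fun x _ => n1 x) m1 (fun x _ => n2 x) m2.
have <- := ge0_integralD mu measurableT (fun x _ => n3 x) m3 (fun x _ => n4 x) m4.
apply: ge0_le_integral.
- exact: measurableT.
- by move=> x _; rewrite adde_ge0 ?n1 ?n2.
- exact: emeasurable_funD.
- exact: emeasurable_funD.
- move=> x _; rewrite -!EFinD lee_fin.
  by have := u0 x; have := u1 x; rewrite indicE; case: (x \in U) => /=; nra.
Qed.

Section indicator_approximation.
Context (R : realType) (n : nat).
Local Notation rV := 'rV[R]_n.
Local Notation leb := (@lebesgue_measure R).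
Local Notation m := (lebesgue_rV R n).
Local Open Scope ereal_scope.
Implicit Types (p q : {measure set rV -> \bar R}) (beta : R).

(** $f$ is an $L^2$-limit of differences of potentials of tame measures. *)
Definition approximable beta (f : rV -> R) := forall e : R, (0 < e)%R ->
  exists p q, [/\ tame p, tame q &
    \int[m]_x ((f x - (fine (potential beta p x) -
                       fine (potential beta q x))) ^+ 2)%:E < e%:E].

Lemma tame_scale p (c : {nonneg R}) : tame p -> tame (mscale c p).
Proof.
move=> [pT [M M0 pM]]; split.
  by rewrite /= /mscale lte_mul_pinfty ?lee_fin.
exists (c%:num * M)%R; first by rewrite mulr_ge0.
by move=> A mA; rewrite /= /mscale EFinM -muleA lee_wpmul2l ?lee_fin// pM.
Qed.

Lemma tame_add p q : tame p -> tame q -> tame (measure_add p q).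
Proof.
move=> [pT [M M0 pM]] [qT [N N0 qN]]; split.
  by rewrite [ltLHS]measure_addE lte_add_pinfty.
exists (M + N)%R; first by rewrite addr_ge0.
move=> A mA; rewrite [leLHS]measure_addE EFinD ge0_muleDl ?lee_fin//.
by rewrite leeD ?pM ?qN.
Qed.

Lemma potential_scale beta p (c : {nonneg R}) x : (0 < beta)%R ->
  (beta < n%:R)%R ->
  potential beta (mscale c p) x = c%:num%:E * potential beta p x.
Proof.
move=> b0 bn; rewrite /potential ge0_integral_mscale//.
- exact: (measurableT_comp (measurable_riesz_kernel b0 bn) (measurable_pair1 x)).
- by move=> y _; exact: riesz_kernel_ge0.
Qed.

Lemma potential_add beta p q x : (0 < beta)%R -> (beta < n%:R)%R ->
  potential beta (measure_add p q) x = potential beta p x + potential beta q x.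
Proof.
move=> b0 bn; rewrite /potential ge0_integral_measure_add//.
- by move=> y _; exact: riesz_kernel_ge0.
- exact: (measurableT_comp (measurable_riesz_kernel b0 bn) (measurable_pair1 x)).
Qed.

Lemma potential_fin_num beta p x : (0 < beta)%R -> (beta < n%:R)%R ->
  tame p -> potential beta p x \is a fin_num.
Proof.
move=> b0 bn tp; have [B B0 BE] := potential_bounded b0 bn tp.
rewrite ge0_fin_numE; last exact: potential_ge0.
by apply: le_lt_trans (BE x) _; exact: ltry.
Qed.

(** For $A$ one takes the points at distance at least $d$ from the complement
of $U$, with $d$ small. *)
Lemma inner_approximation (U : set rV) (e : R) : open U -> m U < +oo ->
  (0 < e)%R -> exists A (d : R), [/\ measurable A, A `<=` U, (0 < d)%R,
    forall x y, A x -> ~ U y -> (d <= `|x - y|)%R & m U <= m A + e%:E].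
Proof.
move=> oU Uoo e0.
pose A (k : nat) : set rV := ~` \bigcup_(y in ~` U) ball y (k.+1%:R^-1)%R.
have mA k : measurable (A k).
  apply: measurableC; apply: open_measurable_rV; apply: bigcup_open => y _.
  exact: ball_open.
have AE k x : A k x <-> forall y, ~ U y -> (k.+1%:R^-1 <= `|x - y|)%R.
  split => [Ax y Uy|Ax [y Uy] /=].
    rewrite leNgt; apply/negP => xy; apply: Ax; exists y => //.
    by rewrite -ball_normE /ball_ /= distrC.
  by rewrite -ball_normE /ball_ /= distrC ltNge Ax.
have AU k : A k `<=` U.
  move=> x /AE Ax; apply: contrapT => /Ax.
  by rewrite subrr normr0 leNgt invr_gt0 ltr0n.
have ndA : nondecreasing_seq A.
  move=> i j ij; apply/subsetPset => x /AE Ax; apply/AE => y Uy.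
  by apply: le_trans (Ax y Uy); rewrite lef_pV2 ?posrE// ler_nat.
have UA : \bigcup_k A k = U.
  apply/seteqP; split => [x [k _ /AU]//|x Ux].
  have /nbhs_ballP[r /= r0 rU] : nbhs x U by exact: open_nbhs_nbhs.
  have [k _ /(_ k (leqnn _)) kP] := near_infty_natSinv_lt (PosNum r0).
  exists k => //; apply/AE => y Uy; rewrite leNgt; apply/negP => xy; apply: Uy.
  apply: rU; rewrite -ball_normE /ball_ /=.
  exact: lt_trans kP.
have mUU : measurable U by exact: open_measurable_rV.
have cv : m (A k) @[k --> \oo] --> m U.
  by have := @nondecreasing_cvg_mu _ _ _ m A mA; rewrite UA => /(_ mUU ndA).
have Ufin : m U \is a fin_num by rewrite ge0_fin_numE.
have [k kP] : exists k, m U - e%:E < m (A k).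
  apply: contrapT => nk.
  have : m U <= m U - e%:E.
    rewrite -{1}(cvg_lim _ cv)//; apply: lime_le; first by apply/cvg_ex; exists (m U).
    by apply: nearW => k; rewrite leNgt; apply/negP => Ak; apply: nk; exists k.
  by rewrite leNgt => /negP; apply; rewrite lteBlDr// lteDl ?lte_fin.
exists (A k), (k.+1%:R^-1)%R; split => //.
- by move=> x y /AE; exact.
- by rewrite -leeBlDr//; exact: ltW.
Qed.

(** The average over $0 < r < b$ of the heat flow $P_r 1_U$ is a difference of
potentials of tame measures by Abel inversion. It has values in $[0, 1]$ and the
same integral as $1_U$, and for small $b$ it is close to $1$ on the points that
are not close to the complement of $U$. *)
Lemma approximable_open beta (U : set rV) : (3 <= n)%N -> (0 < beta)%R ->
  (beta < 2)%R -> open U -> m U < +oo -> approximable beta (\1_U).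
Proof.
move=> n3 b0 b2 oU Uoo e e0.
have n3R : (3 <= n%:R :> R)%R by rewrite (ler_nat R 3).
have bn : (beta < n%:R)%R by lra.
have mU : measurable U by exact: open_measurable_rV.
have [V VE] : exists V, m U = V%:E.
  by exists (fine (m U)); rewrite fineK// ge0_fin_numE.
have V0 : (0 <= V)%R by rewrite -lee_fin -VE.
have [q [qE qint]] := restricted_measure m mU.
have tq : tame q.
  split; first by rewrite qE// setIT.
  exists 1%R => // A mA; rewrite qE// mul1e; apply: le_measure; rewrite ?inE//.
  exact: measurableI.
have rq := tame_radon tq.
have qT : q setT = V%:E by rewrite qE// setIT.
have e8 : (0 < e / 8)%R by rewrite divr_gt0.
have [A [d [mA AU d0 dA UA]]] := inner_approximation oU Uoo e8.
pose K : R := heat_tail_cst n d.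
have K0 : (0 <= K)%R by exact: heat_tail_cst_ge0.
pose b : R := (Num.min 2^-1 (e / 8 / (V * K + 1)))%R.
have VK1 : (0 < V * K + 1)%R by rewrite ltr_wpDl// mulr_ge0.
have bpos : (0 < b)%R by rewrite lt_min invr_gt0 ltr0n/= divr_gt0.
have b1 : (b < 1)%R by rewrite gt_min invf_lt1// ltr1n.
have bVK : (b * (V * K) <= e / 8)%R.
  apply: (@le_trans _ _ (b * (V * K + 1))%R).
    by rewrite ler_wpM2l ?(ltW bpos)// lerDl.
  by rewrite -ler_pdivlMr// ge_min lexx orbT.
have bVK4 : (b * (V * K) + e / 8 <= e / 4)%R by lra.
(* Abel inversion gives two tame measures with potentials differing by the
   integral over ]0, b] of the heat flow of 1_U *)
pose H x r := heatp r q x.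
have mH x : measurable_fun setT (H x) by exact: (@measurable_heatp _ _ _ _ _ id (cst x)).
have H0 x r : 0 <= H x r by exact: heatp_ge0.
(* finite, because the heat flow is O(r ^ (- n / 2)) with 1 < n / 2 *)
have Hoo x : \int[leb]_r ((pw 0 r)%:E * H x r) < +oo.
  have a1 : (1 < n%:R / 2 :> R)%R by lra.
  have [B B0 /(_ x)] := integral_pw_heatp_bounded ltr01 a1 tq.
  by rewrite subrr => /le_lt_trans; apply; exact: ltry.
have g0 : (0 < beta / 2)%R by lra.
have g1 : (beta / 2 < 1)%R by lra.
have [C C0 CE] := abel_inversion g0 g1.
have [w1 [w2 [ww1 ww2 wE]]] := CE b bpos b1.
have [p1 [tp1 p1E]] := heat_mixture ww1 tq.
have [p2 [tp2 p2E]] := heat_mixture ww2 tq.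
have [k k0 kE] := potential_heatp b0 bn.
have potE w p x : weight w -> tame p -> (forall t x, (0 < t)%R ->
    heatp t p x = \int[leb]_s ((w s)%:E * heatp (t + s) q x)) ->
    potential beta p x = k%:E * fracint (beta / 2) w (H x).
  move=> [mw w0 wneg wfin] tp pE; rewrite kE; last exact: tame_radon.
  congr (_ * _); apply: eq_integral => t _.
  have [t0|t0] := ltP 0%R t; last first.
    by rewrite pw0// mul0e integral0_eq// => s _; rewrite mul0r mul0e.
  rewrite pE// -ge0_integralZl_EFin ?pw_ge0//.
  - by apply: eq_integral => s _; rewrite muleA -EFinM.
  - by move=> s _; rewrite mule_ge0 ?heatp_ge0// lee_fin.
  - apply: emeasurable_funM; first exact/measurable_EFinP.
    by apply: measurable_heatp => //; exact: measurable_funD.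
pose I x := \int[leb]_r ((\1_(`]0%R, b]%classic) r)%:E * H x r).
have mind : measurable_fun setT (fun r : R => (\1_(`]0%R, b]%classic) r : R)%:E).
  by apply/measurable_EFinP; exact: measurable_indic.
have mindH x : measurable_fun setT (fun r : R =>
    (\1_(`]0%R, b]%classic) r)%:E * H x r).
  by apply: emeasurable_funM; [exact: mind|exact: mH].
have indb : \int[leb]_r (\1_(`]0%R, b]%classic) r : R)%:E = b%:E.
  have lb : leb `]0%R, b]%classic = b%:E.
    by rewrite lebesgue_measure_itv/= lte_fin bpos -EFinB subr0.
  by rewrite integral_indic// setIT.
have I0 x : 0 <= I x by apply: integral_ge0 => r _; rewrite mule_ge0 ?H0// lee_fin.
have Ib x : I x <= b%:E.
  rewrite -indb; apply: ge0_le_integral.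
  - exact: measurableT.
  - by move=> r _; rewrite mule_ge0 ?H0// lee_fin.
  - exact: mindH.
  - exact: mind.
  - move=> r _; rewrite -[leRHS]mule1 lee_wpmul2l ?lee_fin//.
    have [_ [M M0 qM]] := tq.
    apply: heatp_le_dominated => // B mB; rewrite qE// mul1e.
    by apply: le_measure; rewrite ?inE//; exact: measurableI.
have Ifin x : I x \is a fin_num.
  by rewrite ge0_fin_numE// (le_lt_trans (Ib x))// ltry.
have mI : measurable_fun setT I.
  apply: measurable_integral_leb.
  - apply: emeasurable_funM; first exact: (measurableT_comp mind).
    exact: measurable_heatp.
  - by move=> x r; rewrite mule_ge0 ?H0// lee_fin.
have pdiff x : potential beta p1 x = potential beta p2 x + (k * C)%:E * I x.
  rewrite (potE w1 p1)// (potE w2 p2)// (wE (H x))//.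
  rewrite EFinM -muleA muleDr// ge0_adde_def// inE.
    apply: integral_ge0 => t _; apply: integral_ge0 => s _.
    by rewrite mule_ge0 ?H0// lee_fin mulr_ge0 ?pw_ge0//; case: ww2.
  by rewrite mule_ge0 ?I0// lee_fin ltW.
have c0 : (0 <= (k * C * b)^-1)%R by rewrite invr_ge0 !mulr_ge0 ?(ltW k0) ?(ltW C0) ?(ltW bpos).
exists (mscale (NngNum c0) p1), (mscale (NngNum c0) p2).
split; [exact: tame_scale|exact: tame_scale|].
(* the average of the heat flow of 1_U *)
pose u x : R := (b^-1 * fine (I x))%R.
have uE x : (fine (potential beta (mscale (NngNum c0) p1) x) -
    fine (potential beta (mscale (NngNum c0) p2) x))%R = u x.
  rewrite !potential_scale//= pdiff.
  have := potential_fin_num x b0 bn tp2; have := Ifin x.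
  rewrite /u; case: (I x) => // i _; case: (potential beta p2 x) => //= z _.
  by field; rewrite !gt_eqF.
under eq_integral do rewrite uE.
have u0 x : (0 <= u x)%R by rewrite mulr_ge0 ?invr_ge0 ?(ltW bpos) ?fine_ge0.
have u1 x : (u x <= 1)%R.
  rewrite /u mulrC ler_pdivrMr// mul1r -lee_fin fineK//.
have mu : measurable_fun setT u.
  apply: measurable_funM => //; apply/measurable_EFinP.
  by rewrite (_ : EFin \o _ = I)//; apply/funext => x; rewrite /= fineK.
have intu (D : set rV) : measurable D ->
    \int[m]_(x in D) (u x)%:E = (b^-1)%:E * \int[m]_(x in D) I x.
  move=> mD; rewrite -ge0_integralZl_EFin ?invr_ge0 ?(ltW bpos)//.
  - by apply: eq_integral => x _; rewrite /u EFinM fineK.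
  - exact: measurable_funTS.
have intuT : \int[m]_x (u x)%:E = V%:E.
  rewrite intu// /I -(@tonelli_leb_radon _ _ m
    (fun r x => (\1_(`]0%R, b]%classic) r)%:E * H x r)); last 3 first.
  - exact: radon_lebesgue.
  - apply: emeasurable_funM; first exact: (measurableT_comp mind).
    exact: measurable_heatp.
  - by move=> r x; rewrite mule_ge0 ?H0// lee_fin.
  transitivity ((b^-1)%:E * \int[leb]_r ((\1_(`]0%R, b]%classic) r)%:E * V%:E)).
    congr (_ * _); apply: eq_integral => r _.
    rewrite indicE; have [|_] := boolP (r \in `]0%R, b]%classic); last first.
      by rewrite mul0e integral0_eq// => x _; rewrite mul0e.
    rewrite inE/= in_itv/= => /andP[r0 rb].
    rewrite mul1e -qT -(integral_heatp rq r0).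
    by apply: eq_integral => x _; rewrite mul1e.
  rewrite ge0_integralZr//.
  by rewrite indb -!EFinM mulKf ?gt_eqF.
have Kb0 : (0 <= K * b)%R by rewrite mulr_ge0 ?(ltW bpos).
have HA x r : A x -> (0 < r)%R -> (r <= b)%R -> 1 <= H x r + (K * b)%:E.
  move=> Ax r0 rb; rewrite -(integral_heat x r0) -(setUv U).
  rewrite ge0_integral_setU//; last 4 first.
  - exact: measurableC.
  - by apply: measurable_funTS; exact: measurable_heatB.
  - by move=> y _; rewrite lee_fin heat_ge0.
  - by apply/disj_set2P; rewrite setICr.
  apply: leeD.
    rewrite /H /heatp qint//; first exact: measurable_heatB.
    by move=> y; rewrite lee_fin heat_ge0.
  apply: (@le_trans _ _ (K * r)%:E).
    apply: integral_heat_tail => //; first exact: measurableC.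
    by move=> y Uy; exact: dA.
  by rewrite lee_fin ler_wpM2l.
have uA x : A x -> (1 <= u x + K * b)%R.
  move=> Ax; have : b%:E <= I x + (K * b * b)%:E.
    rewrite [X in _ + X]EFinM -indb -ge0_integralZl_EFin//.
    have s1 r : 0 <= (\1_(`]0%R, b]%classic) r)%:E * H x r.
      by rewrite mule_ge0 ?H0// lee_fin.
    have s2 r : 0 <= (K * b)%:E * (\1_(`]0%R, b]%classic) r : R)%:E.
      by rewrite -EFinM lee_fin mulr_ge0.
    have s3 : measurable_fun setT (fun r : R =>
        (K * b)%:E * (\1_(`]0%R, b]%classic) r : R)%:E).
      exact: measurable_funeM.
    have -> := esym (ge0_integralD leb measurableT (fun r _ => s1 r) (mindH x)
      (fun r _ => s2 r) s3).
    apply: ge0_le_integral.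
    - exact: measurableT.
    - by move=> r _; rewrite lee_fin.
    - exact: mind.
    - by apply: emeasurable_funD; [exact: mindH|exact: s3].
    - move=> r _; rewrite [X in _ + X]muleC -ge0_muleDr ?H0//.
      rewrite indicE; have [|_] := boolP (r \in `]0%R, b]%classic); last first.
        by rewrite mul0e.
      by rewrite inE/= in_itv/= => /andP[r0 rb]; rewrite mul1e; exact: HA.
  have := Ifin x; rewrite /u; case: (I x) => // i _.
  rewrite -EFinD lee_fin /= => bi.
  rewrite -(ler_pM2l bpos) mulr1 mulrDr mulrA divff ?gt_eqF// mul1r.
  by rewrite (mulrC b).
have muE : measurable_fun setT (fun x => (u x)%:E) by exact/measurable_EFinP.
have intuU : V%:E <= \int[m]_(x in U) (u x)%:E + (e / 4)%:E.
  have mAV : m A <= V%:E by rewrite -VE; apply: le_measure; rewrite ?inE.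
  rewrite -VE; apply: (le_trans UA).
  apply: (@le_trans _ _ (\int[m]_(x in A) ((u x)%:E + (K * b)%:E) + (e / 8)%:E)).
    rewrite leeD2r// -[leLHS]mul1e -integral_cst//.
    apply: ge0_le_integral => //.
    by apply: measurable_funTS; apply: emeasurable_funD.
  rewrite ge0_integralD//; last 2 first.
  - by move=> x _; rewrite lee_fin.
  - exact: measurable_funTS.
  rewrite integral_cst// -addeA leeD//.
    apply: ge0_subset_integral => //; first exact: measurable_funTS.
    by move=> x _; rewrite lee_fin.
  apply: (@le_trans _ _ ((K * b)%:E * V%:E + (e / 8)%:E)).
    by rewrite leeD2r// lee_wpmul2l ?lee_fin.
  rewrite -EFinM -EFinD lee_fin (_ : K * b * V = b * (V * K))%R; last by ring.
  exact: bVK4.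
have sq : \int[m]_x ((\1_U x - u x) ^+ 2)%:E + 2%:E * \int[m]_(x in U) (u x)%:E
    <= V%:E + V%:E.
  rewrite -[X in _ <= X + _]intuT -[X in _ <= _ + X]VE.
  exact: (indicator_sq_le m mU mu u0 u1).
have X0 : 0 <= \int[m]_(x in U) (u x)%:E.
  by apply: integral_ge0 => x _; rewrite lee_fin.
have Y0 : 0 <= \int[m]_x ((\1_U x - u x) ^+ 2)%:E.
  by apply: integral_ge0 => x _; rewrite lee_fin sqr_ge0.
move: sq intuU X0 Y0.
move: (\int[m]_(x in U) (u x)%:E) (\int[m]_x ((\1_U x - u x) ^+ 2)%:E).
case=> [X| |]//; last first.
  by case=> [Y| |]//; rewrite gt0_muley ?lte_fin// addeC.
case=> [Y| |]//; rewrite -EFinM -!EFinD !lee_fin lte_fin => *; lra.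
Qed.

End indicator_approximation.

(** * Density of potentials in $L^2$ *)

Section sqdist.
Local Open Scope ereal_scope.
Context d (T : measurableType d) (R : realType) (mu : {measure set T -> \bar R}).
Implicit Types f g h : T -> R.

(** The square of the $L^2$-distance. *)
Definition sqdist f g := \int[mu]_x ((f x - g x) ^+ 2)%:E.

Lemma measurable_sqdiff f g : measurable_fun setT f -> measurable_fun setT g ->
  measurable_fun setT (fun x => ((f x - g x) ^+ 2)%:E).
Proof.
by move=> mf mg; apply/measurable_EFinP; apply: measurable_funX; exact: measurable_funB.
Qed.

Lemma sqdist_triangle g f h : measurable_fun setT f -> measurable_fun setT g ->
  measurable_fun setT h -> sqdist f h <= 2%:E * sqdist f g + 2%:E * sqdist g h.
Proof.
move=> mf mg mh; rewrite /sqdist.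
have p0 (a b : T -> R) x : 0 <= ((a x - b x) ^+ 2)%:E by rewrite lee_fin sqr_ge0.
have q0 (a b : T -> R) x : 0 <= 2%:E * ((a x - b x) ^+ 2)%:E by rewrite mule_ge0.
have m1 := measurable_funeM 2%:E (measurable_sqdiff mf mg).
have m2 := measurable_funeM 2%:E (measurable_sqdiff mg mh).
rewrite -!ge0_integralZl_EFin//; [|exact: measurable_sqdiff..].
have <- := ge0_integralD mu measurableT (fun x _ => q0 f g x) m1 (fun x _ => q0 g h x) m2.
apply: ge0_le_integral => //.
- exact: measurable_sqdiff.
- exact: emeasurable_funD.
- move=> x _; rewrite -!EFinM -EFinD lee_fin.
  rewrite -subr_ge0 (_ : _ - _ = (f x - 2 * g x + h x) ^+ 2)%R ?sqr_ge0//; ring.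
Qed.

Lemma sqdistD f g f' g' : measurable_fun setT f -> measurable_fun setT g ->
  measurable_fun setT f' -> measurable_fun setT g' ->
  sqdist (fun x => f x + g x)%R (fun x => f' x + g' x)%R <=
  2%:E * sqdist f f' + 2%:E * sqdist g g'.
Proof.
move=> mf mg mf' mg'.
have E1 : sqdist (fun x => f x + g x)%R (fun x => f' x + g x)%R = sqdist f f'.
  by apply: eq_integral => x _; congr ((_ ^+ 2)%:E); ring.
have E2 : sqdist (fun x => f' x + g x)%R (fun x => f' x + g' x)%R = sqdist g g'.
  by apply: eq_integral => x _; congr ((_ ^+ 2)%:E); ring.
rewrite -E1 -E2; apply: sqdist_triangle; exact: measurable_funD.
Qed.

Lemma sqdistZ (c : R) f g : measurable_fun setT f -> measurable_fun setT g ->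
  sqdist (fun x => c * f x)%R (fun x => c * g x)%R = (c ^+ 2)%:E * sqdist f g.
Proof.
move=> mf mg; rewrite /sqdist -ge0_integralZl_EFin ?sqr_ge0//.
- by apply: eq_integral => x _; rewrite -EFinM; congr EFin; ring.
- by move=> x _; rewrite lee_fin sqr_ge0.
- exact: measurable_sqdiff.
Qed.

Lemma sqdist_ge0 f g : 0 <= sqdist f g.
Proof. by apply: integral_ge0 => x _; rewrite lee_fin sqr_ge0. Qed.

Lemma double_quarter_lt (a b : \bar R) (e : R) : 0 <= a -> 0 <= b ->
  a < (e / 4)%:E -> b < (e / 4)%:E -> 2%:E * a + 2%:E * b < e%:E.
Proof.
case: a => [a| |]//; case: b => [b| |]// _ _.
by rewrite -!EFinM -EFinD !lte_fin; lra.
Qed.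

End sqdist.

Section L2_density.
Context (R : realType) (n : nat) (beta : R).
Hypotheses (n3 : (3 <= n)%N) (b0 : 0 < beta) (b2 : beta < 2).
Local Notation rV := 'rV[R]_n.
Local Notation m := (lebesgue_rV R n).
Implicit Types (p q : {measure set rV -> \bar R}) (f g : rV -> R).

Let bn : beta < n%:R.
Proof. by apply: lt_le_trans b2 _; rewrite (ler_nat R 2) ltnW. Qed.

(** The potential as a real-valued function; it is the potential when $p$ is
tame, and $0$ stands for the value $+\infty$ in general. *)
Definition fpot p (x : rV) : R := fine (potential beta p x).

Lemma EFin_fpot p x : tame p -> (fpot p x)%:E = potential beta p x.
Proof. by move=> tp; rewrite fineK//; exact: potential_fin_num. Qed.

Lemma measurable_fpot p : tame p -> measurable_fun setT (fpot p).
Proof.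
move=> tp; apply/measurable_EFinP.
rewrite (_ : EFin \o _ = potential beta p); last first.
  by apply/funext => x; exact: EFin_fpot.
by apply: measurable_potential => //; exact: tame_radon.
Qed.

Lemma fpot_add p q x : tame p -> tame q ->
  fpot (measure_add p q) x = fpot p x + fpot q x.
Proof.
by move=> tp tq; rewrite /fpot potential_add// fineD//; exact: potential_fin_num.
Qed.

Lemma fpot_scale p (c : {nonneg R}) x : tame p ->
  fpot (mscale c p) x = c%:num * fpot p x.
Proof.
by move=> tp; rewrite /fpot potential_scale// fineM//; exact: potential_fin_num.
Qed.

Lemma approximableP f : approximable beta f <-> forall e : R, 0 < e ->
  exists p q, [/\ tame p, tame q &
    (sqdist m f (fun x => fpot p x - fpot q x)%R < e%:E)%E].
Proof. by []. Qed.

Lemma measurable_fpotB p q : tame p -> tame q ->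
  measurable_fun setT (fun x => fpot p x - fpot q x).
Proof. by move=> tp tq; apply: measurable_funB; exact: measurable_fpot. Qed.

Lemma approximable_add f g : measurable_fun setT f -> measurable_fun setT g ->
  approximable beta f -> approximable beta g ->
  approximable beta (fun x => f x + g x).
Proof.
move=> mf mg /approximableP af /approximableP ag; apply/approximableP => e e0.
have e4 : 0 < e / 4 by rewrite divr_gt0.
have [p [q [tp tq pq]]] := af _ e4; have [p' [q' [tp' tq' pq']]] := ag _ e4.
exists (measure_add p p'), (measure_add q q').
split; [exact: tame_add|exact: tame_add|].
apply: le_lt_trans (double_quarter_lt (sqdist_ge0 _ _ _) (sqdist_ge0 _ _ _) pq pq').
have mpq := measurable_fpotB tp tq; have mpq' := measurable_fpotB tp' tq'.
rewrite (_ : (fun x => _ - _) = fun x => (fpot p x - fpot q x) + (fpot p' x - fpot q' x)).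
  exact: sqdistD.
by apply/funext => x; rewrite !fpot_add//; ring.
Qed.

Lemma approximable_scale (c : R) f : measurable_fun setT f ->
  approximable beta f -> approximable beta (fun x => c * f x).
Proof.
move=> mf /approximableP af; apply/approximableP => e e0.
have c1 : 0 < c ^+ 2 + 1 by rewrite ltr_wpDl// sqr_ge0.
have e4 : 0 < e / (c ^+ 2 + 1) by rewrite divr_gt0.
have [p [q [tp tq pq]]] := af _ e4.
have cpq : (sqdist m (fun x => c * f x)%R (fun x => c * (fpot p x - fpot q x))%R < e%:E)%E.
  rewrite sqdistZ//; last exact: measurable_fpotB.
  have := sqdist_ge0 m f (fun x => fpot p x - fpot q x); move: pq.
  case: (sqdist _ _ _) => [s| |]//; rewrite -EFinM !lte_fin lee_fin ltr_pdivlMr//.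
  by move=> se s0; apply: le_lt_trans se; rewrite mulrC ler_wpM2l// lerDl.
have [c0|c0] := leP 0 c.
  exists (mscale (NngNum c0) p), (mscale (NngNum c0) q).
  split; [exact: tame_scale|exact: tame_scale|].
  rewrite (_ : (fun x => _ - _) = fun x => c * (fpot p x - fpot q x))//.
  by apply/funext => x; rewrite !fpot_scale//= mulrBr.
have c0' : 0 <= - c by rewrite oppr_ge0 ltW.
exists (mscale (NngNum c0') q), (mscale (NngNum c0') p).
split; [exact: tame_scale|exact: tame_scale|].
rewrite (_ : (fun x => _ - _) = fun x => c * (fpot p x - fpot q x))//.
by apply/funext => x; rewrite !fpot_scale//=; ring.
Qed.

Lemma approximable_limit f : measurable_fun setT f ->
  (forall e : R, 0 < e -> exists g, [/\ measurable_fun setT g, approximable beta g &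
    (sqdist m f g < e%:E)%E]) -> approximable beta f.
Proof.
move=> mf fg; apply/approximableP => e e0.
have e4 : 0 < e / 4 by rewrite divr_gt0.
have [g [mg /approximableP ag fge]] := fg _ e4.
have [p [q [tp tq pq]]] := ag _ e4.
exists p, q; split => //; apply: le_lt_trans (double_quarter_lt (sqdist_ge0 _ _ _) (sqdist_ge0 _ _ _) fge pq).
by apply: sqdist_triangle => //; exact: measurable_fpotB.
Qed.

(** The open ball of radius $k$ about $0$ for the sup norm. *)
Definition oball (k : nat) : set rV := ball (0 : rV) k%:R.

Lemma open_oball k : open (oball k). Proof. exact: ball_open. Qed.

Lemma measurable_oball k : measurable (oball k).
Proof. by apply: open_measurable_rV; exact: open_oball. Qed.

Lemma oball_sub k : oball k `<=` [set v : rV | `|v| <= k%:R].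
Proof. by move=> v; rewrite /oball -ball_normE /ball_/= sub0r normrN => /ltW. Qed.

Lemma radon_oball p k : radon p -> (p (oball k) < +oo)%E.
Proof.
move=> rp; apply: le_lt_trans (rp _ (@ball_compact R n k%:R)).
apply: le_measure; rewrite ?inE; [exact: measurable_oball|exact: measurable_ball_rV|].
exact: oball_sub.
Qed.

(** Indicators of bounded Borel sets: Dynkin's pi-lambda theorem for the
pi-system of open sets. *)
Lemma approximable_indic k (A : set rV) : measurable A ->
  approximable beta (\1_(A `&` oball k) : rV -> R).
Proof.
move=> mA; have mk := measurable_oball k.
have koo : (m (oball k) < +oo)%E by exact: radon_oball (@radon_lebesgue R n).
pose L : set (set rV) := [set A | measurable A /\
  approximable beta (\1_(A `&` oball k) : rV -> R)].
suff : <<s (@open rV) >> `<=` L by move=> /(_ _ mA) [].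
apply: lambda_system_subset.
- by move=> U V oU oV; exact: openI.
- split=> //.
  + split; first exact: measurableT.
    rewrite setTI; apply: approximable_open => //; exact: open_oball.
  + move=> U V VU [mU aU] [mV aV]; split; first exact: measurableD.
    have mUk : measurable (U `&` oball k) by exact: measurableI.
    have mVk : measurable (V `&` oball k) by exact: measurableI.
    rewrite (_ : \1__ = (fun x => \1_(U `&` oball k) x + (-1) * \1_(V `&` oball k) x)).
      apply: approximable_add => //.
      - by apply: measurable_funM => //; exact: measurable_indic.
      - by apply: approximable_scale => //; exact: measurable_indic.
    apply/funext => x; rewrite !indicE.
    have inI W : (x \in W `&` oball k) = (x \in W) && (x \in oball k).
      exact: in_setI.
    rewrite !inI (_ : (x \in U `\` V) = (x \in U) && (x \notin V)); last first.
      by rewrite setDE in_setI in_setC.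
    case: (x \in oball k); rewrite ?andbF ?andbT /= ?mulr0 ?addr0//.
    have := VU x; case: (boolP (x \in V)) => [/set_mem Vx /(_ Vx) Ux|_ _].
      by rewrite (mem_set Ux) /=; ring.
    by rewrite /= mulr0 addr0 andbT.
  + move=> F ndF LF.
    have mF i : measurable (F i) by case: (LF i).
    have mUF : measurable (\bigcup_i F i) by exact: bigcup_measurable.
    split; first exact: mUF.
    pose G i := F i `&` oball k; pose G' := (\bigcup_i F i) `&` oball k.
    have mG i : measurable (G i) by exact: measurableI.
    have mG' : measurable G' by exact: measurableI.
    have GG' i : G i `<=` G' by apply: setSI; exact: bigcup_sup.
    apply: approximable_limit; first exact: measurable_indic.
    move=> e e0.
    have G'oo : (m G' < +oo)%E.
      apply: le_lt_trans koo; apply: le_measure; rewrite ?inE//.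
      exact: subIsetr.
    have [i iP] : exists i, (m G' - e%:E < m (G i))%E.
      apply: contrapT => ni.
      have cv : (m (G i) @[i --> \oo] --> m G')%E.
        rewrite /G' setI_bigcupl; apply: nondecreasing_cvg_mu => //.
          by rewrite -setI_bigcupl.
        move=> a b ab; apply/subsetPset; apply: setSI.
        exact/subsetPset/ndF.
      have : (m G' <= m G' - e%:E)%E.
        rewrite -{1}(cvg_lim _ cv)//; apply: lime_le; first by apply/cvg_ex; exists (m G').
        apply: nearW => i; rewrite leNgt; apply/negP => Gi; apply: ni.
        by exists i.
      have G'fin : m G' \is a fin_num by rewrite ge0_fin_numE.
      by rewrite leNgt => /negP; apply; rewrite lteBlDr// lteDl ?lte_fin.
    exists (\1_(G i)); split; [exact: measurable_indic|by case: (LF i)|].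
    rewrite (_ : sqdist _ _ _ = m (G' `\` G i)).
      rewrite measureD// setIC (setIidl (GG' i)).
      have Gfin : m (G i) \is a fin_num.
        rewrite ge0_fin_numE//; apply: le_lt_trans G'oo.
        by apply: le_measure; rewrite ?inE//; exact: GG'.
      have G'fin : m G' \is a fin_num by rewrite ge0_fin_numE.
      by rewrite lteBlDr// addeC -lteBlDr.
    rewrite -[X in m X]setIT -(integral_indic m measurableT); last exact: measurableD.
    apply: eq_integral => x _; congr EFin; rewrite !indicE -/G'.
    rewrite (_ : (x \in G' `\` G i) = (x \in G') && (x \notin G i)); last first.
      by rewrite setDE; apply: (eq_trans (in_setI x G' (~` G i))); rewrite in_setC.
    have := GG' i x; case: (boolP (x \in G i)) => [/set_mem Gx /(_ Gx) G'x|_ _].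
      by rewrite (mem_set G'x) /= subrr expr0n.
    by rewrite /= subr0 andbT; case: (_ \in _); rewrite ?expr1n ?expr0n.
- move=> U oU; split; first exact: open_measurable_rV.
  apply: approximable_open => //; first by apply: openI => //; exact: open_oball.
  apply: le_lt_trans koo; apply: le_measure; rewrite ?inE//.
  by apply: measurableI => //; exact: open_measurable_rV.
- by [].
Qed.

End L2_density.

Section L2_closure.
Context (R : realType) (n : nat) (beta : R).
Hypotheses (n3 : (3 <= n)%N) (b0 : 0 < beta) (b2 : beta < 2).
Local Notation rV := 'rV[R]_n.
Local Notation m := (lebesgue_rV R n).
Implicit Types (p q : {measure set rV -> \bar R}) (f g : rV -> R).

Import HBNNSimple.

Lemma measurable_indic_oball k (A : set rV) : measurable A ->
  measurable_fun setT (\1_(A `&` @oball R n k) : rV -> R).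
Proof.
by move=> mA; apply: measurable_indic; apply: measurableI => //; exact: measurable_oball.
Qed.

Lemma approximable_sum (I : Type) (s : seq I) (F : I -> rV -> R) :
  (forall i, measurable_fun setT (F i)) ->
  (forall i, approximable beta (F i)) ->
  approximable beta (fun x => \sum_(i <- s) F i x).
Proof.
move=> mF aF; elim: s => [|i s ih].
  rewrite (_ : (fun _ => _) = (fun x => 0 * (\1_(set0 `&` @oball R n 0) x : R))).
    by apply: approximable_scale => //; [exact: measurable_indic_oball|exact: approximable_indic].
  by apply/funext => x; rewrite big_nil mul0r.
rewrite (_ : (fun _ => _) = (fun x => F i x + \sum_(i <- s) F i x)).
  by apply: approximable_add => //; exact: measurable_sum.
by apply/funext => x; rewrite big_cons.
Qed.

Lemma approximable_nnsfun k (h : {nnsfun rV >-> R}) :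
  approximable beta (fun x => h x * \1_(@oball R n k) x).
Proof.
have mh y : measurable (h @^-1` [set y]) by exact: measurable_funPTI.
rewrite (_ : (fun _ => _) = (fun x => \sum_(y <- finmap.enum_fset (fset_set (range h)))
    y * \1_(h @^-1` [set y] `&` @oball R n k) x)).
  apply: approximable_sum => y.
    by apply: measurable_funM => //; exact: measurable_indic_oball.
  by apply: approximable_scale => //; [exact: measurable_indic_oball|exact: approximable_indic].
apply/funext => x; rewrite fimfunE fsbig_finite//= mulr_suml.
by apply: eq_bigr => y _; rewrite indicI mulrA.
Qed.

(** Dominated convergence, for simple functions below $f$ cut off to large
balls. *)
Lemma approximable_ge0 f : measurable_fun setT f -> (forall x, 0 <= f x) ->
  (\int[m]_x (f x ^+ 2)%:E < +oo)%E -> approximable beta f.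
Proof.
move=> mf f0 foo.
have mfE : measurable_fun setT (EFin \o f) by exact/measurable_EFinP.
pose g_ := nnsfun_approx measurableT mfE.
have cvE x : (g_ k x)%:E @[k --> \oo] --> (f x)%:E.
  by apply: cvg_nnsfun_approx => // y _; rewrite /= lee_fin.
have gf k x : g_ k x <= f x.
  rewrite /g_ nnsfun_approxE -lee_fin; apply: (@le_approx _ _ _ setT (EFin \o f)) => //.
  by move=> y _; rewrite /= lee_fin.
pose h k x := g_ k x * \1_(@oball R n k) x.
have mh k : measurable_fun setT (h k).
  by apply: measurable_funM => //; apply: measurable_indic; exact: measurable_oball.
have hf k x : 0 <= h k x <= f x.
  rewrite /h indicE; case: (_ \in _); rewrite ?mulr1 ?mulr0 ?lexx ?f0//.
  by rewrite gf andbT.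
have cvh x : h k x @[k --> \oo] --> f x.
  have cg : g_ k x @[k --> \oo] --> f x by exact: (fine_cvg (cvE x)).
  apply: cvg_trans cg; apply: near_eq_cvg.
  exists (Num.trunc `|x|).+1 => // k /= xk.
  rewrite /h indicE mem_set ?mulr1// /oball -ball_normE /ball_/= sub0r normrN.
  by rewrite (lt_le_trans (truncnS_gt _))// ler_nat.
have cvsq x : (((f x - h k x) ^+ 2)%:E @[k --> \oo] --> 0)%E.
  apply: cvg_EFin; first exact: nearW.
  rewrite (_ : _ \o _ = (fun k => (f x - h k x) * (f x - h k x))); last first.
    by apply/funext => k; rewrite /= expr2.
  rewrite -[X in _ --> X](mulr0 (0 : R)).
  have c0 : f x - h k x @[k --> \oo] --> (0 : R).
    by rewrite -(subrr (f x)); apply: cvgB; [exact: cvg_cst|exact: cvh].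
  exact: cvgM.
apply: approximable_limit => // e e0.
have mf2 : measurable_fun setT (fun x => (f x ^+ 2)%:E).
  by apply/measurable_EFinP; exact: measurable_funX.
have intf2 : m.-integrable setT (fun x => (f x ^+ 2)%:E).
  apply/integrableP; split=> //.
  by under eq_integral do rewrite gee0_abs ?lee_fin ?sqr_ge0//.
have dom x : setT x -> forall k, setT x ->
    (`|((f x - h k x) ^+ 2)%:E| <= (f x ^+ 2)%:E)%E.
  move=> _ k _; rewrite gee0_abs ?lee_fin ?sqr_ge0//.
  have /andP[h0 hfx] := hf k x.
  by rewrite lerXn2r ?nnegrE ?subr_ge0// gerBl.
have [_ _ cv0] := @dominated_convergence _ _ _ m setT measurableT
  (fun k x => ((f x - h k x) ^+ 2)%:E) (cst 0%E) (fun x => (f x ^+ 2)%:E)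
  (fun k => measurable_sqdiff mf (mh k)) (@measurable_cst _ _ _ _ _ _)
  (aeW m (fun x _ => cvsq x)) intf2 (aeW m (fun x k => dom x I k)).
rewrite integral0 in cv0.
have [k ke] : exists k, (sqdist m f (h k) < e%:E)%E.
  apply: contrapT => nk.
  have : (e%:E <= 0 :> \bar R)%E.
    rewrite -(cvg_lim _ cv0)//; apply: lime_ge; first by apply/cvg_ex; exists 0%E.
    by apply: nearW => k; rewrite leNgt; apply/negP => ke; apply: nk; exists k.
  by rewrite lee_fin leNgt e0.
by exists (h k); split => //; exact: approximable_nnsfun.
Qed.

(** The potentials of differences of tame measures are dense in $L^2$. *)
Lemma approximable_L2 f : measurable_fun setT f ->
  (\int[m]_x (f x ^+ 2)%:E < +oo)%E -> approximable beta f.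
Proof.
move=> mf foo.
have part (c : R) : c ^+ 2 = 1 -> approximable beta (fun x => Num.max (c * f x) 0).
  move=> c1; have mc : measurable_fun setT (fun x => Num.max (c * f x) 0).
    by apply: measurable_maxr => //; exact: measurable_funM.
  apply: approximable_ge0 => //.
    by move=> x; rewrite le_max lexx orbT.
  apply: le_lt_trans foo; apply: ge0_le_integral => //.
  - by move=> x _; rewrite lee_fin sqr_ge0.
  - by apply/measurable_EFinP; exact: measurable_funX.
  - by apply/measurable_EFinP; exact: measurable_funX.
  - move=> x _; rewrite lee_fin; case: (leP (c * f x) 0) => _.
      by rewrite expr0n sqr_ge0.
    by rewrite exprMn c1 mul1r.
have mpart (c : R) : measurable_fun setT (fun x => Num.max (c * f x) 0).
  by apply: measurable_maxr => //; exact: measurable_funM.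
have -> : f = (fun x => Num.max (1 * f x) 0 + (-1) * Num.max ((-1) * f x) 0).
  apply/funext => x; rewrite mul1r !mulN1r.
  by case: (leP (f x) 0) => fx; case: (leP (- f x) 0) => fx'; lra.
have a1 := part 1 (expr1n _ _).
have a2 : approximable beta (fun x => (-1) * Num.max ((-1) * f x) 0).
  by apply: approximable_scale => //; apply: part; rewrite sqrrN expr1n.
by apply: approximable_add => //; apply: measurable_funM.
Qed.

End L2_closure.

(** * Finiteness of potentials almost everywhere *)

Section finiteness.
Context (R : realType) (n : nat).
Hypothesis n0 : (0 < n)%N.
Local Notation rV := 'rV[R]_n.
Local Notation m := (lebesgue_rV R n).
Implicit Types (p q : {measure set rV -> \bar R}).

Lemma norm_le_enorm (x : rV) : `|x| <= enorm x.
Proof.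
rewrite -(ler_pXn2r (n := 2)) ?nnegrE ?sqrtr_ge0//.
by rewrite sqr_sqrtr ?nsq_ge0//; exact: nsq_ge_norm.
Qed.

Lemma enorm_le_norm (x : rV) : enorm x <= n%:R * `|x|.
Proof.
rewrite -(ler_pXn2r (n := 2)) ?nnegrE ?sqrtr_ge0 ?mulr_ge0//.
rewrite sqr_sqrtr ?nsq_ge0// exprMn.
apply: (@le_trans _ _ (\sum_(i < n) `|x| ^+ 2)).
  apply: ler_sum => i _; rewrite -[leLHS]real_normK ?num_real//.
  by rewrite lerXn2r ?nnegrE// coord_le_norm.
rewrite sumr_const card_ord -[leLHS]mulr_natl ler_wpM2r ?exprn_ge0//.
by rewrite expr2 ler_peMl// ler1n.
Qed.

Lemma riesz_kernel_sym (beta : R) (x y : rV) :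
  riesz_kernel beta x y = riesz_kernel beta y x.
Proof.
have E (v : rV) : enorm v = Num.sqrt (nsq v) by [].
by rewrite /riesz_kernel (eq_sym y x) !E -(nsqN (x - y)) opprB.
Qed.

Lemma powR_le_neg (e a b : R) : e <= 0 -> 0 < a -> a <= b -> b `^ e <= a `^ e.
Proof.
move=> e0 a0 ab; have b0 := lt_le_trans a0 ab.
rewrite -[e]opprK powRN [leRHS]powRN lef_pV2 ?posrE ?powR_gt0//.
by rewrite ge0_ler_powR ?nnegrE ?oppr_ge0// ltW.
Qed.

Lemma enorm_gt0 (x : rV) : x != 0 -> 0 < enorm x.
Proof. by move=> x0; rewrite sqrtr_gt0 lt0r nsq_ge0 nsq_eq0 x0. Qed.

(** The potential of order $\beta \le \alpha$ of the restriction of Lebesgue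
measure to a ball is dominated by a Riesz kernel of order $\alpha$. *)
Lemma potential_ball_le (alpha beta : R) (x0 : rV) k q : 0 < beta ->
  beta <= alpha -> alpha < n%:R -> tame q ->
  (forall A, measurable A -> q A = m (@oball R n k `&` A)) ->
  exists2 C : R, 0 <= C & forall y : rV,
    (potential beta q y <= C%:E * riesz_kernel alpha x0 y)%E.
Proof.
move=> b0 ba an tq qE.
have bn : beta < n%:R by exact: le_lt_trans an.
have nR : 0 < n%:R :> R by rewrite ltr0n.
have [B B0 BE] := potential_bounded b0 bn tq.
have [Q QE] : exists Q, (q setT = Q%:E)%E.
  by exists (fine (q setT)); rewrite fineK// ge0_fin_numE//; case: tq.
have Q0 : 0 <= Q by rewrite -lee_fin -QE.
pose S : R := `|x0| + k%:R.
have S0 : 0 <= S by rewrite addr_ge0.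
pose rho : R := 1 + 2 * n%:R * S.
have rho1 : 1 <= rho by rewrite lerDl !mulr_ge0.
have rho0 : 0 < rho by exact: lt_le_trans rho1.
pose C1 := B * rho `^ (n%:R - alpha).
pose C2 := (2 * n%:R)^-1 `^ (beta - n%:R) * Q.
have C10 : 0 <= C1 by rewrite mulr_ge0 ?powR_ge0.
have C20 : 0 <= C2 by rewrite mulr_ge0 ?powR_ge0.
exists (C1 + C2 + 1); first by rewrite !addr_ge0.
move=> y; have [->|xy] := eqVneq x0 y.
  by rewrite /riesz_kernel eqxx gt0_muley ?leey// lte_fin ltr_wpDl// addr_ge0.
rewrite [riesz_kernel alpha x0 y]/riesz_kernel (negbTE xy) -EFinM.
set D := enorm (x0 - y).
have D0 : 0 < D by rewrite enorm_gt0// subr_eq0.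
(* for y near x0 the potential is bounded and the kernel is bounded below; for y
   far from x0, the distance from y to the ball is comparable to D *)
have [Drho|rhoD] := leP D rho.
  apply: (le_trans (BE y)); rewrite lee_fin.
  apply: (@le_trans _ _ (C1 * D `^ (alpha - n%:R))); last first.
    by rewrite ler_wpM2r ?powR_ge0// -addrA lerDl addr_ge0.
  rewrite /C1 -mulrA ler_peMr// -(opprB alpha) powRN.
  rewrite mulrC ler_pdivlMr ?powR_gt0// mul1r.
  by apply: powR_le_neg => //; rewrite subr_le0 ltW.
have D1 : 1 <= D by apply: (le_trans rho1); exact: ltW.
apply: (@le_trans _ _ (C2 * D `^ (alpha - n%:R))%:E); last first.
  by rewrite lee_fin ler_wpM2r ?powR_ge0// addrAC lerDr addr_ge0.
have far z : @oball R n k z ->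
    (riesz_kernel beta y z <= ((D / (2 * n%:R)) `^ (beta - n%:R))%:E)%E.
  move=> kz; have zk : `|z| <= k%:R by exact: oball_sub kz.
  have yz : D / (2 * n%:R) <= `|y - z|.
    have h1 : D / n%:R <= `|x0 - y|.
      by rewrite ler_pdivrMr// mulrC; exact: enorm_le_norm.
    have h2 : `|x0 - y| <= `|x0 - z| + `|y - z|.
      by rewrite (distrC y); apply: ler_distD.
    have h3 : `|x0 - z| <= S by apply: (le_trans (ler_normB _ _)); rewrite lerD2l.
    have h4 : S <= D / (2 * n%:R).
      by rewrite ler_pdivlMr ?mulr_gt0// mulrC (le_trans _ (ltW rhoD))// /rho lerDr.
    have h5 : D / n%:R = D / (2 * n%:R) + D / (2 * n%:R) by field; rewrite gt_eqF.
    lra.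
  have Dn0 : 0 < D / (2 * n%:R) by rewrite divr_gt0// mulr_gt0.
  have yzn : y != z.
    by apply: contraTN yz => /eqP ->; rewrite subrr normr0 -ltNge.
  rewrite /riesz_kernel (negbTE yzn) lee_fin; apply: powR_le_neg => //.
    by rewrite subr_le0 ltW.
  by apply: (le_trans yz); exact: norm_le_enorm.
have mk := @measurable_oball R n k.
apply: (@le_trans _ _ (((D / (2 * n%:R)) `^ (beta - n%:R))%:E * q setT)%E).
  rewrite -integral_cst//.
  have mker : measurable_fun setT (riesz_kernel beta y).
    exact: (measurableT_comp (measurable_riesz_kernel b0 bn) (measurable_pair1 y)).
  apply: ae_ge0_le_integral => //.
  - by move=> z _; exact: riesz_kernel_ge0.
  - by move=> z _; rewrite lee_fin powR_ge0.
  - exists (~` @oball R n k); split.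
    + exact: measurableC.
    + by rewrite [LHS]qE ?setICr//; exact: measurableC.
    + by move=> z /= nz kz; apply: nz => _; exact: far.
rewrite QE -EFinM lee_fin /C2 powRM ?invr_ge0 ?mulr_ge0 ?(ltW D0) ?(ltW nR)//.
rewrite (mulrC (D `^ _)) mulrAC ler_wpM2l ?mulr_ge0 ?powR_ge0//.
by apply: ler_powR => //; rewrite lerB// ltW.
Qed.

(** The integral of the potential over a ball is the integral against $p$ of the
potential of the ball, hence it is finite. *)
Lemma potential_finite_ae (alpha beta : R) p (x0 : rV) : 0 < beta ->
  beta <= alpha -> alpha < n%:R -> radon p ->
  (potential alpha p x0 < +oo)%E ->
  {ae m, forall x, potential beta p x \is a fin_num}.
Proof.
move=> b0 ba an rp poo.
have bn : beta < n%:R by exact: le_lt_trans an.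
have a0 : 0 < alpha by exact: lt_le_trans ba.
have mp : measurable_fun setT (potential beta p) by exact: measurable_potential.
suff H k : {ae m, forall x, @oball R n k x -> potential beta p x \is a fin_num}.
  apply: filterS (ae_foralln H) => x Hx.
  apply: (Hx (Num.trunc `|x|).+1); rewrite /oball -ball_normE /ball_/= sub0r normrN.
  exact: truncnS_gt.
have mk := @measurable_oball R n k.
have [q [qE qint]] := restricted_measure m mk.
have tq : tame q.
  split; first by rewrite qE// setIT; exact: radon_oball (@radon_lebesgue R n).
  exists 1 => // A mA; rewrite qE// mul1e; apply: le_measure; rewrite ?inE//.
  exact: measurableI.
have rq := tame_radon tq.
have [C C0 CE] := potential_ball_le x0 b0 ba an tq qE.
apply: integrable_ae => //; apply/integrableP; split; first exact: measurable_funTS.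
under eq_integral do rewrite gee0_abs ?potential_ge0//.
rewrite -qint//; last by move=> x; exact: potential_ge0.
rewrite (tonelli_radon (f := fun x y => riesz_kernel beta x y) rq rp); last 2 first.
- exact: measurable_riesz_kernel.
- exact: riesz_kernel_ge0.
apply: (@le_lt_trans _ _ (C%:E * potential alpha p x0)%E); last first.
  by apply: lte_mul_pinfty; rewrite ?lee_fin.
have mker : measurable_fun setT (riesz_kernel alpha x0).
  exact: (measurableT_comp (measurable_riesz_kernel a0 an) (measurable_pair1 x0)).
rewrite -ge0_integralZl_EFin//; last by move=> y _; exact: riesz_kernel_ge0.
apply: ge0_le_integral.
- exact: measurableT.
- by move=> y _; apply: integral_ge0 => x _; exact: riesz_kernel_ge0.
- apply: (measurable_integral_radon (f := fun y x => riesz_kernel beta x y) rq).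
  + by under eq_fun do rewrite riesz_kernel_sym; exact: measurable_riesz_kernel.
  + by move=> x y; exact: riesz_kernel_ge0.
- exact: measurable_funeM.
- move=> y _; under eq_integral do rewrite riesz_kernel_sym.
  exact: CE.
Qed.

End finiteness.

(** * Signed measures with tame parts *)

Section singular.
Local Open Scope ereal_scope.
Context d (T : measurableType d) (R : realType).
Implicit Types p q s t : {measure set T -> \bar R}.

(** Minimality of the Jordan decomposition. *)
Lemma singular_le s t p q : mutually_singular s t ->
  (forall A, measurable A -> s A + q A = t A + p A) ->
  (forall A, measurable A -> s A <= p A) /\
  (forall A, measurable A -> t A <= q A).
Proof.
move=> [A0 [mA0 sA0 tA0]] st.
have mA0C : measurable (~` A0) by exact: measurableC.
have null (r : {measure set T -> \bar R}) B C : measurable B -> measurable C ->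
    r C = 0 -> r (B `&` C) = 0.
  move=> mB mC rC; apply/eqP; rewrite eq_le measure_ge0 andbT -rC.
  by apply: le_measure; rewrite ?inE//; exact: measurableI.
have le r B C : measurable B -> measurable C -> (r : {measure set T -> \bar R}) (B `&` C) <= r B.
  by move=> mB mC; apply: le_measure; rewrite ?inE//; exact: measurableI.
have splitm (r : {measure set T -> \bar R}) B : measurable B ->
    r B = r (B `&` A0) + r (B `&` ~` A0).
  move=> mB; rewrite -measureU//; [|exact: measurableI..|].
    by rewrite -setIUr setUv setIT.
  by rewrite setIACA setICr setI0.
split=> A mA.
- rewrite (splitm s)// (null s A A0)// add0e.
  apply: (le_trans _ (le p A (~` A0) mA mA0C)).
  have := st (A `&` ~` A0) (measurableI _ _ mA mA0C).
  by rewrite (null t A (~` A0))// add0e => <-; rewrite leeDl.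
- rewrite (splitm t)// (null t A (~` A0))// adde0.
  apply: (le_trans _ (le q A A0 mA mA0)).
  have := st (A `&` A0) (measurableI _ _ mA mA0).
  by rewrite (null s A A0)// add0e => ->; rewrite leeDl.
Qed.

End singular.

Section signed_measures.
Context (R : realType) (n : nat).
Local Notation rV := 'rV[R]_n.
Local Notation m := (lebesgue_rV R n).
Local Open Scope ereal_scope.
Implicit Types (p q s t : {measure set rV -> \bar R}) (mu nu : signed_radon R n).

Lemma tame_le p q : tame q -> (forall A, measurable A -> p A <= q A) -> tame p.
Proof.
move=> [qT [M M0 qM]] pq; split; first exact: le_lt_trans (pq _ measurableT) _.
by exists M => // A mA; exact: le_trans (pq _ mA) (qM _ mA).
Qed.

(** The difference $\nu = p - q$; its parts are tame by the minimality of the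
Jordan decomposition. *)
Lemma exists_tame_signed p q : tame p -> tame q -> exists nu,
  [/\ tame (mu_pos nu), tame (mu_neg nu) & forall A, measurable A ->
    mu_pos nu A + q A = mu_neg nu A + p A].
Proof.
move=> tp tq; have [nu nuE] := hahn_jordan (tame_radon tp) (tame_radon tq).
have [le1 le2] := singular_le (mu_singular nu) nuE.
by exists nu; split => //; [exact: tame_le le1|exact: tame_le le2].
Qed.

Lemma ge0_integral_balance s t p q (f : rV -> \bar R) :
  (forall A, measurable A -> s A + q A = t A + p A) ->
  measurable_fun setT f -> (forall x, 0 <= f x) ->
  \int[s]_x f x + \int[q]_x f x = \int[t]_x f x + \int[p]_x f x.
Proof.
move=> st mf f0; rewrite -!ge0_integral_measure_add//.
apply: eq_measure_integral => A mA _.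
by rewrite [LHS]measure_addE [RHS]measure_addE st.
Qed.

Lemma potential_balance beta s t p q x : (0 < beta)%R -> (beta < n%:R)%R ->
  (forall A, measurable A -> s A + q A = t A + p A) ->
  potential beta s x + potential beta q x =
  potential beta t x + potential beta p x.
Proof.
move=> b0 bn st; apply: ge0_integral_balance => //; last exact: riesz_kernel_ge0.
exact: (measurableT_comp (measurable_riesz_kernel b0 bn) (measurable_pair1 x)).
Qed.

Lemma tame_mutual_energy alpha p q : (0 < alpha)%R -> (alpha < n%:R)%R ->
  tame p -> tame q -> mutual_energy alpha p q < +oo.
Proof.
move=> a0 an tp tq; have [B B0 BE] := potential_bounded a0 an tq.
apply: (@le_lt_trans _ _ (B%:E * p setT)); last first.
  by apply: lte_mul_pinfty; rewrite ?lee_fin//; case: tp.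
rewrite -integral_cst//; apply: ge0_le_integral.
- exact: measurableT.
- by move=> x _; exact: potential_ge0.
- by apply: measurable_potential => //; exact: tame_radon.
- exact: measurable_cst.
- by move=> x _; exact: BE.
Qed.

Lemma tame_bounded_energy alpha nu : (0 < alpha)%R -> (alpha < n%:R)%R ->
  tame (mu_pos nu) -> tame (mu_neg nu) -> bounded_energy_space n alpha nu.
Proof.
move=> a0 an tp tq; have tabs := tame_add tp tq.
split; last by case: tabs.
split; [|exact: tame_mutual_energy..].
exists 0%R; have [B B0 BE] := potential_bounded a0 an tabs.
by apply: le_lt_trans (BE 0%R) _; exact: ltry.
Qed.

Lemma signed_potential_tame beta nu x : (0 < beta)%R -> (beta < n%:R)%R ->
  tame (mu_pos nu) -> tame (mu_neg nu) ->
  signed_potential beta nu x = (fpot beta (mu_pos nu) x - fpot beta (mu_neg nu) x)%:E.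
Proof.
move=> b0 bn tp tq; rewrite /signed_potential EFinB.
by rewrite /fpot !fineK//; exact: potential_fin_num.
Qed.

Lemma tame_weak_energy alpha nu : (3 <= n)%N -> (0 < alpha)%R -> (alpha <= 2)%R ->
  tame (mu_pos nu) -> tame (mu_neg nu) -> weak_energy_space n alpha nu.
Proof.
move=> n3 a0 a2 tp tq.
have n3R : (3 <= n%:R :> R)%R by rewrite (ler_nat R 3).
have an : (alpha < n%:R)%R by lra.
have b0 : (0 < alpha / 2)%R by lra.
have b2 : (alpha / 2 < 2)%R by lra.
have bn : (alpha / 2 < n%:R)%R by lra.
split; first by have [[]] := tame_bounded_energy a0 an tp tq.
have mf := measurable_fpot n3 b0 b2 tp; have mg := measurable_fpot n3 b0 b2 tq.
rewrite /weak_energy.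
have -> : \int[m]_x (signed_potential (alpha / 2) nu x) ^+ 2 =
    sqdist m (fpot (alpha / 2) (mu_pos nu)) (fpot (alpha / 2) (mu_neg nu)).
  by apply: eq_integral => x _; rewrite signed_potential_tame.
have m0 : measurable_fun setT (fun _ : rV => 0%R : R) by exact: measurable_cst.
have tri := sqdist_triangle m mf m0 mg.
apply: (le_lt_trans tri).
have fin p : tame p -> \int[m]_x ((fpot (alpha / 2) p x) ^+ 2)%:E < +oo.
  move=> tp'; have b2n : (2 * (alpha / 2) < n%:R)%R by lra.
  apply: le_lt_trans (potential_square_integrable b0 b2n tp').
  rewrite (eq_integral (fun x => (potential (alpha / 2) p x) ^+ 2))// => x _.
  by rewrite -(EFin_fpot n3)// EFin_expe.
have E1 : sqdist m (fpot (alpha / 2) (mu_pos nu)) (fun _ => 0%R) < +oo.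
  apply: le_lt_trans (fin _ tp); rewrite /sqdist.
  by under eq_integral do rewrite subr0.
have E2 : sqdist m (fun _ => 0%R) (fpot (alpha / 2) (mu_neg nu)) < +oo.
  apply: le_lt_trans (fin _ tq); rewrite /sqdist.
  by under eq_integral do rewrite sub0r sqrrN.
by apply: lte_add_pinfty; apply: lte_mul_pinfty; rewrite ?lee_fin.
Qed.

End signed_measures.

(** * Density in the weak energy norm *)

Section norm_density.
Context (R : realType) (n : nat).
Local Notation rV := 'rV[R]_n.
Local Notation m := (lebesgue_rV R n).
Local Open Scope ereal_scope.
Implicit Types (p q s t : {measure set rV -> \bar R}) (mu nu : signed_radon R n).

Lemma potential_le beta p q x : (0 < beta)%R -> (beta < n%:R)%R ->
  (forall A, measurable A -> p A <= q A) -> potential beta p x <= potential beta q x.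
Proof.
move=> b0 bn pq; apply: (@ge0_le_measure_integral _ _ _ p q) => //.
  exact: riesz_kernel_ge0.
exact: (measurableT_comp (measurable_riesz_kernel b0 bn) (measurable_pair1 x)).
Qed.

Lemma measurable_signed_potential beta mu : (0 < beta)%R -> (beta < n%:R)%R ->
  measurable_fun setT (signed_potential beta mu).
Proof.
move=> b0 bn; apply: emeasurable_funB; apply: measurable_potential => //.
  exact: mu_pos_radon.
exact: mu_neg_radon.
Qed.

(** The potential of the signed measure $\nu - \mu$, where all the potentials
involved are finite. *)
Lemma signed_potential_sub beta mu nu p q x : (0 < beta)%R -> (beta < n%:R)%R ->
  tame p -> tame q -> tame (mu_pos nu) -> tame (mu_neg nu) ->
  (forall A, measurable A -> mu_pos nu A + q A = mu_neg nu A + p A) ->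
  potential beta (abs_measure mu) x \is a fin_num ->
  signed_potential beta (signed_radon_sub nu mu) x =
  (fpot beta p x - fpot beta q x - fine (signed_potential beta mu x))%:E.
Proof.
move=> b0 bn tp tq tP tN nuE; rewrite potential_add// => fin.
have subE := @signed_radon_subE R n nu mu.
pose N := measure_add (mu_neg nu) (mu_pos mu).
pose P := measure_add (mu_pos nu) (mu_neg mu).
have subE' A : measurable A -> mu_pos (signed_radon_sub nu mu) A + N A =
    mu_neg (signed_radon_sub nu mu) A + P A.
  by move=> mA; rewrite [N A]measure_addE [P A]measure_addE subE.
have [le1 le2] := singular_le (mu_singular (signed_radon_sub nu mu)) subE'.
have b1 := potential_le x b0 bn le1; have b3 := potential_le x b0 bn le2.
have e1 := potential_balance x b0 bn subE'; have e2 := potential_balance x b0 bn nuE.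
move: b1 b3 e1 e2; rewrite !potential_add//.
rewrite /signed_potential /fpot.
have s0 := potential_ge0 beta (mu_pos (signed_radon_sub nu mu)) x.
have t0 := potential_ge0 beta (mu_neg (signed_radon_sub nu mu)) x.
have := potential_fin_num x b0 bn tp; have := potential_fin_num x b0 bn tq.
have := potential_fin_num x b0 bn tP; have := potential_fin_num x b0 bn tN.
move: fin s0 t0.
case: (potential beta (mu_pos mu) x) => [mp| |]//;
  case: (potential beta (mu_neg mu) x) => [mn| |]// _.
case: (potential beta (mu_pos (signed_radon_sub nu mu)) x) => [s| |]// _;
case: (potential beta (mu_neg (signed_radon_sub nu mu)) x) => [t| |]// _;
case: (potential beta (mu_neg nu) x) => [b| |]// _;
case: (potential beta (mu_pos nu) x) => [a| |]// _;
case: (potential beta q x) => [q'| |]// _;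
case: (potential beta p x) => [p'| |]// _ _ _ [] st [] ab.
by rewrite -EFinB/=; congr EFin; lra.
Qed.

Lemma weak_norm_lt alpha nu (e : R) : (0 < e)%R ->
  weak_energy alpha nu < (e ^+ 2)%:E -> weak_norm alpha nu < e%:E.
Proof.
move=> e0 h; rewrite ltNge; apply/negP; rewrite /weak_norm => le_e.
move: h; rewrite ltNge => /negP; apply.
have -> : (e ^+ 2)%:E = (e%:E) ^+ 2 :> \bar R by rewrite expe2 expr2 EFinM.
rewrite -lee_sqrt ?sqrte_sqr; last first.
  by apply: integral_ge0 => x _; exact: sqre_ge0.
by rewrite gee0_abs// lee_fin ltW.
Qed.

(** Approximate the potential of $\mu$ in $L^2$ by a difference of potentials of
tame measures. *)
Lemma weak_norm_density alpha mu (e : R) : (3 <= n)%N -> (0 < alpha)%R ->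
  (alpha <= 2)%R -> weak_energy_space n alpha mu -> (0 < e)%R ->
  exists nu, [/\ tame (mu_pos nu), tame (mu_neg nu) &
    weak_norm alpha (signed_radon_sub nu mu) < e%:E].
Proof.
move=> n3 a0 a2 [[x0 ax0] muoo] e0.
have n3R : (3 <= n%:R :> R)%R by rewrite (ler_nat R 3).
have an : (alpha < n%:R)%R by lra.
have b0 : (0 < alpha / 2)%R by lra.
have b2 : (alpha / 2 < 2)%R by lra.
have bn : (alpha / 2 < n%:R)%R by lra.
have ba : (alpha / 2 <= alpha)%R by lra.
have n0 : (0 < n)%N by exact: leq_trans n3.
have rabs : radon (abs_measure mu).
  by apply: radon_add; [exact: mu_pos_radon|exact: mu_neg_radon].
have finae := potential_finite_ae n0 b0 ba an rabs ax0.
pose f x : R := fine (signed_potential (alpha / 2) mu x).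
have mS := measurable_signed_potential mu b0 bn.
have mf : measurable_fun setT f by exact: (measurableT_comp _ mS).
have foo : \int[m]_x (f x ^+ 2)%:E < +oo.
  apply: le_lt_trans muoo; apply: ge0_le_integral.
  - exact: measurableT.
  - by move=> x _; rewrite lee_fin sqr_ge0.
  - by apply/measurable_EFinP; exact: measurable_funX.
  - by under eq_fun do rewrite expe2; apply: emeasurable_funM.
  - move=> x _; rewrite /f; case: (signed_potential _ _ _) => [r| |] //=.
    + by rewrite mulyy leey.
    + by rewrite mulNyNy leey.
have e20 : (0 < e ^+ 2)%R by rewrite exprn_gt0.
have [p [q [tp tq pqf]]] := approximable_L2 n3 b0 b2 mf foo e20.
have [nu [tP tN nuE]] := exists_tame_signed tp tq.
exists nu; split => //; apply: weak_norm_lt => //.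
apply: le_lt_trans pqf; rewrite /weak_energy.
have mS' := measurable_signed_potential (signed_radon_sub nu mu) b0 bn.
apply: ae_ge0_le_integral.
- exact: measurableT.
- move=> x _; exact: sqre_ge0.
- by under eq_fun do rewrite expe2; apply: emeasurable_funM.
- by move=> x _; rewrite lee_fin sqr_ge0.
- apply: measurable_sqdiff => //; exact: measurable_fpotB.
- apply: filterS finae => x fx _.
  rewrite (signed_potential_sub b0 bn tp tq tP tN nuE fx).
  rewrite expe2 -EFinM lee_fin le_eqVlt /fpot /f; apply/orP; left.
  by apply/eqP; ring.
Qed.

End norm_density.

(** * Density in the vague topology *)

Section heat_regularization.
Context (R : realType) (n : nat).
Local Notation rV := 'rV[R]_n.
Local Notation m := (lebesgue_rV R n).
Local Open Scope ereal_scope.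
Implicit Types (p q : {measure set rV -> \bar R}).

Lemma continuous_measurable_rV (h : rV -> R) : continuous h -> measurable_fun setT h.
Proof.
move=> ch; apply: (measurability _ (RGenOInfty.measurableE R)) => //.
move=> _ [_ [a ->] <-]; rewrite setTI; apply: open_measurable_rV.
by apply: open_comp; [move=> v _; exact: ch|exact: interval_open].
Qed.

Section average.
Variables (h : rV -> R) (M : R).
Hypotheses (ch : continuous h) (h0 : forall x, (0 <= h x)%R)
  (hM : forall x, (h x <= M)%R).

Let mh : measurable_fun setT h. Proof. exact: continuous_measurable_rV. Qed.
Let M0 : (0 <= M)%R. Proof. exact: le_trans (h0 0%R) (hM 0%R). Qed.

(** The function $P_t h$. *)
Definition heat_average (t : R) (y : rV) := \int[m]_x (h x * heat t (y - x))%:E.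

Let mhH t y : measurable_fun setT (fun x => (h x * heat t (y - x))%:E).
Proof.
apply/measurable_EFinP; apply: measurable_funM => //.
by apply/measurable_EFinP; exact: measurable_heatB.
Qed.

Lemma heat_average_ge0 t y : 0 <= heat_average t y.
Proof. by apply: integral_ge0 => x _; rewrite lee_fin mulr_ge0// heat_ge0. Qed.

Lemma heat_average_le t y : (0 < t)%R -> heat_average t y <= M%:E.
Proof.
move=> t0; rewrite -[leRHS]mule1 -(integral_heat y t0).
rewrite -ge0_integralZl_EFin//; last 2 first.
- by move=> x _; rewrite lee_fin heat_ge0.
- exact: measurable_heatB.
apply: ge0_le_integral.
- exact: measurableT.
- by move=> x _; rewrite lee_fin mulr_ge0// heat_ge0.
- exact: mhH.
- by apply: measurable_funeM; exact: measurable_heatB.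
- by move=> x _; rewrite -EFinM lee_fin ler_wpM2r// heat_ge0.
Qed.

(** The heat average at $y$ differs from $h(y)$ by at most the oscillation $e$ of $h$
on a ball about $y$, plus $M$ times the heat outside this ball. *)
Lemma heat_average_near t y d e : (0 < t)%R -> (0 < d)%R -> (0 < e)%R ->
  (forall x, (`|y - x| < d)%R -> (`|h y - h x| <= e)%R) ->
  heat_average t y <= (h y + e + M * (heat_tail_cst n d * t))%:E /\
  (h y)%:E <= heat_average t y + (e + M * (heat_tail_cst n d * t))%:E.
Proof.
move=> t0 d0 e0 hd.
pose D : set rV := [set x | (d <= `|y - x|)%R].
have mD : measurable D.
  apply: closed_measurable_rV.
  apply: (@preimage_closed _ _ (fun x : rV => `|y - x|%R) [set r | (d <= r)%R]).
    move=> x _; apply: continuous_comp; last exact: norm_continuous.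
    by apply: continuousB; [exact: cst_continuous|exact: id].
  exact: closed_ge.
pose H x := heat t (y - x).
have mH : measurable_fun setT (fun x => (H x)%:E) by exact: measurable_heatB.
have H0 x : (0 <= H x)%R by exact: heat_ge0.
have mHD : measurable_fun setT (fun x => (M * (H x * \1_D x))%:E).
  apply/measurable_EFinP; apply: measurable_funM => //.
  by apply: measurable_funM; [exact/measurable_EFinP|exact: measurable_indic].
have HI0 x : (0 <= H x * \1_D x)%R by exact: mulr_ge0.
have HD0 x : (0 <= M * (H x * \1_D x))%R by exact: mulr_ge0.
have tailD : \int[m]_x (M * (H x * \1_D x))%:E <= (M * (heat_tail_cst n d * t))%:E.
  under eq_integral do rewrite EFinM.
  rewrite ge0_integralZl_EFin//; last 2 first.
  - by move=> x _; rewrite lee_fin HI0.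
  - by apply/measurable_EFinP; apply: measurable_funM; [exact/measurable_EFinP|exact: measurable_indic].
  rewrite EFinM lee_wpmul2l ?lee_fin//.
  have tl : \int[m]_(x in D) (H x)%:E <= (heat_tail_cst n d * t)%:E.
    by apply: integral_heat_tail.
  apply: le_trans tl; rewrite [leRHS]integral_mkcond epatch_indic.
  by rewrite le_eqVlt; apply/orP; left; apply/eqP; apply: eq_integral => x _.
have cstH (c : R) : (0 <= c)%R -> \int[m]_x (c * H x)%:E = c%:E.
  move=> c0; under eq_integral do rewrite EFinM.
  by rewrite ge0_integralZl_EFin// ?integral_heat ?mule1// => x _; rewrite lee_fin.
have mcH (c : R) : measurable_fun setT (fun x => (c * H x)%:E).
  by apply/measurable_EFinP; apply: measurable_funM => //; exact/measurable_EFinP.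
have split_x x : (`|h y - h x| <= e)%R \/ (\1_D x = 1 :> R)%R.
  have [xd|xd] := ltP `|y - x|%R d; [left; exact: hd|right].
  by rewrite indicE mem_set.
split.
- have c0 : (0 <= h y + e)%R by rewrite addr_ge0// ltW.
  rewrite EFinD -(cstH _ c0).
  apply: le_trans (leeD (lexx _) tailD).
  rewrite -ge0_integralD//; last 2 first.
  + by move=> x _; rewrite lee_fin mulr_ge0.
  + by move=> x _; rewrite lee_fin.
  apply: ge0_le_integral.
  + exact: measurableT.
  + by move=> x _; rewrite lee_fin mulr_ge0// heat_ge0.
  + exact: mhH.
  + by apply: emeasurable_funD.
  + move=> x _; rewrite -EFinD lee_fin -/(H x).
    have Hx := H0 x; have hx := hM x; have hy := h0 y.
    case: (split_x x) => [|->].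
      by rewrite ler_norml => /andP[h1 h2]; have := HD0 x; nra.
    by rewrite mulr1; nra.
- rewrite -(cstH _ (h0 y)).
  apply: (@le_trans _ _ (heat_average t y +
      (\int[m]_x (e * H x)%:E + \int[m]_x (M * (H x * \1_D x))%:E))).
    rewrite /heat_average -ge0_integralD//; last 2 first.
    + by move=> x _; rewrite lee_fin mulr_ge0// ltW.
    + by move=> x _; rewrite lee_fin.
    rewrite -ge0_integralD//; last 3 first.
    + by move=> x _; rewrite lee_fin mulr_ge0// heat_ge0.
    + by move=> x _; rewrite -EFinD lee_fin addr_ge0// mulr_ge0// ltW.
    + exact: emeasurable_funD.
    apply: ge0_le_integral.
    + exact: measurableT.
    + by move=> x _; rewrite lee_fin mulr_ge0.
    + exact: mcH.
    + by apply: emeasurable_funD => //; exact: emeasurable_funD.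
    + move=> x _; rewrite -!EFinD lee_fin -/(H x).
      have Hx := H0 x; have hx := h0 x; have hy := hM y.
      case: (split_x x) => [|->].
        by rewrite ler_norml => /andP[h1 h2]; have := HD0 x; nra.
      by rewrite mulr1; nra.
  by rewrite (cstH e (ltW e0)) EFinD; apply: leeD => //; exact: leeD.
Qed.


Lemma heat_average_cvg (y : rV) : heat_average (harmonic j) y @[j --> \oo] --> (h y)%:E.
Proof.
have fin j : heat_average (harmonic j) y \is a fin_num.
  rewrite ge0_fin_numE ?heat_average_ge0//.
  exact: le_lt_trans (heat_average_le y (harmonic_gt0 j)) (ltry _).
apply/fine_cvgP; split; first exact: nearW.
apply/cvgrPdist_le => e e0.
have e20 : (0 < e / 2)%R by rewrite divr_gt0.
have chy : h x @[x --> y] --> h y by exact: ch.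
have /cvgrPdist_le/(_ _ e20)/nbhs_ballP[d /= d0 hd] := chy.
have hd' x : (`|y - x| < d)%R -> (`|h y - h x| <= e / 2)%R.
  by move=> yx; apply: hd; rewrite -ball_normE.
have Ccvg : ((M * heat_tail_cst n d) * harmonic j)%R @[j --> \oo] --> (0 : R)%R.
  rewrite -[X in _ --> X](mulr0 (M * heat_tail_cst n d)%R).
  by apply: cvgMr; exact: cvg_harmonic.
move/cvgrPdist_le : Ccvg => /(_ _ e20); apply: filterS => j.
rewrite sub0r normrN => Cj.
have Cj' : (M * (heat_tail_cst n d * harmonic j) <= e / 2)%R.
  by rewrite mulrA; exact: le_trans (ler_norm _) Cj.
have [] := heat_average_near (harmonic_gt0 j) d0 e20 hd'.
rewrite -(fineK (fin j)) -EFinD !lee_fin /= => u l; rewrite /harmonic /= in Cj'.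
move: Cj' u l; move: (M * _)%R (fine _) (h y) => T F c Cj' u l.
by rewrite ler_norml; apply/andP; split; lra.
Qed.

Lemma measurable_heat_average t : measurable_fun setT (heat_average t).
Proof.
apply: (@measurable_integral_radon R n _ _ m
  (fun (y x : rV) => (h x * heat t (y - x))%:E)) => //.
- exact: radon_lebesgue.
- apply/measurable_EFinP; apply: measurable_funM.
    exact: (measurableT_comp mh measurable_snd).
  apply: measurable_heat; first exact: measurable_cst.
  by apply: measurable_funB_rV; [exact: measurable_fst|exact: measurable_snd].
- by move=> y x; rewrite lee_fin mulr_ge0// heat_ge0.
Qed.

Lemma integral_heat_average_cvg q : q setT < +oo ->
  \int[q]_y heat_average (harmonic j) y @[j --> \oo] --> \int[q]_y (h y)%:E.
Proof.
move=> qT; have [] // := @dominated_convergence _ _ _ q setT measurableT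
  (fun j => heat_average (harmonic j)) (EFin \o h) (cst M%:E).
- by move=> j; exact: measurable_heat_average.
- exact/measurable_EFinP.
- by apply: aeW => y _; exact: heat_average_cvg.
- apply/integrableP; split; first exact: measurable_cst.
  rewrite integral_cst// lte_mul_pinfty//.
- apply: aeW => y j _.
  by rewrite gee0_abs ?heat_average_ge0// heat_average_le ?harmonic_gt0.
Qed.

Lemma integral_heat_flow q t : radon q ->
  \int[m]_x ((h x)%:E * heatp t q x) = \int[q]_y heat_average t y.
Proof.
move=> rq; transitivity (\int[m]_x \int[q]_y (h x * heat t (y - x))%:E).
  apply: eq_integral => x _.
  have Hx0 (y : rV) : setT y -> 0 <= (heat t (x - y))%:E.
    by move=> _; rewrite lee_fin heat_ge0.
  have <- := ge0_integralZl_EFin q measurableT Hx0 (measurable_heatB t x) (h0 x).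
  by apply: eq_integral => y _; rewrite -EFinM heat_sym.
apply: (tonelli_radon
  (f := fun x y => (h x * heat t (y - x))%:E) (@radon_lebesgue R n) rq).
- apply/measurable_EFinP; apply: measurable_funM.
    exact: (measurableT_comp mh measurable_fst).
  apply: measurable_heat; first exact: measurable_cst.
  by apply: measurable_funB_rV; [exact: measurable_snd|exact: measurable_fst].
- by move=> x y; rewrite lee_fin mulr_ge0// heat_ge0.
Qed.

End average.

(** The heat flow of a finite measure is tame. *)
Lemma heat_flow_tame q t : radon q -> q setT < +oo -> (0 < t)%R ->
  exists p, tame p /\ forall (h : rV -> R), continuous h -> (forall x, (0 <= h x)%R) ->
    \int[p]_x (h x)%:E = \int[q]_y heat_average h t y.
Proof.
move=> rq qT t0.
pose M := fine (((4 * pi) `^ (- (n%:R / 2)) * pw (- (n%:R / 2)) t)%:E * q setT).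
have qTfin : q setT \is a fin_num by rewrite ge0_fin_numE.
have HM x : heatp t q x <= M%:E.
  rewrite fineK ?fin_numM//; exact: heatp_le_mass.
have fin x : heatp t q x \is a fin_num.
  by rewrite ge0_fin_numE ?heatp_ge0//; exact: le_lt_trans (HM x) (ltry _).
pose g x := fine (heatp t q x).
have mH : measurable_fun setT (heatp t q).
  by apply: measurable_heatp => //; exact: measurable_cst.
have mg : measurable_fun setT g by exact: (measurableT_comp _ mH).
have g0 x : (0 <= g x)%R by rewrite fine_ge0 ?heatp_ge0.
have gM x : (g x <= M)%R by rewrite -lee_fin fineK.
have gE x : (g x)%:E = heatp t q x by rewrite fineK.
exists (density m mg g0); split.
  split; last by exists M; [exact: le_trans (g0 0%R) (gM 0%R)|exact: dominated_density].
  rewrite /= /density; under eq_integral do rewrite gE.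
  by rewrite integral_heatp.
move=> h ch h0; rewrite ge0_integral_density//; last first.
  by apply/measurable_EFinP; exact: continuous_measurable_rV.
rewrite -integral_heat_flow//; apply: eq_integral => x _.
by rewrite gE muleC.
Qed.

End heat_regularization.

Section vague_density.
Context (R : realType) (n : nat).
Local Notation rV := 'rV[R]_n.
Implicit Types (p q s t : {measure set rV -> \bar R}) (f : Cc R n).
Implicit Types mu nu : signed_radon R n.

Lemma Cc_bounded f : exists M k, [/\ 0 <= M, forall x, `|sval f x| <= M &
  forall x, ~ oball k x -> sval f x = 0].
Proof.
case: f => f /= [cf [K cK fK]].
have [k Kk] : exists k, K `<=` @oball R n k.
  have [A [_ KA]] := compact_bounded cK.
  have A1 : A < `|A| + 1 by apply: le_lt_trans (ler_norm A) _; rewrite ltrDl.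
  have Kb := KA _ A1; exists (Num.trunc (`|A| + 1)).+1 => x /Kb /= xA.
  by rewrite /oball -ball_normE/= sub0r normrN; apply: le_lt_trans xA (truncnS_gt _).
have [B [_ fB]] := compact_bounded (continuous_compact (continuous_subspaceT cf) cK).
have B1 : B < `|B| + 1 by apply: le_lt_trans (ler_norm B) _; rewrite ltrDl.
have fB' := fB _ B1.
exists (`|B| + 1), k; split => [|x|x xk].
- by rewrite addr_ge0.
- have [Kx|Kx] := pselect (K x); first by apply: fB'; exists x.
  by rewrite fK// normr0 addr_ge0.
- by apply: fK => /Kk.
Qed.

(** The positive and the negative part of a real function. *)
Definition posp (f : rV -> R) x := Num.max (f x) 0.
Definition negp (f : rV -> R) x := Num.max (- f x) 0.

Lemma posp_ge0 (f : rV -> R) x : 0 <= posp f x.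
Proof. by rewrite /posp le_max lexx orbT. Qed.

Lemma negp_ge0 (f : rV -> R) x : 0 <= negp f x.
Proof. by rewrite /negp le_max lexx orbT. Qed.

Lemma continuous_posp (f : rV -> R) : continuous f -> continuous (posp f).
Proof. by move=> cf x; apply: continuous_max; [exact: cf|exact: cst_continuous]. Qed.

Lemma continuous_negp (f : rV -> R) : continuous f -> continuous (negp f).
Proof.
move=> cf; apply: (@continuous_posp (fun x => - f x)) => x.
by apply: continuousN; exact: cf.
Qed.

Local Open Scope ereal_scope.

Lemma integral_bounded_support p (h : rV -> R) M k : radon p ->
  (0 <= M)%R -> (forall x, 0 <= h x <= M)%R -> (forall x, ~ oball k x -> h x = 0%R) ->
  measurable_fun setT h -> \int[p]_x (h x)%:E \is a fin_num.
Proof.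
move=> rp M0 hM hk mh; rewrite ge0_fin_numE; last first.
  by apply: integral_ge0 => x _; rewrite lee_fin; case/andP: (hM x).
have mo := @measurable_oball R n k.
apply: (@le_lt_trans _ _ (\int[p]_(x in oball k) M%:E)); last first.
  by rewrite integral_cst// lte_mul_pinfty// radon_oball.
rewrite [leRHS]integral_mkcond epatch_indic.
apply: ge0_le_integral.
- exact: measurableT.
- by move=> x _; rewrite lee_fin; case/andP: (hM x).
- exact/measurable_EFinP.
- by apply/measurable_EFinP; apply: measurable_funM => //; exact: measurable_indic.
- move=> x _ /=; rewrite -EFinM lee_fin indicE.
  have [xk|xk] := pselect (oball k x).
    by rewrite mem_set// mulr1; case/andP: (hM x).
  by rewrite memNset// mulr0 hk.
Qed.

Section one_function.
Variable f : Cc R n.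

Let cf : continuous (sval f). Proof. by have [] := svalP f. Qed.
Let cpos := continuous_posp cf.
Let cneg := continuous_negp cf.
Let mpos := continuous_measurable_rV cpos.
Let mneg := continuous_measurable_rV cneg.

Lemma Cc_parts : exists M k, [/\ (0 <= M)%R,
  forall x, (0 <= posp (sval f) x <= M)%R, forall x, (0 <= negp (sval f) x <= M)%R &
  forall x, ~ oball k x -> posp (sval f) x = 0%R /\ negp (sval f) x = 0%R].
Proof.
have [M [k [M0 fM fk]]] := Cc_bounded f.
exists M, k; split => // [x|x|x /fk].
- by rewrite posp_ge0 /posp ge_max M0 andbT (le_trans (ler_norm _)).
- by rewrite negp_ge0 /negp ge_max M0 andbT (le_trans (ler_norm _))// normrN.
- by rewrite /posp /negp => ->; rewrite oppr0 maxxx.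
Qed.

Lemma fin_posp p : radon p -> \int[p]_x (posp (sval f) x)%:E \is a fin_num.
Proof.
move=> rp; have [M [k [M0 fp _ fk]]] := Cc_parts.
by apply: (@integral_bounded_support p _ M k) => // x /fk[].
Qed.

Lemma fin_negp p : radon p -> \int[p]_x (negp (sval f) x)%:E \is a fin_num.
Proof.
move=> rp; have [M [k [M0 _ fn fk]]] := Cc_parts.
by apply: (@integral_bounded_support p _ M k) => // x /fk[].
Qed.

Lemma Rintegral_Cc p : radon p -> (\int[p]_x sval f x)%R =
  (fine (\int[p]_x (posp (sval f) x)%:E) - fine (\int[p]_x (negp (sval f) x)%:E))%R.
Proof.
move=> rp; rewrite -fineB ?fin_posp ?fin_negp// /Rintegral integralE.
congr (fine (_ - _)); apply: eq_integral => x _.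
  by rewrite funeposE /posp EFin_max.
by rewrite funenegE /negp EFin_max.
Qed.

(** The hypothesis is $s - t = p - q$, written without subtraction since all four
measures may be infinite. *)
Lemma Rintegral_balance s t p q : radon s -> radon t -> radon p -> radon q ->
  (forall A, measurable A -> s A + q A = t A + p A) ->
  (\int[s]_x sval f x - \int[t]_x sval f x)%R =
  (\int[p]_x sval f x - \int[q]_x sval f x)%R.
Proof.
move=> rs rt rp rq st; rewrite !Rintegral_Cc//.
have e1 : \int[s]_x (posp (sval f) x)%:E + \int[q]_x (posp (sval f) x)%:E =
    \int[t]_x (posp (sval f) x)%:E + \int[p]_x (posp (sval f) x)%:E.
  apply: ge0_integral_balance => //; first exact/measurable_EFinP.
  by move=> x; rewrite lee_fin posp_ge0.
have e2 : \int[s]_x (negp (sval f) x)%:E + \int[q]_x (negp (sval f) x)%:E =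
    \int[t]_x (negp (sval f) x)%:E + \int[p]_x (negp (sval f) x)%:E.
  apply: ge0_integral_balance => //; first exact/measurable_EFinP.
  by move=> x; rewrite lee_fin negp_ge0.
move: e1 e2 (fin_posp rs) (fin_posp rt) (fin_posp rp) (fin_posp rq)
  (fin_negp rs) (fin_negp rt) (fin_negp rp) (fin_negp rq).
move: (\int[s]_x _) (\int[t]_x _) (\int[p]_x _) (\int[q]_x _).
move=> [a| |] [b| |] [c| |] [d| |]//.
move: (\int[s]_x _) (\int[t]_x _) (\int[p]_x _) (\int[q]_x _).
move=> [a'| |] [b'| |] [c'| |] [d'| |]// [e1] [e2] _ _ _ _ _ _ _ _ /=; lra.
Qed.

Lemma Rintegral_heat_flow_cvg q (p : nat -> {measure set rV -> \bar R}) :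
  radon q -> q setT < +oo -> (forall j, radon (p j)) ->
  (forall j (h : rV -> R), continuous h -> (forall x, (0 <= h x)%R) ->
    \int[p j]_x (h x)%:E = \int[q]_y heat_average h (harmonic j) y) ->
  (\int[p j]_x sval f x)%R @[j --> \oo] --> (\int[q]_x sval f x)%R.
Proof.
move=> rq qT rp pE; rewrite Rintegral_Cc//.
under eq_fun do rewrite Rintegral_Cc//.
have [M [k [M0 fp fn fk]]] := Cc_parts.
have fp0 x := posp_ge0 (sval f) x; have fn0 x := negp_ge0 (sval f) x.
have fpM x : (posp (sval f) x <= M)%R by case/andP: (fp x).
have fnM x : (negp (sval f) x <= M)%R by case/andP: (fn x).
have cv (h : rV -> R) : continuous h -> (forall x, 0 <= h x)%R ->
    (forall x, h x <= M)%R -> \int[q]_x (h x)%:E \is a fin_num ->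
    fine (\int[p j]_x (h x)%:E) @[j --> \oo] --> fine (\int[q]_x (h x)%:E).
  move=> ch h0 hM fin; apply: fine_cvg; rewrite fineK//.
  have -> : (fun j => \int[p j]_x (h x)%:E) =
      (fun j => \int[q]_y heat_average h (harmonic j) y).
    by apply/funext => j; exact: pE.
  exact (integral_heat_average_cvg ch h0 hM qT).
by apply: cvgB; apply: cv => //; [exact: fin_posp|exact: fin_negp].
Qed.

Lemma Rintegral_restrict (mu : {measure set rV -> \bar R}) (k : nat) q : radon mu -> radon q ->
  (forall x, ~ oball k x -> sval f x = 0%R) ->
  (forall h : rV -> \bar R, measurable_fun setT h -> (forall x, 0 <= h x) ->
      \int[q]_x h x = \int[mu]_(x in oball k) h x) ->
  (\int[q]_x sval f x)%R = (\int[mu]_x sval f x)%R.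
Proof.
move=> rmu rq fk qE; rewrite !Rintegral_Cc//.
have restrict (h : rV -> R) : measurable_fun setT h -> (forall x, 0 <= h x)%R ->
    (forall x, ~ oball k x -> h x = 0%R) ->
    \int[q]_x (h x)%:E = \int[mu]_x (h x)%:E.
  move=> mh h0 hk; rewrite qE; last 2 first.
  - exact/measurable_EFinP.
  - by move=> x; rewrite lee_fin.
  rewrite integral_mkcond; apply: eq_integral => x _; rewrite patchE.
  by case: ifPn => // /negP xk; rewrite hk// => /mem_set.
rewrite !restrict//.
- exact: negp_ge0.
- by move=> x /fk; rewrite /negp => ->; rewrite oppr0 maxxx.
- exact: posp_ge0.
- by move=> x /fk; rewrite /posp => ->; rewrite maxxx.
Qed.

End one_function.

(** The functionals on $C_c$ given by the signed measures with tame parts. *)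
Definition tame_functional : set {ptws Cc R n -> R} :=
  [set L | exists nu, [/\ tame (mu_pos nu), tame (mu_neg nu) &
    L = @signed_integral R n nu]].

Lemma closure_cvg_seq (L_ : nat -> {ptws Cc R n -> R}) (L : {ptws Cc R n -> R})
    (S : set {ptws Cc R n -> R}) :
  (forall j, closure S (L_ j)) -> (forall f, L_ j f @[j --> \oo] --> L f) ->
  closure S L.
Proof.
move=> SL cvL.
have cvL' : L_ @ \oo --> L.
  apply/cvg_sup => f U [V] [[W] oW <-] WL WU; apply: (filterS WU).
  by apply: (cvL f); apply: open_nbhs_nbhs.
by apply: (closed_cvg (closure S) (@closed_closure _ S)) cvL'; exact: nearW.
Qed.

(** The heat flows of $q_1$ and $q_2$ at the times $1 / (j + 1)$ converge to $q_1$
and $q_2$. *)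
Lemma finite_difference_closure q1 q2 : radon q1 -> radon q2 ->
  q1 setT < +oo -> q2 setT < +oo ->
  closure tame_functional
    (fun f => \int[q1]_x sval f x - \int[q2]_x sval f x)%R.
Proof.
move=> r1 r2 f1 f2.
have /choice[p1 p1E] j := heat_flow_tame r1 f1 (@harmonic_gt0 R j).
have /choice[p2 p2E] j := heat_flow_tame r2 f2 (@harmonic_gt0 R j).
have /choice[nu nuE] j := exists_tame_signed (p1E j).1 (p2E j).1.
apply: (@closure_cvg_seq (fun j => @signed_integral R n (nu j))) => [j|f].
  by apply: subset_closure; exists (nu j); have [] := nuE j.
have rp1 j : radon (p1 j) by apply: tame_radon; have [] := p1E j.
have rp2 j : radon (p2 j) by apply: tame_radon; have [] := p2E j.
have e j : @signed_integral R n (nu j) f =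
    (\int[p1 j]_x sval f x - \int[p2 j]_x sval f x)%R.
  apply: Rintegral_balance => //; [exact: mu_pos_radon|exact: mu_neg_radon|].
  by have [] := nuE j.
under eq_fun do rewrite e.
apply: cvgB; apply: Rintegral_heat_flow_cvg => // j; first by have [] := p1E j.
by have [] := p2E j.
Qed.

(** On a given function of $C_c$, the restriction of $\mu$ to a large ball agrees
with $\mu$. *)
Lemma vague_closure mu : closure tame_functional (@signed_integral R n mu).
Proof.
have mo k := @measurable_oball R n k.
have /choice[q1 q1E] k := restricted_measure (mu_pos mu) (mo k).
have /choice[q2 q2E] k := restricted_measure (mu_neg mu) (mo k).
have restrict (r : {measure set rV -> \bar R}) q k : radon r ->
    (forall B, measurable B -> q B = r (oball k `&` B)) ->
    radon q /\ q setT < +oo.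
  move=> rr qE; have qT : q setT < +oo by rewrite qE// setIT radon_oball.
  split=> // K cK; apply: le_lt_trans qT.
  by apply: le_measure; rewrite ?inE//; exact: compact_measurable_rV.
have h1 k := restrict _ _ _ (mu_pos_radon mu) (q1E k).1.
have h2 k := restrict _ _ _ (mu_neg_radon mu) (q2E k).1.
apply: (@closure_cvg_seq (fun k f =>
    (\int[q1 k]_x sval f x - \int[q2 k]_x sval f x)%R)) => [k|f].
  by have [? ?] := h1 k; have [? ?] := h2 k; exact: finite_difference_closure.
have [M [k0 [_ _ fk0]]] := Cc_bounded f.
apply: cvg_near_cst; near=> k.
have fk x : ~ oball k x -> sval f x = 0%R.
  move=> xk; apply: fk0 => xk0; apply: xk; move: xk0.
  rewrite /oball -ball_normE /= => /lt_le_trans; apply.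
  by rewrite ler_nat; near: k; exact: nbhs_infty_ge.
rewrite /signed_integral; congr (_ - _)%R.
  by apply: (Rintegral_restrict (mu_pos_radon mu) (h1 k).1 fk) => h mh h0; apply (q1E k).2.
by apply: (Rintegral_restrict (mu_neg_radon mu) (h2 k).1 fk) => h mh h0; apply (q2E k).2.
Unshelve. all: by end_near. Qed.

End vague_density.

(** * Density of the bounded measures of finite energy *)

Theorem theorem4p2 (R : realType) (n : nat) (alpha : R) :
  (3 <= n)%N -> 0 < alpha -> alpha <= 2 ->
  dense ([set mu | bounded_energy_space n alpha (val mu)] :
           set (weak_norm_space n alpha)) /\
  dense ([set mu | bounded_energy_space n alpha (val mu)] :
           set (weak_vague_space n alpha)).
Proof.
move=> n3 a0 a2.
have n3R : 3 <= n%:R :> R by rewrite (ler_nat R 3).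
have an : alpha < n%:R by lra.
split=> O [mu Omu] oO.
- have [e e0 eO] : exists2 e : R, 0 < e & forall nu : weak_norm_space n alpha,
      (weak_norm alpha (signed_radon_sub (val nu) (val mu)) < e%:E)%E -> O nu.
    exact: (oO mu Omu).
  have [nu [tP tN nue]] := weak_norm_density n3 a0 a2 (set_valP mu) e0.
  have wnu := tame_weak_energy n3 a0 a2 tP tN.
  exists (SigSub (mem_set wnu)); split; first exact: eO.
  exact: tame_bounded_energy.
- have [V [W oW WV] VO] := oO.
  have /(_ W) := @vague_closure R n (val mu).
  have WL : nbhs (@signed_integral R n (val mu) : {ptws Cc R n -> R}) W.
    by apply: open_nbhs_nbhs; split => //; move: Omu; rewrite -VO /= -WV.
  move=> /(_ WL) [_ [[nu [tP tN ->]] Wnu]].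
  have wnu := tame_weak_energy n3 a0 a2 tP tN.
  exists (SigSub (mem_set wnu)); split; last exact: tame_bounded_energy.
  by rewrite -VO /= -WV.
Qed.
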